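(* Consider $dy_t=S(t)dt+d\xi_t$, $0\le t\le n$, with noise distribution in a family $\mathcal{Q}_n$ satisfying: $\mathcal{Q}_n\subseteq\{Q:\ \mathbf{L}_{1,n}(Q)+\mathbf{L}_{2,n}(Q)\le l_n\}$, and $$0<\varsigma_*:=\inf_{Q\in\mathcal{Q}_n}\varsigma_Q\le\sup_{Q\in\mathcal{Q}_n}\varsigma_Q=:\varsigma^*<\infty,\qquad \sigma^*:=\sup_{Q\in\mathcal{Q}_n}\sigma_Q<\infty .$$ Assume that $S$ is continuously differentiable (for $0\le t<1$) with $|\dot S|_1=\int_0^1|\dot S(t)|dt<+\infty$. Then for any $n\ge1$ and $0<\rho<1/3$ the model selection procedure $\widehat S_*$ with finite weight set $\Gamma$ ($\nu=\mathrm{card}(\Gamma)$, $\mu=\max_{\gamma\in\Gamma}\#(\gamma)$), penalty coefficient $\rho$, and $\widehat\sigma_n=\sum_{j=l}^n\widehat\theta_{j,n}^2$, $l=[\sqrt n]+1$, satisfies $$\mathcal{R}^*_n(\widehat S_*,S)\le\frac{1+3\rho-2\rho^2}{1-3\rho}\min_{\gamma\in\Gamma}\mathcal{R}^*_n(\widehat S_\gamma,S)+\frac1n\mathcal{B}^*_1(n,\rho),\qquad \mathcal{B}^*_1(n,\rho)=\Psi^*(n,\rho)+\frac{6\mu\,\kappa^*_n(S)}{(1-3\rho)\sqrt n},$$ where $$\Psi^*(n,\rho)=\frac{2\varsigma^*\sigma^*\nu+4\varsigma^*l_n+2\nu l_n}{\varsigma_*\,\rho\,(1-3\rho)},\qquad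 \kappa^*_n(S)=4|\dot S|_1^2+\varsigma^*+\sqrt{l_n}+\frac{4|\dot S|_1\sqrt{\sigma^*}}{n^{1/4}}+\frac{l_n}{n^{1/2}}.$$
   Context: Model: $n$ is a positive integer, $S$ is an unknown 1-periodic function in $L_2[0,1]$, and $(\xi_t)_{0\le t\le n}$ is an unobservable semimartingale with values in the Skorokhod space $\mathcal{D}[0,n]$ whose distribution $Q$ belongs to a family $\mathcal{Q}_n$ of probability measures on $\mathcal{D}[0,n]$. For every $Q\in\mathcal{Q}_n$ and $f\in L_2[0,n]$ the integral $I_n(f)=\int_0^nf_s\,d\xi_s$ is well defined with $\mathbf{E}_QI_n(f)=0$ and $\mathbf{E}_QI_n^2(f)\le\sigma_Q\int_0^nf_s^2ds$, for a constant $\sigma_Q>0$ attached to $Q$. $\mathbf{E}_{Q,S}$ is expectation under the law of $(y_t)_{0\le t\le n}$. Risks: $\mathcal{R}_Q(\widehat S,S)=\mathbf{E}_{Q,S}\|\widehat S-S\|^2$ with $\|f\|^2=\int_0^1f^2(t)dt$, and robust risk $\mathcal{R}^*_n(\widehat S,S)=\sup_{Q\in\mathcal{Q}_n}\mathcal{R}_Q(\widehat S,S)$. Basis: $\phi_1=1$ and, for $j\ge2$, $\phi_j(x)=\sqrt2\cos(2\pi[j/2]x)$ for even $j$, $\sqrt2\sin(2\pi[j/2]x)$ for odd $j$ ($[\cdot]$ integer part). $\xi_{j,n}=n^{-1/2}I_n(\phi_j)$. For a sequence $x=(x_j)$, $|x|^2=\sum_jx_j^2$, $\#(x)=\sum_j\mathbf{1}_{\{|x_j|>0\}}$.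 To each $Q$ is attached a constant $\varsigma_Q>0$ with $$\mathbf{L}_{1,n}(Q)=\sup_{x\in[-1,1]^\infty,\ \#(x)\le n}\Bigl|\sum_{j\ge1}x_j(\mathbf{E}_Q\xi_{j,n}^2-\varsigma_Q)\Bigr|<\infty,\qquad \mathbf{L}_{2,n}(Q)=\sup_{|x|\le1,\ \#(x)\le n}\mathbf{E}_Q\Bigl(\sum_{j\ge1}x_j(\xi_{j,n}^2-\mathbf{E}_Q\xi_{j,n}^2)\Bigr)^2<\infty .$$ $(l_n)$ is a fixed positive increasing sequence with $l_n\to\infty$ and $l_n/n^\delta\to0$ for every $\delta>0$. Estimators: $\widehat\theta_{j,n}=\frac1n\int_0^n\phi_j(t)dy_t$. $\Gamma$ is a finite set of weight sequences $\gamma=(\gamma(j))_{j\ge1}$ with $0\le\gamma(j)\le1$, $0<\#(\gamma)\le n$. $\widehat S_\gamma=\sum_{j\ge1}\gamma(j)\widehat\theta_{j,n}\phi_j$; $\widetilde\theta_{j,n}=\widehat\theta_{j,n}^2-\widehat\sigma_n/n$; $\widehat P_n(\gamma)=\widehat\sigma_n|\gamma|^2/n$; $J_n(\gamma)=\sum_j\gamma^2(j)\widehat\theta_{j,n}^2-2\sum_j\gamma(j)\widetilde\theta_{j,n}+\rho\widehat P_n(\gamma)$. $\widehat\gamma$ is a minimizer of $J_n$ over $\Gamma$ and $\widehat S_*=\widehat S_{\widehat\gamma}$. *)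

(* Defs.v *)
From HB Require Import structures.
From mathcomp Require Import all_boot all_order all_algebra finmap.
From mathcomp Require Import all_classical all_reals all_analysis.

Set Implicit Arguments.
Unset Strict Implicit.
Unset Printing Implicit Defensive.

Import Order.TTheory GRing.Theory Num.Theory.
Import numFieldNormedType.Exports.

Local Open Scope classical_set_scope.
Local Open Scope ring_scope.

Section SkorokhodSpace.
Context {R : realType}.
Implicit Types T : R.

Definition cadlag T (w : R -> R) : Prop :=
  (forall t, 0 <= t < T -> w @ t^'+ --> w t) /\
  (forall t, 0 < t <= T -> cvg (w @ t^'-)).

(* An element of D[0,T] is represented by its extension by 0 to the whole
   line, so that two paths are equal as soon as they agree on [0,T]. *)
Record path_space T := PathSpace {
  path_fun :> R -> R;
  path_cadlag : cadlag T path_fun;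
  path_out : forall t, ~~ (0 <= t <= T) -> path_fun t = 0 }.

Lemma cadlag0 T : cadlag T (fun=> 0).
Proof. by split=> t _; [exact: cvg_cst|exact: is_cvg_cst]. Qed.

Definition path0 T : path_space T := PathSpace (@cadlag0 T) (fun _ _ => erefl).

HB.instance Definition _ T := gen_eqMixin (path_space T).
HB.instance Definition _ T := gen_choiceMixin (path_space T).
HB.instance Definition _ T := isPointed.Build (path_space T) (path0 T).

Definition cylinders T : set (set (path_space T)) :=
  [set C | exists t (B : set R), [/\ 0 <= t <= T, measurable B &
                                    C = [set w : path_space T | B (w t)]]].

(* The sigma-algebra generated by the coordinates is the Borel sigma-algebra
   of the Skorokhod topology. *)
Definition skorokhod T : measurableType _ :=
  g_sigma_algebraType (@cylinders T).

Definition coord T (w : skorokhod T) : R -> R := path_fun w.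

End SkorokhodSpace.

Section Semimartingale.
Context {R : realType} {d : measure_display} {Omega : measurableType d}.
Variables (P : probability Omega R) (T : R) (F : R -> set (set Omega)).
Implicit Types (X M A : Omega -> R -> R) (tau : Omega -> R).

Definition usual_filtration : Prop :=
  [/\ forall t, 0 <= t <= T -> sigma_algebra setT (F t) /\ F t `<=` measurable,
      forall s t, 0 <= s -> s <= t -> t <= T -> F s `<=` F t,
      forall t, 0 <= t < T -> F t = \bigcap_(s in `]t, T]) F s &
      forall N, P.-negligible N -> F 0 N].

Definition adapted X : Prop :=
  forall t (B : set R), 0 <= t <= T -> measurable B ->
    F t [set w | B (X w t)].

Definition martingale M : Prop :=
  [/\ adapted M,
      forall t, 0 <= t <= T -> P.-integrable setT (fun w => (M w t)%:E) &
      forall s t (E : set Omega), 0 <= s -> s <= t -> t <= T -> F s E ->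
        (\int[P]_(w in E) (M w t)%:E = \int[P]_(w in E) (M w s)%:E)%E].

Definition stopping_time tau : Prop :=
  (forall w, 0 <= tau w) /\
  (forall t, 0 <= t <= T -> F t [set w | tau w <= t]).

Definition local_martingale M : Prop :=
  adapted M /\
  exists tau : nat -> Omega -> R,
    [/\ forall k, stopping_time (tau k),
        forall k w, tau k w <= tau k.+1 w,
        {ae P, forall w, exists k, T <= tau k w} &
        forall k, martingale (fun w t => M w (Num.min t (tau k w)))].

Definition semimartingale X : Prop :=
  [/\ usual_filtration, adapted X, forall w, cadlag T (X w) &
    exists M A : Omega -> R -> R,
      [/\ local_martingale M /\ adapted A,
          forall w, cadlag T (M w) /\ cadlag T (A w),
          forall w, M w 0 = 0 /\ A w 0 = 0,
          forall w, bounded_variation 0 T (A w) &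
          forall w t, 0 <= t <= T -> X w t = X w 0 + M w t + A w t]].

End Semimartingale.

(* The filtered space carrying the process is existentially quantified: by the
   theorem of Stricker nothing is lost in comparison with the augmented
   filtration of the coordinate process. *)
Definition semimartingale_law (R : realType) (T : R)
    (Q : probability (skorokhod T) R) : Prop :=
  exists (d : measure_display) (Omega : measurableType d)
         (P : probability Omega R) (F : R -> set (set Omega))
         (X : Omega -> skorokhod T),
    [/\ measurable_fun setT X,
        forall B, measurable B -> P (X @^-1` B) = Q B &
        semimartingale P T F (fun w => coord (X w))].

Definition L2_on (R : realType) (a b : R) (f : R -> R) : Prop :=
  measurable_fun `[a, b] f /\
  (\int[lebesgue_measure]_(t in `[a, b]) (f t ^+ 2)%:E < +oo)%E.

(* A step function sum_i c_i 1_{(a_i, b_i]} is given by the list of its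
   triples (c_i, (a_i, b_i)). *)
Section StochasticIntegral.
Context {R : realType}.
Implicit Types s : seq (R * (R * R)).

Definition is_step (T : R) s : Prop :=
  all (fun p => [&& 0 <= p.2.1, p.2.1 <= p.2.2 & p.2.2 <= T]) s.

Definition step_fun s (t : R) : R :=
  \sum_(p <- s) p.1 * (p.2.1 < t <= p.2.2)%R%:R.

Definition step_int s (x : R -> R) : R :=
  \sum_(p <- s) p.1 * (x p.2.2 - x p.2.1).

(* Z is (a version of) int_0^T f dX, for a deterministic f in L2[0,T]: it is
   the L2(P)-limit of the elementary integrals of the step functions s, as
   s tends to f in L2[0,T]. *)
Definition is_stoch_int (d : measure_display) (Omega : measurableType d)
    (P : probability Omega R) (T : R) (X : Omega -> R -> R)
    (f : R -> R) (Z : Omega -> R) : Prop :=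
  measurable_fun setT Z /\
  forall e : R, 0 < e -> exists2 delta : R, 0 < delta &
    forall s, is_step T s ->
      (\int[lebesgue_measure]_(t in `[0%R, T])
          ((f t - step_fun s t) ^+ 2)%:E < delta%:E)%E ->
      ('E_P[fun w => ((step_int s (X w) - Z w) ^+ 2)%R] < e%:E)%E.

Definition stoch_int (T : R) (Q : probability (skorokhod T) R) (f : R -> R)
    : skorokhod T -> R :=
  xget (fun=> 0) [set Z | is_stoch_int Q T (@coord R T) f Z].

End StochasticIntegral.

Section Model.
Context {R : realType} (n : nat).

Notation D := (skorokhod (n%:R : R)).
Notation law := (probability D R).
Implicit Types (Q : law) (x g th : nat -> R) (S f : R -> R).

Definition noise_condition Q (sigmaQ : R) : Prop :=
  0 < sigmaQ /\
  forall f, L2_on 0 n%:R f ->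
    [/\ exists Z, is_stoch_int Q n%:R (@coord R n%:R) f Z,
        ('E_Q[stoch_int Q f] = 0)%E &
        ('E_Q[fun w => (stoch_int Q f w ^+ 2)%R] <=
         sigmaQ%:E *
         \int[lebesgue_measure]_(t in `[0%R, n%:R]) (f t ^+ 2)%:E)%E].

Definition phi (j : nat) (t : R) : R :=
  if (j <= 1)%N then 1
  else if odd j then Num.sqrt 2 * sin (2 * pi * (j./2)%:R * t)
  else Num.sqrt 2 * cos (2 * pi * (j./2)%:R * t).

Definition xi Q (j : nat) (w : D) : R :=
  (Num.sqrt n%:R)^-1 * stoch_int Q (phi j) w.

Definition xi_var Q (j : nat) : R := fine 'E_Q[fun w => (xi Q j w ^+ 2)%R]%E.

(* Sequences are indexed by j >= 1; the entry of index 0 is ignored,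
   and is normalised to 0 in a weight set so that distinct elements are
   distinct weight sequences. *)
Definition supp x : set nat := [set j | (0 < j)%N /\ x j != 0].
Definition nsupp x : nat := #|` fset_set (supp x)|.
Definition supp_le (m : nat) x : Prop :=
  finite_set (supp x) /\ (nsupp x <= m)%N.
Definition sqnorm x : R := \sum_(j \in [set j | (0 < j)%N]) x j ^+ 2.

Definition L1 (varsigmaQ : R) Q : \bar R :=
  ereal_sup [set `| \sum_(j \in [set j | (0 < j)%N])
                     x j * (xi_var Q j - varsigmaQ) |%:E
            | x in [set x | (forall j, -1 <= x j <= 1) /\ supp_le n x]].

Definition L2 Q : \bar R :=
  ereal_sup [set 'E_Q[fun w => ((\sum_(j \in [set j | (0 < j)%N])
                     x j * (xi Q j w ^+ 2 - xi_var Q j)) ^+ 2)%R]%E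
            | x in [set x | sqnorm x <= 1 /\ supp_le n x]].

Definition obs S (w : D) (t : R) : R :=
  (\int[lebesgue_measure]_(u in `[0, t]) S u) + coord w t.

(* theta j is a statistic (a function of the observed path) which, under each
   law of the family, is a version of (1/n) int_0^n phi_j dy. *)
Definition is_fourier_estimator (QQ : set law) S
    (theta : (R -> R) -> nat -> R) : Prop :=
  forall Q j, QQ Q -> (0 < j)%N ->
    is_stoch_int Q n%:R (obs S) (phi j) (fun w => n%:R * theta (obs S w) j).

(* Below, th stands for the sequence of the estimated Fourier coefficients. *)
Definition sigma_hat th : R :=
  \sum_((Num.truncn (Num.sqrt (n%:R : R))).+1 <= j < n.+1) th j ^+ 2.

Definition theta_tilde th (j : nat) : R := th j ^+ 2 - sigma_hat th / n%:R.

Definition penalty th g : R := sigma_hat th * sqnorm g / n%:R.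

Definition cost (rho : R) th g : R :=
  \sum_(j \in [set j | (0 < j)%N]) g j ^+ 2 * th j ^+ 2
  - 2 * \sum_(j \in [set j | (0 < j)%N]) g j * theta_tilde th j
  + rho * penalty th g.

Definition S_hat g th (t : R) : R :=
  \sum_(j \in [set j | (0 < j)%N]) g j * th j * phi j t.

Definition weight_set (G : {fset (nat -> R)}) : Prop :=
  G != fset0 /\
  forall g, g \in G ->
    [/\ g 0%N = 0, forall j, 0 <= g j <= 1, supp_le n g & (0 < nsupp g)%N].

Definition model_selection (rho : R) (G : {fset (nat -> R)}) S
    (theta : (R -> R) -> nat -> R) (ghat : (R -> R) -> nat -> R) : Prop :=
  (forall g, g \in G -> measurable [set w : D | ghat (obs S w) = g]) /\
  forall y, ghat y \in G /\
    forall g, g \in G -> cost rho (theta y) (ghat y) <= cost rho (theta y) g.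

Definition risk Q (Shat : (R -> R) -> R -> R) S : \bar R :=
  \int[Q]_w \int[lebesgue_measure]_(t in `[0%R, 1%R])
     ((Shat (obs S w) t - S t) ^+ 2)%:E.

Definition robust_risk (QQ : set law) (Shat : (R -> R) -> R -> R) S : \bar R :=
  ereal_sup [set risk Q Shat S | Q in QQ].

End Model.

(* dS is the derivative of S on [0,1), right-sided at 0; the behaviour of S at
   1 from the left is not constrained. *)
Definition C1_with_derivative (R : realType) (S dS : R -> R) : Prop :=
  {within `[0, 1[, continuous dS} /\
  forall t, 0 <= t < 1 ->
    (fun u => (S u - S t) / (u - t)) @ within `[0, 1[ t^' --> dS t.

Section Bound.
Context {R : realType}.
Variables (n : nat) (rho l varsigma_inf varsigma_sup sigma_sup : R).

Definition Psi_star (nu : nat) : R :=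
  (2 * varsigma_sup * sigma_sup * nu%:R + 4 * varsigma_sup * l + 2 * nu%:R * l)
  / (varsigma_inf * rho * (1 - 3 * rho)).

Definition kappa_star (dS1 : R) : R :=
  4 * dS1 ^+ 2 + varsigma_sup + Num.sqrt l
  + 4 * dS1 * Num.sqrt sigma_sup / n%:R `^ 4^-1
  + l / n%:R `^ 2^-1.

Definition B_star (nu mu : nat) (dS1 : R) : R :=
  Psi_star nu
  + 6 * mu%:R * kappa_star dS1 / ((1 - 3 * rho) * Num.sqrt n%:R).

End Bound.

(* Main.v *)
Require Import Defs.
From mathcomp Require Import all_boot all_order all_algebra finmap.
From mathcomp Require Import all_classical all_reals all_analysis.
From mathcomp Require Import measurable_realfun zify ring lra.
Import Order.TTheory GRing.Theory Num.Theory.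
Import numFieldNormedType.Exports.
Local Open Scope classical_set_scope.
Local Open Scope ring_scope.

(** The estimators are trigonometric polynomials, so by Parseval's identity
    ([loss_trig_poly]) the loss of the weight [g] is the sum over [j] of
    [(g j * y j - theta j) ^+ 2], up to a constant, where [theta] are the
    Fourier coefficients of the signal and [y] their estimators. Stochastic
    integrals are linear and unique almost surely, and an absolutely continuous
    drift can be removed from them; hence, almost surely,
    [y j = theta j + xi j / sqrt n] ([theta_noise]). From there on the problem
    is the selection of weights in a sequence of noisy coefficients.

    Expanding the squares, the empirical cost of [g] is its loss up to a
    constant, the penalty and four remainders ([errorE]): a cross term between
    the signal and the noise, the sum of
    [g j * (E (xi j ^+ 2) - varsigma)], the sum of
    [g j * (xi j ^+ 2 - E (xi j ^+ 2))], and the error on the noise variance,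
    multiplied by at most the number of nonzero weights. Comparing the costs of
    the selected weight and of a competitor ([pointwise_oracle]), the second
    remainder is bounded by [L1]; the third one is absorbed by the penalty, up
    to its square divided by the squared norm of the weight; the cross term is
    absorbed by the losses, which is where the factor [1 - 3 * rho] comes from,
    up to its square divided by its variance. These normalized squares are
    replaced by their sums over the finite weight set, so that their means can
    be bounded by [L2] and by the isometry-like hypothesis on the noise
    ([integrated_oracle]). The variance of the competitor, left by its penalty,
    is at most its risk plus [l / n] ([variance_le_risk]).

    The estimator of the noise variance uses the frequencies beyond [sqrt n].
    Its bias is the tail of the squared Fourier coefficients of the signal. As
    the derivative is integrable, these coefficients are [O (1 / j)], even if
    the signal jumps at 1: one integrates by parts against a primitive of
    [phi j] that vanishes at both ends ([fourier_bound]). So the bias is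
    [O (1 / sqrt n)], as is the mean of the other errors
    ([variance_estimator_L1]).

    The inequality then holds under each law of the family with constants that
    are monotone in the law ([oracle_constants]), and passes to the supremum
    over the laws and to the minimum over the weights. *)

Set Implicit Arguments.
Unset Strict Implicit.
Unset Printing Implicit Defensive.

(** * Integrable real functions *)

Section Integrable.
Context {d : measure_display} {T : measurableType d} {R : realType}.
Variables (mu : {measure set T -> \bar R}) (D : set T) (mD : measurable D).
Implicit Types f g : T -> R.

Lemma integrableD_EFin f g : mu.-integrable D (EFin \o f) ->
  mu.-integrable D (EFin \o g) -> mu.-integrable D (EFin \o (fun t => f t + g t)).
Proof.
move=> fi gi; apply: (eq_integrable mD _ _ _ (integrableD mD fi gi)) => t _.
by rewrite /= EFinD.
Qed.

Lemma integrableZl_EFin (c : R) f : mu.-integrable D (EFin \o f) ->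
  mu.-integrable D (EFin \o (fun t => c * f t)).
Proof.
move=> fi; apply: (eq_integrable mD _ _ _ (integrableZl mD c fi)) => t _.
by rewrite /= EFinM.
Qed.

Lemma integrable_sum_EFin (I : Type) (s : seq I) (h : I -> T -> R) :
  (forall i, mu.-integrable D (EFin \o h i)) ->
  mu.-integrable D (EFin \o (fun t => \sum_(i <- s) h i t)).
Proof.
move=> hi; apply: (eq_integrable mD _ _ _ (integrable_sum mD s (fun i _ => hi i))).
by move=> t _; rewrite /= sumEFin.
Qed.

Lemma Rintegral_sum (I : Type) (s : seq I) (h : I -> T -> R) :
  (forall i, mu.-integrable D (EFin \o h i)) ->
  \int[mu]_(t in D) (\sum_(i <- s) h i t) =
  \sum_(i <- s) \int[mu]_(t in D) h i t.
Proof.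
move=> hi; elim: s => [|i s IH].
  under eq_Rintegral do rewrite big_nil.
  by rewrite big_nil /Rintegral integral0.
under eq_Rintegral do rewrite big_cons.
by rewrite RintegralD ?IH ?big_cons//; exact: integrable_sum_EFin.
Qed.

End Integrable.

(** * The trigonometric basis *)

Section Trigonometric.
Context {R : realType}.
Implicit Types (w t T : R) (j k n : nat).

Lemma is_derive_sin_mul w t : is_derive t 1 (fun x => sin (w * x)) (w * cos (w * t)).
Proof.
rewrite mulrC; apply: (@is_derive1_comp R sin (fun x => w * x)).
by apply: is_derive_eq; rewrite ?scaler0 ?addr0 /GRing.scale /= ?mulr1 ?mulr0 ?addr0 ?add0r.
Qed.

Lemma is_derive_cos_mul w t :
  is_derive t 1 (fun x => cos (w * x)) (- (w * sin (w * t))).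
Proof.
rewrite mulrC -mulNr; apply: (@is_derive1_comp R cos (fun x => w * x)).
by apply: is_derive_eq; rewrite ?scaler0 ?addr0 /GRing.scale /= ?mulr1 ?mulr0 ?addr0 ?add0r.
Qed.

Definition phi_freq j : nat := if (j <= 1)%N then 0 else j./2.
Definition phi_cos j : R :=
  if (j <= 1)%N then 1 else if odd j then 0 else Num.sqrt 2.
Definition phi_sin j : R :=
  if (j <= 1)%N then 0 else if odd j then Num.sqrt 2 else 0.

(** A single formula for the three kinds of basis functions: it reduces the
    orthogonality relations to the product-to-sum identities. *)
Lemma phiE j t : phi j t = phi_cos j * cos (2 * pi * (phi_freq j)%:R * t) +
                           phi_sin j * sin (2 * pi * (phi_freq j)%:R * t).
Proof.
rewrite /phi /phi_cos /phi_sin /phi_freq; case: ifP => _.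
  by rewrite mulr0 mul0r cos0 sin0 mulr1 mulr0 addr0.
by case: ifP => _; rewrite mul0r ?add0r ?addr0.
Qed.

Lemma sin_2pi_int (m : int) : sin (2 * pi * m%:~R) = 0 :> R.
Proof.
have H k : sin (2 * pi * k%:R) = 0 :> R.
  have -> : 2 * pi * k%:R = 0 + pi *+ 2 *+ k :> R by ring.
  by rewrite (periodicn (@sinD2pi R)) sin0.
case: (intP m) => [|k|k]; first by rewrite mulr0 sin0.
  by rewrite -pmulrn H.
by rewrite mulrNz mulrN sinN -pmulrn H oppr0.
Qed.

Lemma is_derive_phi j t :
  is_derive t 1 (phi j : R -> R)
    (2 * pi * (phi_freq j)%:R *
      (phi_sin j * cos (2 * pi * (phi_freq j)%:R * t) -
       phi_cos j * sin (2 * pi * (phi_freq j)%:R * t))).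
Proof.
set w := 2 * pi * _.
have -> : phi j = (fun t => phi_cos j * cos (w * t) + phi_sin j * sin (w * t)).
  by apply/funext => x; rewrite phiE.
have [dc ds] := (is_derive_cos_mul w t, is_derive_sin_mul w t).
apply: is_derive_eq.
by rewrite /GRing.scale /=; ring.
Qed.

Lemma continuous_phi j : continuous (phi j : R -> R).
Proof.
move=> t; apply/differentiable_continuous/derivable1_diffP.
by have [] := is_derive_phi j t.
Qed.

Lemma measurable_phi j : measurable_fun setT (phi j : R -> R).
Proof. by apply: continuous_measurable_fun; exact: continuous_phi. Qed.

Lemma phi_bound j t : `|phi j t| <= 2.
Proof.
have s2 : Num.sqrt 2 <= 2 :> R.
  by rewrite -[leRHS]ger0_norm// -sqrtr_sqr ler_sqrt; lra.
rewrite /phi; case: ifP => _; first by rewrite normr1; lra.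
by case: ifP => _; rewrite normrM (ger0_norm (sqrtr_ge0 _));
  rewrite -[leRHS]mulr1 ler_pM// ?sqrtr_ge0//;
  rewrite ler_norml ?sin_geN1 ?sin_le1 ?cos_geN1 ?cos_le1.
Qed.

(** Makes the basis easy to approximate by step functions. *)
Lemma phi_lipschitz j : exists2 K : R, 0 <= K &
  forall s t, `|phi j s - phi j t| <= K * `|s - t|.
Proof.
pose w : R := 2 * pi * (phi_freq j)%:R.
pose K := `|w| * (`|phi_sin j| + `|phi_cos j|).
have K0 : 0 <= K by rewrite mulr_ge0 ?addr_ge0.
exists K => // s t; wlog st : s t / s <= t => [H|].
  by have [/H//|/ltW/H] := leP s t; rewrite distrC (distrC t).
have [c _ h] := MVT_segment st (fun x _ => is_derive_phi j x)
  (continuous_subspaceT (@continuous_phi j)).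
rewrite distrC h normrM (distrC t) ler_wpM2r// normrM ler_wpM2l//.
rewrite (le_trans (ler_normB _ _))// !normrM lerD//.
  by rewrite ler_piMr// ler_norml cos_geN1 cos_le1.
by rewrite ler_piMr// ler_norml sin_geN1 sin_le1.
Qed.

Local Notation mu := (@lebesgue_measure R).

Lemma continuous_integrable (f : R -> R) a b : continuous f ->
  mu.-integrable `[a, b] (EFin \o f).
Proof.
move=> cf; apply: continuous_compact_integrable; first exact: segment_compact.
exact: continuous_subspaceT.
Qed.

Lemma continuous_cos_mul w : continuous (fun t => cos (w * t)).
Proof.
move=> t; apply/differentiable_continuous/derivable1_diffP.
by have [] := is_derive_cos_mul w t.
Qed.

Lemma continuous_sin_mul w : continuous (fun t => sin (w * t)).
Proof.
move=> t; apply/differentiable_continuous/derivable1_diffP.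
by have [] := is_derive_sin_mul w t.
Qed.

Lemma Rintegral_derive (F f : R -> R) a b : a < b -> continuous f ->
  (forall t, is_derive t 1 F (f t)) ->
  \int[mu]_(t in `[a, b]) f t = F b - F a.
Proof.
move=> ab cf dF.
have cF : continuous F.
  by move=> t; apply/differentiable_continuous/derivable1_diffP; have [] := dF t.
rewrite /Rintegral (continuous_FTC2 (F := F)) //.
- exact: continuous_subspaceT.
- split; first by move=> x _; have [] := dF x.
  + exact: cvg_at_right_filter (cF a).
  + exact: cvg_at_left_filter (cF b).
- by move=> x _; rewrite derive1E; have [_] := dF x.
Qed.

Lemma Rintegral_cos_period n (m : int) : (0 < n)%N ->
  \int[mu]_(t in `[0, n%:R]) cos (2 * pi * m%:~R * t) = (n * (m == 0))%:R.
Proof.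
move=> n0; have n0' : 0 < n%:R :> R by rewrite ltr0n.
have [->|m0] := eqVneq m 0.
  under eq_Rintegral do rewrite mulr0 mul0r cos0.
  rewrite Rintegral_cst//= mul1r lebesgue_measure_itv/= lte_fin n0' muln1.
  by rewrite oppr0 addr0.
have w0 : 2 * pi * m%:~R != 0 :> R.
  by rewrite !mulf_neq0 ?intr_eq0// gt_eqF ?pi_gt0.
have dF t : is_derive t 1
    (fun t => (2 * pi * m%:~R)^-1 * sin (2 * pi * m%:~R * t))
    (cos (2 * pi * m%:~R * t)).
  have ds := is_derive_sin_mul (2 * pi * m%:~R) t.
  by apply: is_derive_eq; rewrite /GRing.scale /= ?mulr0 ?addr0 mulKf.
rewrite (Rintegral_derive n0' (@continuous_cos_mul _) dF).
rewrite mulr0 sin0 mulr0 subr0 muln0.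
have -> : 2 * pi * m%:~R * n%:R = 2 * pi * (m * n)%:~R :> R.
  by rewrite intrM mulrA.
by rewrite sin_2pi_int mulr0.
Qed.

Lemma cos_2pi_int (m : int) : cos (2 * pi * m%:~R) = 1 :> R.
Proof.
have H k : cos (2 * pi * k%:R) = 1 :> R.
  have -> : 2 * pi * k%:R = 0 + pi *+ 2 *+ k :> R by ring.
  by rewrite (periodicn (@cosD2pi R)) cos0.
case: (intP m) => [|k|k]; first by rewrite mulr0 cos0.
  by rewrite -pmulrn H.
by rewrite mulrNz mulrN cosN -pmulrn H.
Qed.

Lemma Rintegral_sin_period n (m : int) : (0 < n)%N ->
  \int[mu]_(t in `[0, n%:R]) sin (2 * pi * m%:~R * t) = 0.
Proof.
move=> n0; have n0' : 0 < n%:R :> R by rewrite ltr0n.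
have [->|m0] := eqVneq m 0.
  under eq_Rintegral do rewrite mulr0 mul0r sin0.
  by rewrite Rintegral_cst//= mul0r.
have w0 : 2 * pi * m%:~R != 0 :> R.
  by rewrite !mulf_neq0 ?intr_eq0// gt_eqF ?pi_gt0.
have dF t : is_derive t 1
    (fun t => - (2 * pi * m%:~R)^-1 * cos (2 * pi * m%:~R * t))
    (sin (2 * pi * m%:~R * t)).
  have ds := is_derive_cos_mul (2 * pi * m%:~R) t.
  by apply: is_derive_eq; rewrite /GRing.scale /= ?mulr0 ?addr0 mulrNN mulKf.
rewrite (Rintegral_derive n0' (@continuous_sin_mul _) dF).
rewrite mulr0 cos0.
have -> : 2 * pi * m%:~R * n%:R = 2 * pi * (m * n)%:~R :> R.
  by rewrite intrM mulrA.
by rewrite cos_2pi_int subrr.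
Qed.

Lemma phi_mulE j k t : phi j t * phi k t =
  (phi_cos j * phi_cos k + phi_sin j * phi_sin k) / 2 *
    cos (2 * pi * ((phi_freq j)%:Z - (phi_freq k)%:Z)%:~R * t) +
  ((phi_cos j * phi_cos k - phi_sin j * phi_sin k) / 2 *
    cos (2 * pi * ((phi_freq j)%:Z + (phi_freq k)%:Z)%:~R * t) +
  ((phi_cos j * phi_sin k + phi_sin j * phi_cos k) / 2 *
    sin (2 * pi * ((phi_freq j)%:Z + (phi_freq k)%:Z)%:~R * t) +
  (phi_sin j * phi_cos k - phi_cos j * phi_sin k) / 2 *
    sin (2 * pi * ((phi_freq j)%:Z - (phi_freq k)%:Z)%:~R * t))).
Proof.
rewrite !phiE intrB intrD -!pmulrn.
set x := (phi_freq j)%:R; set y := (phi_freq k)%:R.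
have -> : 2 * pi * (x - y) * t = 2 * pi * x * t - 2 * pi * y * t by ring.
have -> : 2 * pi * (x + y) * t = 2 * pi * x * t + 2 * pi * y * t by ring.
by rewrite cosB cosD sinB sinD; field.
Qed.

(** Integrals of cosines and sines of integer frequency over whole periods
    vanish, unless the frequency is zero. The loss needs one period, the noise
    is observed over [n] of them. *)
Lemma phi_orthogonal n j k : (0 < n)%N -> (0 < j)%N -> (0 < k)%N ->
  \int[mu]_(t in `[0, n%:R]) (phi j t * phi k t) = (n * (j == k))%:R.
Proof.
move=> n0 j0 k0; under eq_Rintegral do rewrite phi_mulE.
set c1 := _ / 2; set c2 := _ / 2; set c3 := _ / 2; set c4 := _ / 2.
have ic w c : mu.-integrable `[0, n%:R] (EFin \o (fun t => c * cos (w * t))).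
  apply: continuous_integrable => t; apply: cvgMl_tmp.
  exact: continuous_cos_mul.
have isn w c : mu.-integrable `[0, n%:R] (EFin \o (fun t => c * sin (w * t))).
  apply: continuous_integrable => t; apply: cvgMl_tmp.
  exact: continuous_sin_mul.
rewrite RintegralD//; last first.
  by do 2 ?apply: integrableD_EFin.
rewrite RintegralD//; last exact: integrableD_EFin.
rewrite RintegralD// !RintegralZl//;
  try (apply: continuous_integrable; exact: continuous_cos_mul);
  try (apply: continuous_integrable; exact: continuous_sin_mul).
rewrite !Rintegral_cos_period// !Rintegral_sin_period// !mulr0 !addr0.
rewrite subr_eq0 eqz_nat -PoszD eqz_nat addn_eq0 !natrM.
have -> A B (x y : R) : A * (n%:R * x) + B * (n%:R * y) = n%:R * (A * x + B * y).
  by ring.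
congr (_ * _).
rewrite {}/c1 {}/c2 /phi_cos /phi_sin /phi_freq {c3 c4}.
have s2 : Num.sqrt 2 * Num.sqrt 2 = 2 :> R by rewrite -expr2 sqr_sqrtr.
have half_eq0 i : (1 < i)%N -> (i./2 == 0)%N = false.
  by case: i => [|[|i]].
have eq_half : (1 < j)%N -> (1 < k)%N -> odd j = odd k -> (j./2 == k./2) = (j == k).
  move=> _ _ e; apply/eqP/eqP => [h|->//].
  by rewrite -(odd_double_half j) -(odd_double_half k) e h.
have neq : odd j <> odd k -> (j == k) = false.
  by move=> h; apply/eqP => e; apply: h; rewrite e.
case: (leqP j 1) => j1; case: (leqP k 1) => k1.
- by rewrite (_ : j == k) //=; [lra|lia].
- rewrite (half_eq0 k)// [(0 == _)%N]eq_sym half_eq0//= (_ : (j == k) = false).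
    by rewrite !mulr0 addr0.
  by apply/negbTE; lia.
- rewrite (half_eq0 j)//= (_ : (j == k) = false).
    by rewrite !mulr0 addr0.
  by apply/negbTE; lia.
- rewrite (half_eq0 j)//= mulr0 addr0.
  case: (boolP (odd j)) => oj; case: (boolP (odd k)) => ok;
    rewrite ?(mul0r, mulr0, add0r, addr0).
  + by rewrite s2 divff// mul1r eq_half// oj ok.
  + by rewrite neq// (negbTE ok) oj.
  + by rewrite neq// (negbTE oj) ok.
  + by rewrite s2 divff// mul1r eq_half// (negbTE oj) (negbTE ok).
Qed.

(** The primitive of [phi j] that vanishes at the integers: integrating by
    parts against it leaves no boundary term at 1, where the signal may jump. *)
Definition phi_primitive j t : R :=
  (2 * pi * (phi_freq j)%:R)^-1 *
  (phi_cos j * sin (2 * pi * (phi_freq j)%:R * t) +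
   phi_sin j * (1 - cos (2 * pi * (phi_freq j)%:R * t))).

Lemma phi_freq_gt0 j : (1 < j)%N -> 0 < 2 * pi * (phi_freq j)%:R :> R.
Proof.
move=> j1; rewrite !mulr_gt0 ?pi_gt0// ltr0n /phi_freq (leqNgt j) j1/=.
by case: j j1 => [|[|j]].
Qed.

Lemma is_derive_phi_primitive j t : (1 < j)%N ->
  is_derive t 1 (phi_primitive j) (phi j t).
Proof.
move=> /phi_freq_gt0; rewrite phiE /phi_primitive; set w := 2 * pi * _ => w0.
have [dc ds] := (is_derive_cos_mul w t, is_derive_sin_mul w t).
apply: is_derive_eq.
by rewrite /GRing.scale /=; field; rewrite gt_eqF.
Qed.

Lemma phi_primitive0 j : phi_primitive j 0 = 0.
Proof. by rewrite /phi_primitive mulr0 sin0 cos0 subrr !mulr0 addr0 mulr0. Qed.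

Lemma phi_primitive1 j : phi_primitive j 1 = 0.
Proof.
rewrite /phi_primitive mulr1 -[(phi_freq j)%:R]/((phi_freq j)%:Z%:~R) sin_2pi_int cos_2pi_int.
by rewrite subrr !mulr0 addr0 mulr0.
Qed.

Lemma continuous_phi_primitive j : (1 < j)%N -> continuous (phi_primitive j).
Proof.
move=> j1 t; apply/differentiable_continuous/derivable1_diffP.
by have [] := is_derive_phi_primitive t j1.
Qed.

(** The frequency of [phi j] is at least [(j - 1) / 2], and [2 <= pi]. This is
    where the coefficients of a signal of bounded variation get their decay. *)
Lemma phi_primitive_bound j t : (1 < j)%N ->
  `|phi_primitive j t| <= Num.sqrt 2 / (j.-1)%:R.
Proof.
move=> j1; have w0 := phi_freq_gt0 j1; rewrite /phi_primitive.
set w := 2 * pi * _ in w0 *.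
rewrite normrM gtr0_norm ?invr_gt0// mulrC.
have s2 : 0 <= Num.sqrt 2 :> R := sqrtr_ge0 _.
have j0 : 0 < (j.-1)%:R :> R by rewrite ltr0n; case: j j1 {w w0} => [|[|]].
have wj : 2 * (j.-1)%:R <= w.
  have h : (j.-1)%:R <= 2 * (phi_freq j)%:R :> R.
    rewrite -natrM ler_nat /phi_freq (leqNgt j) j1/= mul2n.
    by have := odd_double_half j; case: (odd j) => /=; lia.
  rewrite /w -mulrA mulrCA; apply: le_trans (_ : 2 * (2 * (phi_freq j)%:R) <= _).
    by rewrite ler_pM2l.
  by rewrite ler_wpM2r ?pi_ge2// mulr_ge0.
have num : `|phi_cos j * sin (w * t) + phi_sin j * (1 - cos (w * t))| <=
    2 * Num.sqrt 2.
  rewrite /phi_cos /phi_sin (leqNgt j) j1 /=; case: ifP => _.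
    rewrite mul0r add0r normrM ger0_norm// mulrC ler_wpM2r//.
    by rewrite ger0_norm; have := cos_geN1 (w * t); have := cos_le1 (w * t); lra.
  rewrite mul0r addr0 normrM ger0_norm// mulrC ler_wpM2r//.
  by rewrite ler_norml; have := sin_geN1 (w * t); have := sin_le1 (w * t); lra.
rewrite ler_pdivrMr// (le_trans num)//.
have -> : 2 * Num.sqrt 2 = Num.sqrt 2 / (j.-1)%:R * (2 * (j.-1)%:R) :> R.
  by field; rewrite gt_eqF.
by rewrite ler_wpM2l// divr_ge0// ltW.
Qed.

End Trigonometric.

(** * Integrals of periodic functions *)

Section Periodic.
Context {R : realType}.
Local Notation mu := (@lebesgue_measure R).
Implicit Types (D : set R) (f : R -> \bar R) (c a b : R) (n : nat).

(** Typed on the carrier of Lebesgue measure, whose measurable structure is not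
    syntactically the one of [R]. *)
Definition shift_by c : measurableTypeR R -> measurableTypeR R := fun x => (x : R) + c.

Lemma measurable_shift_by c (D : set (measurableTypeR R)) : measurable_fun D (shift_by c).
Proof.
apply: (measurable_funS measurableT (@subsetT _ D)).
by apply: continuous_measurable_fun => x; apply: cvgD; [exact: cvg_id|exact: cvg_cst].
Qed.

Lemma preimage_shift_by c a b :
  shift_by c @^-1` `[a, b[ = `[a - c, b - c[%classic.
Proof.
by apply/seteqP; split => x /=; rewrite !in_itv/= /shift_by; lra.
Qed.

(** Lebesgue measure is determined by its values on half-open intervals. *)
Lemma lebesgue_measure_shift c D : measurable D ->
  pushforward mu (shift_by c) D = mu D.
Proof.
move=> mD; apply/esym/lebesgue_measure_unique => //=.
  exact: measurable_shift_by.
move=> _ _ [[a b]] _ <-.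
have -> : pushforward mu (shift_by c) `]a, b] = mu `]a - c, b - c].
  rewrite /pushforward; congr (mu _).
  by apply/seteqP; split => x /=; rewrite !in_itv/= /shift_by; lra.
rewrite !lebesgue_measure_itv/= !lte_fin ltrD2r; case: ifP => // _.
by rewrite -!EFinD; congr EFin; ring.
Qed.

Lemma ge0_integral_shift c a b f : measurable_fun `[a, b[ f ->
  (forall x : R, a <= x < b -> (0 <= f x)%E) ->
  (\int[mu]_(x in `[a, b[) f x = \int[mu]_(x in `[(a - c)%R, (b - c)%R[) f (x + c)%R)%E.
Proof.
move=> mf f0; rewrite -preimage_shift_by.
have mphi := @measurable_shift_by c setT.
transitivity (\int[pushforward mu (shift_by c)]_(x in `[a, b[) f x)%E; last first.
  apply: (ge0_integral_pushforward mphi) => //.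
  by move=> x; rewrite inE/= in_itv/=; exact: f0.
- apply: eq_measure_integral => //= A mA _.
  exact/esym/lebesgue_measure_shift.
Qed.

Lemma measurable_fun_shift c a b (d : measure_display) (T : measurableType d)
    (f : R -> T) :
  measurable_fun `[a, b[ f ->
  measurable_fun `[a - c, b - c[ (fun x => f (x + c)).
Proof.
move=> mf; apply: (@measurable_comp _ _ _ _ _ _ `[a, b[ f _ (shift_by c)) => //.
  by move=> _ [x /= + <-]; rewrite !in_itv/= /shift_by; lra.
exact: measurable_shift_by.
Qed.

Lemma itv_natS n :
  `[0, n.+1%:R[%classic = `[0, n%:R[%classic `|` `[n%:R, n.+1%:R[%classic :> set R.
Proof. by rewrite -itv_bndbnd_setU// bnd_simp ?ler_nat. Qed.

Lemma periodic_measurable (d : measure_display) (T : measurableType d)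
    (f : R -> T) n : (forall t, f (t + 1) = f t) ->
  measurable_fun (`[0, 1[%classic : set R) f -> measurable_fun (`[0, n%:R[%classic : set R) f.
Proof.
move=> pf mf; elim: n => [|n IH]; first by rewrite set_itvco0; exact: measurable_fun_set0.
rewrite itv_natS; apply/measurable_funU => //; split=> //.
have pfn t : f (t - n%:R) = f t.
  elim: n {IH} t => [|m IHm] t; first by rewrite subr0.
  by rewrite -(IHm t) -(pf (t - m.+1%:R)); congr f; rewrite -natr1; ring.
have := @measurable_fun_shift (- n%:R) 0 1 _ _ f mf.
rewrite !opprK add0r nat1r; congr (measurable_fun _ _).
by apply/funext => x; rewrite pfn.
Qed.

Lemma periodic_ge0_integral f n : (forall t, f (t + 1) = f t) ->
  measurable_fun (`[0, 1[%classic : set R) f -> (forall t, 0 <= f t)%E ->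
  (\int[mu]_(t in `[0%R, n%:R[) f t = n%:R%:E * \int[mu]_(t in `[0%R, 1%R[) f t)%E.
Proof.
move=> pf mf f0; elim: n => [|n IH].
  by rewrite set_itvco0 integral_set0 mul0e.
have mfn k := @periodic_measurable _ _ f k pf mf.
rewrite itv_natS ge0_integral_setU//; last 2 first.
  by rewrite -itv_natS; exact: mfn.
  apply/disj_setPS => x [] /=; rewrite !in_itv/=.
  by case/andP => _ h /andP[]; rewrite leNgt h.
rewrite IH (@ge0_integral_shift n%:R n%:R n.+1%:R)//; last first.
  apply: (@measurable_funS _ _ _ _ (`[0, n.+1%:R[%classic : set R)) => //.
    by rewrite itv_natS; right.
rewrite subrr -natr1 addrAC subrr add0r EFinD.
have pfn t : f (t + n%:R) = f t.
  elim: n {IH} t => [|m IHm] t; first by rewrite addr0.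
  by rewrite -natr1 addrA pf.
under [in X in (_ + X)%E]eq_integral do rewrite pfn.
by rewrite ge0_muleDl ?lee_fin// mul1e.
Qed.

(** By positive and negative parts. *)
Lemma periodic_integrable (f : R -> R) n : (forall t, f (t + 1) = f t) ->
  mu.-integrable `[0, 1[ (EFin \o f) ->
  mu.-integrable `[0, n%:R[ (EFin \o f) /\
  \int[mu]_(t in `[0, n%:R[) f t = n%:R * \int[mu]_(t in `[0, 1[) f t.
Proof.
move=> pf /[dup] fi /integrableP[mf foo]; split.
  apply/integrableP; split.
    by apply: periodic_measurable => // t /=; rewrite pf.
  rewrite periodic_ge0_integral//.
  - by rewrite lte_mul_pinfty// ?lee_fin.
  - by move=> t /=; rewrite pf.
  - exact: measurableT_comp.
have fE : (\int[mu]_(t in `[0%R, n%:R[) (f t)%:E =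
    n%:R%:E * \int[mu]_(t in `[0%R, 1%R[) (f t)%:E)%E.
  rewrite integralE [in RHS]integralE.
  rewrite (@periodic_ge0_integral (fun t => (f t)%:E)^\+%E)//.
  - rewrite (@periodic_ge0_integral (fun t => (f t)%:E)^\-%E)//.
    + rewrite -muleBr//; apply: fin_num_adde_defr.
      exact: integrable_pos_fin_num.
    + by move=> t; rewrite !funenegE /= pf.
    + exact: measurable_funeneg.
  - by move=> t; rewrite !funeposE /= pf.
  - exact: measurable_funepos.
rewrite /Rintegral fE fineM//; exact: integrable_fin_num.
Qed.

End Periodic.

(** * Decay of the Fourier coefficients *)

Section FourierDecay.
Context {R : realType}.
Local Notation mu := (@lebesgue_measure R).
Variables (S dS : R -> R).
Hypothesis S_C1 : C1_with_derivative S dS.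
Hypothesis dS_int : mu.-integrable `[0, 1[ (EFin \o dS).

Local Notation D := (\int[mu]_(t in `[0, 1[) `|dS t|).
Implicit Types t u b e : R.

(** At 0 the derivative is one-sided, hence the explicit form with increments,
    which covers both cases. *)
Lemma C1_increment t e : 0 <= t < 1 -> 0 < e ->
  exists2 delta, 0 < delta & forall u, 0 <= u < 1 -> `|u - t| < delta ->
    `|S u - S t - dS t * (u - t)| <= e * `|u - t|.
Proof.
move=> t01 e0; have [_ /(_ _ t01)] := S_C1.
move=> /cvgrPdist_le /(_ _ e0); rewrite /within/= nearE/=.
move=> -[delta /= delta0 H]; exists delta => // u u01 ut.
have [->|neq] := eqVneq u t; first by rewrite !subrr mulr0 subrr normr0 mulr0.
have := H u; rewrite /ball /= distrC => /(_ ut neq).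
rewrite in_itv/= => /(_ u01).
have -> : dS t - (S u - S t) / (u - t) = - ((S u - S t - dS t * (u - t)) / (u - t)).
  by field; rewrite subr_eq0.
by rewrite normrN normf_div ler_pdivrMr// normr_gt0 subr_eq0.
Qed.

Lemma C1_continuous t : 0 <= t < 1 -> S u @[u --> within `[0, 1[ (nbhs t)] --> S t.
Proof.
move=> t01; apply/cvgrPdist_le => e e0; rewrite /within /= nearE.
have [delta delta0 H] := C1_increment t01 ltr01.
have K0 : 0 < 1 + `|dS t| by rewrite ltr_wpDr.
exists (Num.min delta (e / (1 + `|dS t|))) => /=.
  by rewrite lt_min delta0 divr_gt0.
move=> u; rewrite /ball /= lt_min distrC => /andP[ud ue].
rewrite in_itv/= => u01; have := H _ u01 ud; rewrite mul1r => Hu.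
have -> : S t - S u = - (S u - S t - dS t * (u - t)) - dS t * (u - t) by ring.
rewrite (le_trans (ler_normB _ _))// normrN normrM.
rewrite (le_trans (lerD Hu (lexx _)))// (_ : _ + _ = `|u - t| * (1 + `|dS t|)); last by ring.
by rewrite -ler_pdivlMr// ltW.
Qed.

Lemma C1_is_derive t : 0 < t < 1 -> is_derive t 1 S (dS t).
Proof.
move=> /andP[t0 t1]; have t01 : 0 <= t < 1 by rewrite ltW.
suff H : (fun h => h^-1 *: (S (h *: 1 + t) - S t)) @ 0^' --> dS t.
  by apply: DeriveDef; [apply/cvg_ex; exists (dS t)|exact: cvg_lim].
apply/cvgrPdist_le => e e0; rewrite /dnbhs /within /= nearE.
have [delta delta0 H] := C1_increment t01 e0.
exists (Num.min delta (Num.min t (1 - t))) => /=.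
  by rewrite !lt_min delta0 t0 subr_gt0.
move=> h; rewrite /ball /= !lt_min sub0r normrN => /and3P[hd ht ht1] h0.
have hE : h *: 1 + t - t = h by rewrite addrK /GRing.scale /= mulr1.
have h01 : 0 <= h *: 1 + t < 1.
  rewrite /GRing.scale /= mulr1; apply/andP; split.
    by move: ht; rewrite ltr_norml => /andP[]; lra.
  by move: ht1; rewrite ltr_norml => /andP[]; lra.
have := H (h *: 1 + t); rewrite hE => /(_ h01 hd).
set s := S _; rewrite /GRing.scale /=.
have -> : dS t - h^-1 * (s - S t) = - ((s - S t - dS t * h) / h).
  by field.
by rewrite normrN normf_div ler_pdivrMr// normr_gt0.
Qed.

Lemma C1_derivable_oo b : 0 < b < 1 -> derivable_oo_LRcontinuous S 0 b.
Proof.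
move=> /andP[b0 b1].
have dt t : t \in `]0, b] -> derivable S t 1.
  rewrite in_itv/= => /andP[t0 tb].
  by have [] : is_derive t 1 S (dS t) by apply: C1_is_derive; rewrite t0 (le_lt_trans tb).
split.
- by move=> t tb; apply: dt; exact: subset_itv_oo_oc tb.
- have /cvgrPdist_le C : S u @[u --> within `[0, 1[ (nbhs (0 : R))] --> S 0.
    by apply: C1_continuous; rewrite lexx ltr01.
  apply/cvgrPdist_le => e e0; have := C _ e0; rewrite /within/= nearE => -[d /= d0 Hd].
  rewrite /at_right /within /= nearE; exists (Num.min d 1) => /=.
    by rewrite lt_min d0 ltr01.
  move=> u; rewrite /ball/= lt_min => /andP[ud u1] u0; apply: Hd => //.
  rewrite in_itv/= ltW//=; move: u1; rewrite sub0r normrN ger0_norm// ltW//.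
- apply/cvg_at_left_filter/differentiable_continuous/derivable1_diffP/dt.
  by rewrite in_itv/= b0 lexx.
Qed.

Lemma C1_itv_subset (b : R) : b < 1 -> `[0, b] `<=` `[0, 1[.
Proof.
by move=> b1 t /=; rewrite !in_itv/= => /andP[-> tb]; rewrite (le_lt_trans tb).
Qed.

Lemma C1_continuous_derivative (b : R) : b < 1 -> {within `[0, b], continuous dS}.
Proof.
move=> b1; have [c _] := S_C1; apply: continuous_subspaceW c.
exact: C1_itv_subset.
Qed.

Lemma Rintegral_norm_derivative_le b : 0 < b < 1 ->
  \int[mu]_(t in `[0, b]) `|dS t| <= D.
Proof.
move=> /andP[b0 b1]; rewrite /Rintegral.
have di : mu.-integrable `[0, 1[ (EFin \o (fun t => `|dS t|)).
  by apply: integrable_norm.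
rewrite fine_le//; try exact: integrable_fin_num.
- apply: integrable_fin_num => //; apply: integrableS di => //.
  exact: C1_itv_subset.
- apply: ge0_subset_integral => //; first by case/integrableP: di.
  exact: C1_itv_subset.
Qed.

Lemma total_variation_ge0 : 0 <= D.
Proof. by rewrite Rintegral_ge0. Qed.

(** The integrability of the derivative bounds the signal up to 1, where it may
    jump. *)
Lemma C1_bound b : 0 <= b < 1 -> `|S b| <= `|S 0| + D.
Proof.
move=> /andP[]; rewrite le_eqVlt => /predU1P[<- _|b0 b1].
  by rewrite lerDl total_variation_ge0.
have b01 : 0 < b < 1 by rewrite b0.
have di : mu.-integrable `[0, b] (EFin \o dS).
  by apply: integrableS dS_int => //; exact: C1_itv_subset.
have E : \int[mu]_(t in `[0, b]) dS t = S b - S 0.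
  rewrite /Rintegral (continuous_FTC2 b0 (C1_continuous_derivative b1) (C1_derivable_oo b01)) //.
  move=> t; rewrite in_itv/= => /andP[t0 tb].
  rewrite derive1E; have [_] // : is_derive t 1 S (dS t).
  by apply: C1_is_derive; rewrite t0 (lt_trans tb).
have -> : S b = S 0 + (S b - S 0) by ring.
rewrite (le_trans (ler_normD _ _))// lerD2l -E.
rewrite (le_trans (le_normr_Rintegral _ di))//.
exact: Rintegral_norm_derivative_le.
Qed.

Hypothesis S_per : forall t, S (t + 1) = S t.
Hypothesis S_meas : measurable_fun (`[0, 1]%classic : set R) S.

Lemma periodic_C1_bound t : 0 <= t <= 1 -> `|S t| <= `|S 0| + D.
Proof.
rewrite le_eqVlt andb_orl => /orP[/andP[/eqP<- _]|/andP[t0]].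
  by rewrite lerDl total_variation_ge0.
rewrite le_eqVlt => /predU1P[->|t1]; last by rewrite C1_bound// ltW.
have -> : S 1 = S 0 by rewrite -[RHS]S_per add0r.
by rewrite lerDl total_variation_ge0.
Qed.

Lemma periodic_C1_integrable (g : R -> R) (M : R) (A : set R) : measurable A ->
  A `<=` `[0, 1] -> measurable_fun setT g -> (forall t, `|g t| <= M) ->
  mu.-integrable A (EFin \o (fun t => S t * g t)).
Proof.
move=> mA A01 mg gM; apply: measurable_bounded_integrable => //.
- apply: (@le_lt_trans _ _ (mu `[0, 1])); first by apply: le_measure; rewrite ?inE.
  by rewrite lebesgue_measure_itv/= lte01 oppr0 addr0 ltry.
- apply: measurable_funM; first exact: measurable_funS S_meas.
  exact: measurable_funTS.
- exists ((`|S 0| + D) * M); split; [exact: num_real|] => y yM t At.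
  rewrite /= (le_trans _ (ltW yM))// normrM ler_pM//.
  by apply: periodic_C1_bound; have := A01 _ At; rewrite /= in_itv/=.
Qed.

(** Integration by parts is only possible up to some [b < 1], as [S] may jump
    at 1. *)
Lemma fourier_partial_bound j b : (1 < j)%N -> 0 < b < 1 ->
  `|\int[mu]_(t in `[0, b]) (S t * phi j t)| <=
    (`|S 0| + D) * `|phi_primitive j b| + Num.sqrt 2 / (j.-1)%:R * D.
Proof.
move=> j1 /[dup] b01 /andP[b0 b1].
have dP t : is_derive t 1 (phi_primitive j) (phi j t : R) by exact: is_derive_phi_primitive.
have cP := @continuous_phi_primitive R j j1.
rewrite (Rintegration_by_parts (F := S) (G := phi_primitive j) (f := dS) b0).
- rewrite phi_primitive0 mulr0 subr0 (le_trans (ler_normB _ _))//.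
  rewrite normrM lerD// ?ler_wpM2r//; first by rewrite C1_bound// ltW.
  have i1 : mu.-integrable `[0, b] (EFin \o dS).
    by apply: integrableS dS_int => //; exact: C1_itv_subset.
  have i2 : mu.-integrable `[0, b] (EFin \o (fun t => dS t * phi_primitive j t)).
    have mP : measurable_fun (`[0, b]%classic : set R) (phi_primitive j).
      by apply: measurable_funTS; apply: continuous_measurable_fun.
    have bP : [bounded phi_primitive j t | t in `[0, b]%classic : set R].
      exists (Num.sqrt 2 / (j.-1)%:R); split; [exact: num_real|] => y yM t _.
      by rewrite /= (le_trans _ (ltW yM))// phi_primitive_bound.
    exact: (eq_integrable _ _ _ _ (integrableMl _ i1 mP bP)).
  rewrite (le_trans (le_normr_Rintegral _ i2))//.
  apply: (@le_trans _ _ (\int[mu]_(t in `[0, b]) (Num.sqrt 2 / (j.-1)%:R * `|dS t|))).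
    apply: le_Rintegral => //.
    - exact: integrable_norm i2.
    - by apply: integrableZl_EFin => //; exact: integrable_norm i1.
    - by move=> t _; rewrite normrM mulrC ler_wpM2r// phi_primitive_bound.
  rewrite RintegralZl//; last exact: integrable_norm i1.
  rewrite ler_wpM2l// ?divr_ge0 ?sqrtr_ge0//.
  exact: Rintegral_norm_derivative_le.
- exact: C1_continuous_derivative.
- exact: C1_derivable_oo.
- move=> t; rewrite in_itv/= => /andP[t0 tb].
  rewrite derive1E; have [_] // : is_derive t 1 S (dS t).
  by apply: C1_is_derive; rewrite t0 (lt_trans tb).
- exact/continuous_subspaceT/continuous_phi.
- split; first by move=> t _; have [] := dP t.
  + exact: cvg_at_right_filter (cP 0).
  + exact: cvg_at_left_filter (cP b).
- by move=> t _; rewrite derive1E; have [_] := dP t.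
Qed.

(** As [b] tends to 1, the boundary term vanishes with the primitive of [phi j],
    and so does the integral from [b] to 1, because [S] is bounded. *)
Lemma fourier_bound j : (1 < j)%N ->
  `|\int[mu]_(t in `[0, 1]) (S t * phi j t)| <= Num.sqrt 2 / (j.-1)%:R * D.
Proof.
move=> j1; set B := `|S 0| + D.
have B0 : 0 <= B by rewrite addr_ge0// total_variation_ge0.
have H b : 0 < b < 1 -> `|\int[mu]_(t in `[0, 1]) (S t * phi j t)| <=
    4 * B * (1 - b) + Num.sqrt 2 / (j.-1)%:R * D.
  move=> /[dup] b01 /andP[b0 b1].
  have i01 : mu.-integrable `[0, 1] (EFin \o (fun t => S t * phi j t)).
    apply: (@periodic_C1_integrable _ 2) => //; first exact: measurable_phi.
    exact: phi_bound.
  rewrite -[X in `|X|](subrK (\int[mu]_(t in `[0, b]) (S t * phi j t))).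
  rewrite (le_trans (ler_normD _ _))// Rintegral_itvB ?bnd_simp ?(ltW b0) ?(ltW b1)//.
  have tail : `|\int[mu]_(t in `]b, 1]) (S t * phi j t)| <= 2 * B * (1 - b).
    have sub : `]b, 1] `<=` `[0, 1].
      by move=> t /=; rewrite !in_itv/= => /andP[bt ->]; rewrite (ltW (lt_trans b0 bt)).
    have ib : mu.-integrable `]b, 1] (EFin \o (fun t => S t * phi j t)).
      exact: integrableS i01.
    rewrite (le_trans (le_normr_Rintegral _ ib))//.
    apply: (@le_trans _ _ (\int[mu]_(t in `]b, 1]) (2 * B))).
      apply: le_Rintegral => //.
      - exact: integrable_norm ib.
      - have ic : mu.-integrable `[0, 1] (EFin \o (fun=> 2 * B)).
          by apply: continuous_integrable => t; exact: cvg_cst.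
        exact: integrableS ic.
      - move=> t tb; rewrite normrM mulrC ler_pM// ?phi_bound//.
        by apply: periodic_C1_bound; have := sub _ tb; rewrite /= in_itv.
    by rewrite Rintegral_cst//= lebesgue_measure_itv/= lte_fin b1.
  have prim : `|phi_primitive j b| <= 2 * (1 - b).
    have dP t : is_derive t 1 (phi_primitive j) (phi j t : R).
      exact: is_derive_phi_primitive.
    have [c _ h] := MVT_segment (ltW b1) (fun x _ => dP x)
      (continuous_subspaceT (continuous_phi_primitive j1)).
    rewrite -normrN -[- _]add0r -(phi_primitive1 j) h normrM.
    by rewrite (@ger0_norm _ (1 - b)) ?subr_ge0 ?(ltW b1)// ler_wpM2r ?phi_bound// subr_ge0 ltW.
  have := fourier_partial_bound j1 b01; rewrite -/B => part.
  rewrite (le_trans (lerD tail part))// addrA lerD2r.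
  have := ler_wpM2l B0 prim; lra.
apply/ler_addgt0Pl => e e0.
have K0 : 0 < 4 * B + 1 by lra.
pose x := Num.max (1 / 2) (1 - e / (4 * B + 1)).
have x01 : 0 < x < 1.
  rewrite /x lt_max gt_max; apply/andP; split; first by apply/orP; left; lra.
  by apply/andP; split; [lra|rewrite gtrBl divr_gt0].
rewrite (le_trans (H _ x01))// lerD2r.
have h : 1 - x <= e / (4 * B + 1).
  by rewrite lerBlDr -lerBlDl /x le_max lexx orbT.
rewrite (@le_trans _ _ (4 * B * (e / (4 * B + 1))))//.
  by rewrite ler_wpM2l//; lra.
by rewrite mulrA ler_pdivrMr//; lra.
Qed.

Lemma fourier_sq_bound j : (1 < j)%N ->
  (\int[mu]_(t in `[0, 1]) (S t * phi j t)) ^+ 2 <= 2 * D ^+ 2 / (j.-1)%:R ^+ 2.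
Proof.
move=> j1; rewrite -real_normK ?num_real//.
have -> : 2 * D ^+ 2 / (j.-1)%:R ^+ 2 = (Num.sqrt 2 / (j.-1)%:R * D) ^+ 2.
  by rewrite !exprMn exprVn sqr_sqrtr//; ring.
by rewrite ler_sqr ?nnegrE ?fourier_bound// !mulr_ge0 ?sqrtr_ge0 ?invr_ge0 ?total_variation_ge0.
Qed.

(** By comparison with the telescoping sum of [2 (1 / i - 1 / i.+1)]. *)
Lemma sum_invr_sq_le (m n : nat) : (0 < m <= n)%N ->
  \sum_(m <= i < n) (i%:R ^- 2 : R) <= 2 / m%:R.
Proof.
move=> /andP[m0 mn].
apply: (@le_trans _ _ (\sum_(m <= i < n) (2 * (- (i.+1)%:R^-1 - - (i%:R^-1))))).
  apply: ler_sum_nat => i /andP[mi _].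
  have i0 : 0 < i%:R :> R by rewrite ltr0n (leq_trans m0).
  have i1 : 1 <= i%:R :> R by rewrite ler1n (leq_trans m0).
  have -> : 2 * (- (i.+1)%:R^-1 - - (i%:R^-1)) = 2 / (i%:R * (i%:R + 1)) :> R.
    by rewrite -natr1; field; rewrite gt_eqF//= gt_eqF// ltr_wpDr.
  rewrite ler_pdivlMr ?mulr_gt0 ?ltr_wpDr// ler_pdivrMl ?exprn_gt0//.
  by rewrite expr2; nra.
rewrite -mulr_sumr telescope_sumr// opprK ler_wpM2l//.
by rewrite gerDr oppr_le0 invr_ge0.
Qed.

(** The bias of the estimator of the noise variance: coefficients of order
    [1 / j] leave a tail of order [1 / m] beyond [m], here of order [sqrt n]. *)
Lemma fourier_tail_bound (n : nat) : (0 < n)%N ->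
  \sum_((Num.truncn (Num.sqrt n%:R : R)).+1 <= j < n.+1)
    (\int[mu]_(t in `[0, 1]) (S t * phi j t)) ^+ 2 <= 8 * D ^+ 2 / Num.sqrt n%:R.
Proof.
move=> n0; set r := Num.sqrt n%:R; set m := Num.truncn r.
have n1 : 1 <= n%:R :> R by rewrite ler1n.
have r1 : 1 <= r by rewrite /r -[leLHS]sqrtr1 ler_sqrt ?ler0n.
have r0 : 0 < r := lt_le_trans ltr01 r1.
have m0 : (0 < m)%N by rewrite truncn_gt0.
have /andP[mr rm] : m%:R <= r < m.+1%:R by rewrite truncn_itv// ltW.
have mn : (m <= n)%N.
  rewrite -(ler_nat R) (le_trans mr)//.
  by rewrite -[leRHS]sqr_sqrtr ?ler0n// expr2 -/r ler_peMr// ltW.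
have m0' : 0 < m%:R :> R by rewrite ltr0n.
rewrite big_add1 /=.
apply: (@le_trans _ _ (\sum_(m <= i < n) (2 * D ^+ 2 * i%:R ^- 2))).
  apply: ler_sum_nat => i /andP[mi _]; apply: fourier_sq_bound.
  by rewrite ltnS (leq_trans m0).
rewrite -mulr_sumr (le_trans (ler_wpM2l _ (@sum_invr_sq_le m n _)))//.
- by rewrite mulr_ge0// sqr_ge0.
- by rewrite m0.
have -> : 2 * D ^+ 2 * (2 / m%:R) = 4 * D ^+ 2 / m%:R by ring.
have -> : 8 * D ^+ 2 / r = 4 * D ^+ 2 * (2 / r) by ring.
rewrite ler_wpM2l ?mulr_ge0 ?total_variation_ge0// ler_pdivlMr// mulrC ler_pdivrMr//.
move: rm; rewrite -natr1; have : 1 <= m%:R :> R by rewrite ler1n.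
lra.
Qed.

End FourierDecay.

(** * Mean-square calculus *)

Section SquareIntegral.
Context {d : measure_display} {T : measurableType d} {R : realType}.
Variables (m : {measure set T -> \bar R}) (D : set T) (mD : measurable D).
Implicit Types (f g : T -> R) (c : R).

Definition sq_int f : \bar R := (\int[m]_(x in D) (f x ^+ 2)%:E)%E.

Lemma sq_int_ge0 f : (0 <= sq_int f)%E.
Proof. by apply: integral_ge0 => x _; rewrite lee_fin sqr_ge0. Qed.

Lemma measurable_sq f : measurable_fun D f ->
  measurable_fun D (fun x => (f x ^+ 2)%:E).
Proof. by move=> mf; apply/measurable_EFinP; exact: measurable_funX. Qed.

Lemma measurable_scale c f : measurable_fun D f ->
  measurable_fun D (fun x => c * f x).
Proof. by move=> mf; apply: measurable_funM => //; exact: measurable_cst. Qed.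

Lemma sq_intZ c f : measurable_fun D f ->
  sq_int (fun x => c * f x) = ((c ^+ 2)%:E * sq_int f)%E.
Proof.
move=> mf; rewrite /sq_int.
under eq_integral do rewrite exprMn EFinM.
rewrite ge0_integralZl//.
- exact: measurable_sq.
- by move=> x _; rewrite lee_fin sqr_ge0.
- by rewrite lee_fin sqr_ge0.
Qed.

(** Plays the part of the triangle inequality of L2; the factor 2 is harmless
    as it is only used to make quantities small. *)
Lemma sq_intD f g : measurable_fun D f -> measurable_fun D g ->
  (sq_int (fun x => f x + g x)%R <= 2%:E * sq_int f + 2%:E * sq_int g)%E.
Proof.
move=> mf mg; rewrite /sq_int.
rewrite -!ge0_integralZl//; try (exact: measurable_sq);
  try (by move=> x _; rewrite lee_fin sqr_ge0).
rewrite -ge0_integralD//; last 4 first.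
- by move=> x _; rewrite -EFinM lee_fin mulr_ge0// sqr_ge0.
- by apply: measurable_funeM; exact: measurable_sq.
- by move=> x _; rewrite -EFinM lee_fin mulr_ge0// sqr_ge0.
- by apply: measurable_funeM; exact: measurable_sq.
apply: ge0_le_integral => //.
- by move=> x _; rewrite lee_fin sqr_ge0.
- by apply: measurable_sq; exact: measurable_funD.
- by apply: emeasurable_funD; apply: measurable_funeM; exact: measurable_sq.
- move=> x _; rewrite -!EFinM -EFinD lee_fin.
  by have := sqr_ge0 (f x - g x); rewrite sqrrB sqrrD; lra.
Qed.

Lemma sq_int_lt_fin f : measurable_fun D f -> (sq_int f < +oo)%E ->
  m.-integrable D (EFin \o (fun x => f x ^+ 2)).
Proof.
move=> mf ff; apply/integrableP; split; first exact: measurable_sq.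
rewrite (_ : (\int[m]_(x in D) _)%E = sq_int f)//.
by apply: eq_integral => x _ /=; rewrite ger0_norm// sqr_ge0.
Qed.

Lemma sq_int_mul_integrable f g : measurable_fun D f -> measurable_fun D g ->
  (sq_int f < +oo)%E -> (sq_int g < +oo)%E ->
  m.-integrable D (EFin \o (fun x => f x * g x)).
Proof.
move=> mf mg ff gf.
have h : m.-integrable D (EFin \o (fun x => f x ^+ 2 + g x ^+ 2)).
  by apply: integrableD_EFin => //; exact: sq_int_lt_fin.
apply: (le_integrable mD _ _ h).
- by apply/measurable_EFinP; exact: measurable_funM.
- move=> x _ /=; rewrite lee_fin normrM (@ger0_norm _ (_ + _)) ?addr_ge0 ?sqr_ge0//.
  rewrite -(real_normK (num_real (f x))) -(real_normK (num_real (g x))).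
  by have := sqr_ge0 (`|f x| - `|g x|); have := sqr_ge0 (`|f x| + `|g x|);
    rewrite sqrrB sqrrD; lra.
Qed.

(** A substitute for the Cauchy-Schwarz inequality: it suffices to make the
    left-hand side small, and spares the square roots. *)
Lemma Rintegral_mul_amgm f g (eta : R) : measurable_fun D f -> measurable_fun D g ->
  (sq_int f < +oo)%E -> (sq_int g < +oo)%E -> 0 < eta ->
  `|\int[m]_(x in D) (f x * g x)| <=
    eta^-1 * fine (sq_int f) + eta * fine (sq_int g).
Proof.
move=> mf mg ff gf eta0.
have ifg := sq_int_mul_integrable mf mg ff gf.
have i1 := sq_int_lt_fin mf ff; have i2 := sq_int_lt_fin mg gf.
rewrite (le_trans (le_normr_Rintegral mD ifg))//.
rewrite -[fine (sq_int f)]/(\int[m]_(x in D) (f x ^+ 2)).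
rewrite -[fine (sq_int g)]/(\int[m]_(x in D) (g x ^+ 2)).
rewrite -!RintegralZl// -RintegralD//; try exact: integrableZl_EFin.
apply: le_Rintegral => //.
- exact: integrable_norm ifg.
- by apply: integrableD_EFin => //; exact: integrableZl_EFin.
- move=> x _; rewrite normrM.
  rewrite -(real_normK (num_real (f x))) -(real_normK (num_real (g x))).
  rewrite -(ler_pM2l eta0) mulrDr !mulrA divff ?gt_eqF// mul1r.
  have := sqr_ge0 (`|f x| - eta * `|g x|).
  have : 0 <= eta * `|f x| * `|g x| by rewrite !mulr_ge0// ltW.
  rewrite sqrrB exprMn; lra.
Qed.

End SquareIntegral.

Lemma continuous_sq_int_lt {R : realType} (f : R -> R) (a b : R) : continuous f ->
  (sq_int (@lebesgue_measure R) `[a, b] f < +oo)%E.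
Proof.
move=> cf.
have : lebesgue_measure.-integrable `[a, b] (EFin \o (fun t => f t ^+ 2)).
  by apply: continuous_integrable => t; apply: cvgM; exact: cf.
by move/integrable_fin_num => /(_ (measurable_itv _)); rewrite fin_numElt => /andP[].
Qed.

(** * Integrals of deterministic functions against a process *)

Section StochasticIntegral.
Context {R : realType}.
Local Notation mu := (@lebesgue_measure R).
Implicit Types (s : seq (R * (R * R))) (T K t : R) (f g : R -> R).

Definition scale_step (c : R) s := [seq (c * p.1, p.2) | p <- s].

Lemma step_fun_cat s1 s2 t : step_fun (s1 ++ s2) t = step_fun s1 t + step_fun s2 t.
Proof. by rewrite /step_fun big_cat. Qed.

Lemma step_int_cat s1 s2 x : step_int (s1 ++ s2) x = step_int s1 x + step_int s2 x.
Proof. by rewrite /step_int big_cat. Qed.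

Lemma step_fun_scale c s t : step_fun (scale_step c s) t = c * step_fun s t.
Proof. by rewrite /step_fun big_map mulr_sumr; apply: eq_bigr => p _; rewrite mulrA. Qed.

Lemma step_int_scale c s x : step_int (scale_step c s) x = c * step_int s x.
Proof. by rewrite /step_int big_map mulr_sumr; apply: eq_bigr => p _; rewrite mulrA. Qed.

Lemma is_step_cat T s1 s2 : is_step T s1 -> is_step T s2 -> is_step T (s1 ++ s2).
Proof. by rewrite /is_step all_cat => -> ->. Qed.

Lemma is_step_scale T c s : is_step T s -> is_step T (scale_step c s).
Proof. by rewrite /is_step all_map. Qed.

Lemma measurable_step_fun s D : measurable_fun D (step_fun s).
Proof.
apply: measurable_funTS; apply: measurable_sum => p.
apply: measurable_funM => //.
rewrite (_ : (fun t => _) = \1_(`]p.2.1, p.2.2]%classic)); first exact: measurable_indic.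
by apply/funext => t; rewrite indicE; congr (_%:R); congr nat_of_bool; rewrite mem_setE.
Qed.

Lemma step_intD (h x : R -> R) s :
  step_int s (fun t => h t + x t) = step_int s h + step_int s x.
Proof. by rewrite /step_int -big_split; apply: eq_bigr => p _ /=; ring. Qed.

Lemma step_fun_mul_integrable T s (S : R -> R) :
  mu.-integrable `[0, T] (EFin \o S) ->
  mu.-integrable `[0, T] (EFin \o (fun t => step_fun s t * S t)).
Proof.
move=> iS; pose B := \sum_(p <- s) `|p.1|.
have bs : [bounded step_fun s t | t in `[0, T]%classic : set R].
  exists B; split; [exact: num_real|] => y yB t _.
  rewrite /= (le_trans _ (ltW yB))// (le_trans (ler_norm_sum _ _ _))//.
  apply: ler_sum => p _; rewrite normrM ler_piMr// ger0_norm//.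
  by case: (_ < _ <= _).
have ms : measurable_fun (`[0, T]%classic : set R) (step_fun s).
  exact: measurable_step_fun.
apply: (eq_integrable _ _ _ _ (integrableMl _ iS ms bs)) => // t _ /=.
by rewrite mulrC.
Qed.

(** Elementary integrals against an absolutely continuous path are Lebesgue
    integrals. *)
Lemma step_int_primitive T s (S : R -> R) :
  mu.-integrable `[0, T] (EFin \o S) -> is_step T s ->
  step_int s (fun t => \int[mu]_(u in `[0, t]) S u) =
  \int[mu]_(t in `[0, T]) (step_fun s t * S t).
Proof.
move=> iS; elim: s => [_|p s IH /andP[/and3P[p0 pp pT] ss]].
  rewrite /step_int /step_fun big_nil.
  under eq_Rintegral do rewrite big_nil mul0r.
  by rewrite Rintegral_cst//= mul0r.
rewrite -cat1s step_int_cat IH//.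
under [RHS]eq_Rintegral do rewrite step_fun_cat mulrDl.
rewrite RintegralD//; try exact: step_fun_mul_integrable.
congr (_ + _); rewrite /step_int /step_fun big_seq1.
under [RHS]eq_Rintegral do rewrite big_seq1 -mulrA.
have ip : mu.-integrable `[0, p.2.2] (EFin \o S).
  apply: integrableS iS => // t /=; rewrite !in_itv/= => /andP[-> tp].
  exact: le_trans pT.
rewrite Rintegral_itvB ?bnd_simp//.
have -> : `]p.2.1, p.2.2]%classic = `[0, T] `&` `]p.2.1, p.2.2]%classic.
  apply/seteqP; split => t /=; rewrite !in_itv/=; last by case.
  move=> /andP[pt tp]; rewrite pt tp; split => //.
  by rewrite (le_trans p0 (ltW pt)) (le_trans tp).
rewrite Rintegral_mkcondr.
have iE t : (p.2.1 < t <= p.2.2)%R%:R * S t = (S \_ `]p.2.1, p.2.2]) t.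
  rewrite patchE mem_setE /= in_itv/=; case: ifP => _; first by rewrite mul1r.
  by rewrite mul0r.
under [RHS]eq_Rintegral do rewrite iE.
rewrite RintegralZl//.
apply: (eq_integrable _ _ _ _ (@step_fun_mul_integrable T [:: (1, p.2)] S iS)) => //.
by move=> t _; rewrite /= /step_fun big_seq1 mul1r iE.
Qed.

Definition step_approximable T (f : R -> R) : Prop :=
  measurable_fun `[0, T] f /\ forall delta, 0 < delta ->
    exists2 s, is_step T s &
      (sq_int mu `[0%R, T] (fun t => f t - step_fun s t)%R < delta%:E)%E.

(** Sampled at the right end points, which belong to the intervals of a step
    function, unlike the left ones. *)
Definition uniform_step T (f : R -> R) (k : nat) :=
  [seq (f (T * i.+1%:R / k%:R), (T * i%:R / k%:R, T * i.+1%:R / k%:R)) | i <- iota 0 k].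

Lemma is_step_uniform T f k : 0 <= T -> (0 < k)%N -> is_step T (uniform_step T f k).
Proof.
move=> T0 k0; have k0' : 0 < k%:R :> R by rewrite ltr0n.
apply/allP => _ /mapP[i + ->] /=; rewrite mem_iota add0n /= => ik.
apply/and3P; split.
- by rewrite !mulr_ge0 ?invr_ge0 ?ler0n.
- by rewrite ler_wpM2r ?invr_ge0 ?ler0n// ler_wpM2l// ler_nat.
- by rewrite ler_pdivrMr// ler_wpM2l// ler_nat.
Qed.

Lemma uniform_step_error T f K k t : 0 <= K -> (0 < k)%N ->
  (forall x y, `|f x - f y| <= K * `|x - y|) -> 0 < t <= T ->
  `|f t - step_fun (uniform_step T f k) t| <= K * (T / k%:R).
Proof.
move=> K0 k0 fK /andP[t0 tT]; have k0' : 0 < k%:R :> R by rewrite ltr0n.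
have T0 : 0 < T := lt_le_trans t0 tT.
rewrite /step_fun big_map /=.
pose a i := T * i%:R / k%:R.
have aS i : a i <= a i.+1 by rewrite /a ler_wpM2r ?invr_ge0 ?ler0n// ler_wpM2l ?(ltW T0)// ler_nat.
have ak i : a i.+1 - a i = T / k%:R by rewrite /a -natr1; field; rewrite gt_eqF.
rewrite (_ : \sum_(i <- _) _ = \sum_(0 <= i < k) f (a i.+1) * (a i < t <= a i.+1)%R%:R); last first.
  by rewrite /index_iota subn0.
(* Exactly one interval of the partition contains t. *)
have one : \sum_(0 <= i < k) (a i < t <= a i.+1)%R%:R = 1 :> R.
  rewrite (eq_bigr (fun i => (t <= a i.+1)%R%:R - (t <= a i)%R%:R)); last first.
    move=> i _; rewrite ltNge; have := aS i.
    case: (leP t (a i)) => h1 h; case: (leP t (a i.+1)) => h2 /=; lra.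
  rewrite telescope_sumr// /a mulr0 mul0r -mulrA divff ?gt_eqF// mulr1 tT.
  by rewrite leNgt t0/= subr0.
have -> : f t - \sum_(0 <= i < k) f (a i.+1) * (a i < t <= a i.+1)%R%:R =
    \sum_(0 <= i < k) (f t - f (a i.+1)) * (a i < t <= a i.+1)%R%:R.
  by under [RHS]eq_bigr do rewrite mulrBl; rewrite sumrB -mulr_sumr one mulr1.
rewrite (le_trans (ler_norm_sum _ _ _))//.
apply: (@le_trans _ _ (\sum_(0 <= i < k) K * (T / k%:R) * (a i < t <= a i.+1)%R%:R)); last first.
  by rewrite -mulr_sumr one mulr1.
apply: ler_sum => i _; rewrite normrM (@ger0_norm _ _%:R)//.
case: (boolP (a i < t <= a i.+1)) => //= h; last by rewrite !mulr0.
rewrite !mulr1 (le_trans (fK _ _))// ler_wpM2l// distrC ger0_norm; last first.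
  by rewrite subr_ge0; case/andP: h.
by rewrite -(ak i) lerD2l lerN2 ltW//; case/andP: h.
Qed.

(** The point 0 lies in no interval of a step function, but it is negligible. *)
Lemma lipschitz_step_approximable T f : 0 < T ->
  (exists2 K, 0 <= K & forall x y, `|f x - f y| <= K * `|x - y|) ->
  continuous f -> step_approximable T f.
Proof.
move=> T0 [K K0 fK] cf.
have mf D : measurable_fun D f.
  by apply: measurable_funTS; exact: continuous_measurable_fun.
split => // delta delta0.
pose k := (Num.truncn ((K * T) ^+ 2 * T / delta)).+1.
have k0 : 0 < k%:R :> R by rewrite ltr0n.
exists (uniform_step T f k); first by apply: is_step_uniform => //; exact: ltW.
have md : measurable_fun setT (fun t => (f t - step_fun (uniform_step T f k) t)).
  by apply: measurable_funB; [exact: mf|exact: measurable_step_fun].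
rewrite /sq_int -integral_itv_obnd_cbnd; last first.
  by apply: measurable_sq; exact: measurable_funTS md.
apply: (@le_lt_trans _ _ (\int[mu]_(t in `]0%R, T]) ((K * (T / k%:R)) ^+ 2)%:E)%E).
  apply: ge0_le_integral => //.
  - by move=> x _; rewrite lee_fin sqr_ge0.
  - by apply: measurable_sq; exact: measurable_funTS md.
  - move=> t; rewrite /= in_itv/= => t0T; rewrite lee_fin -real_normK ?num_real//.
    have hK : 0 <= K * (T / k%:R) by rewrite mulr_ge0// divr_ge0// ltW.
    by rewrite ler_sqr ?nnegrE//; exact: uniform_step_error.
rewrite integral_cst//= lebesgue_measure_itv/= lte_fin T0 oppr0 adde0 -EFinM lte_fin.
have : (K * T) ^+ 2 * T / delta < k%:R.
  have h0 : 0 <= (K * T) ^+ 2 * T / delta.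
    by rewrite divr_ge0 ?(ltW delta0)// mulr_ge0 ?sqr_ge0// ltW.
  by have /andP[] := truncn_itv h0.
rewrite ltr_pdivrMr// => h.
have -> : (K * (T / k%:R)) ^+ 2 * T = (K * T) ^+ 2 * T / k%:R ^+ 2.
  by field; rewrite gt_eqF.
rewrite ltr_pdivrMr ?exprn_gt0// (lt_le_trans h)// mulrC ler_wpM2l ?(ltW delta0)//.
by rewrite expr2 ler_peMr ?(ltW k0)// ler1n.
Qed.


Section Process.
Context {d : measure_display} {Omega : measurableType d}.
Variables (P : probability Omega R) (T : R).
Implicit Types (X : Omega -> R -> R) (Z : Omega -> R).

Definition measurable_process X : Prop :=
  forall t, 0 <= t <= T -> measurable_fun setT (fun w => X w t).

Lemma measurable_step_int s X : measurable_process X -> is_step T s ->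
  measurable_fun setT (fun w => step_int s (X w)).
Proof.
move=> mX; elim: s => [|p s IH] /=.
  by move=> _; rewrite /step_int; under eq_fun do rewrite big_nil; exact: measurable_cst.
move=> /andP[/and3P[p0 pp pT] /IH mS].
rewrite /step_int; under eq_fun do rewrite big_cons.
apply: measurable_funD => //; apply: measurable_scale => //.
by apply: measurable_funB; apply: mX; rewrite ?p0 ?pT ?(le_trans p0 pp) ?(le_trans pp pT).
Qed.

Lemma is_stoch_intE X f Z e : is_stoch_int P T X f Z -> 0 < e ->
  exists2 delta, 0 < delta & forall s, is_step T s ->
    (sq_int mu `[0%R, T] (fun t => f t - step_fun s t)%R < delta%:E)%E ->
    (sq_int P setT (fun w => step_int s (X w) - Z w)%R < e%:E)%E.
Proof.
move=> [_ H] e0; have [delta delta0 Hd] := H _ e0.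
exists delta => // s ss fs; have := Hd s ss fs.
by rewrite unlock.
Qed.

Let lt_combination (x y : \bar R) (c2 K e : R) : 0 <= c2 -> c2 <= K -> 0 < K ->
  (0 <= x)%E -> (0 <= y)%E -> (x < (e / 4)%:E)%E -> (y < (e / (4 * K))%:E)%E ->
  (2%:E * x + 2%:E * (c2%:E * y) < e%:E)%E.
Proof.
move=> c0 cK K0; move: x y => [x| |] [y| |]//; rewrite -!EFinM -EFinD !lee_fin !lte_fin.
move=> x0 y0 xe; rewrite ltr_pdivlMr ?mulr_gt0// => ye.
have : c2 * y <= K * y by rewrite ler_wpM2r.
by move: xe ye; lra.
Qed.

(** Only [f] has to be approximable: from a step function near [g + c f],
    subtracting [c] times a step function near [f] gives one near [g]. *)
Lemma is_stoch_int_lin X f g Zf Zg c : measurable_process X ->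
  step_approximable T f -> measurable_fun `[0, T] g ->
  is_stoch_int P T X f Zf -> is_stoch_int P T X g Zg ->
  is_stoch_int P T X (fun t => g t + c * f t) (fun w => Zg w + c * Zf w).
Proof.
move=> mX [mf af] mg HZf HZg.
have [mZf _] := HZf; have [mZg _] := HZg.
split; first by apply: measurable_funD => //; exact: measurable_scale.
move=> e e0; pose K := 1 + c ^+ 2.
have K0 : 0 < K by rewrite ltr_wpDr ?sqr_ge0.
have c2K : c ^+ 2 <= K by rewrite lerDr.
have [df df0 Hf] := is_stoch_intE HZf (divr_gt0 e0 (mulr_gt0 (ltr0n _ 4) K0)).
have [dg dg0 Hg] := is_stoch_intE HZg (divr_gt0 e0 (ltr0n _ 4)).
have [] := af (Num.min df (dg / (4 * K))); first by rewrite lt_min df0 divr_gt0 ?mulr_gt0.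
move=> sf ssf; rewrite EFin_min lt_min => /andP[sfdf sfdg].
exists (dg / 4); first by rewrite divr_gt0.
move=> s ss hs.
have ms s' : measurable_fun `[0, T] (step_fun s') by exact: measurable_step_fun.
have mi s' : is_step T s' -> measurable_fun setT (fun w => step_int s' (X w)).
  exact: measurable_step_int.
pose s' := s ++ scale_step (- c) sf.
have ss' : is_step T s' by apply: is_step_cat => //; exact: is_step_scale.
have near_g : (sq_int mu `[0%R, T] (fun t => g t - step_fun s' t)%R < dg%:E)%E.
  have -> : (fun t => g t - step_fun s' t) =
      (fun t => (g t + c * f t - step_fun s t) + (- c) * (f t - step_fun sf t)).
    by apply/funext => t; rewrite step_fun_cat step_fun_scale; ring.
  apply: (le_lt_trans (sq_intD _ _ _ _)) => //.
  - apply: measurable_funB; last exact: ms.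
    by apply: measurable_funD => //; exact: measurable_scale.
  - by apply: measurable_scale; apply: measurable_funB => //; exact: ms.
  rewrite sq_intZ//; last by apply: measurable_funB => //; exact: ms.
  by apply: (lt_combination (sqr_ge0 (- c)) _ K0 (sq_int_ge0 _ _ _) (sq_int_ge0 _ _ _) hs sfdg);
    rewrite sqrrN.
rewrite unlock -[X in (X < _)%E]/(sq_int P setT (fun w => step_int s (X w) - (Zg w + c * Zf w))).
have -> : (fun w => step_int s (X w) - (Zg w + c * Zf w)) =
    (fun w => (step_int s' (X w) - Zg w) + c * (step_int sf (X w) - Zf w)).
  by apply/funext => w; rewrite step_int_cat step_int_scale; ring.
apply: (le_lt_trans (sq_intD _ _ _ _)) => //.
- by apply: measurable_funB => //; exact: mi.
- by apply: measurable_scale => //; apply: measurable_funB => //; exact: mi.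
rewrite sq_intZ//; last by apply: measurable_funB => //; exact: mi.
exact: (lt_combination (sqr_ge0 c) c2K K0 (sq_int_ge0 _ _ _) (sq_int_ge0 _ _ _)
  (Hg _ ss' near_g) (Hf _ ssf sfdf)).
Qed.

(** Both versions are close, in mean square, to the elementary integral of one
    and the same step function near [f]. *)
Lemma is_stoch_int_unique X f Z Z' : measurable_process X ->
  step_approximable T f ->
  is_stoch_int P T X f Z -> is_stoch_int P T X f Z' ->
  {ae P, forall w, Z w = Z' w}.
Proof.
move=> mX [mf af] HZ HZ'; have [mZ _] := HZ; have [mZ' _] := HZ'.
have mD : measurable_fun setT (fun w => Z w - Z' w) by exact: measurable_funB.
have small e : 0 < e -> (sq_int P setT (fun w => Z w - Z' w)%R <= e%:E)%E.
  move=> e0; have e4 : 0 < e / 4 by rewrite divr_gt0.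
  have [d1 d10 H1] := is_stoch_intE HZ e4.
  have [d2 d20 H2] := is_stoch_intE HZ' e4.
  have [] := af (Num.min d1 d2); first by rewrite lt_min d10.
  move=> s ss; rewrite EFin_min lt_min => /andP[s1 s2].
  have ms := measurable_step_int mX ss.
  have -> : (fun w => Z w - Z' w) =
      (fun w => (-1) * (step_int s (X w) - Z w) + (step_int s (X w) - Z' w)).
    by apply/funext => w; ring.
  apply: (le_trans (sq_intD _ _ _ _)) => //.
  - by apply: measurable_scale => //; exact: measurable_funB.
  - exact: measurable_funB.
  rewrite sq_intZ//; last exact: measurable_funB.
  rewrite sqrrN expr1n mul1e.
  rewrite (_ : e%:E = 2%:E * (e / 4)%:E + 2%:E * (e / 4)%:E)%E; last first.
    by rewrite -!EFinM -EFinD; congr EFin; field.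
  by rewrite leeD// lee_wpmul2l// ltW//; [exact: H1|exact: H2].
have zero : sq_int P setT (fun w => Z w - Z' w) = 0%E.
  apply/eqP; rewrite eq_le sq_int_ge0 andbT.
  by apply/lee_addgt0Pr => e e0; rewrite add0e small.
have /ae_eq_integral_abs : measurable_fun setT (fun w => ((Z w - Z' w) ^+ 2)%:E).
  exact: measurable_sq.
move=> /(_ P measurableT) [+ _] => H.
have : ae_eq P setT (fun w => ((Z w - Z' w) ^+ 2)%:E) (cst 0%E).
  apply: H; rewrite -zero; apply: eq_integral => w _ /=.
  by rewrite ger0_norm// sqr_ge0.
apply: filterS => w /(_ I) [] /eqP.
by rewrite sqrf_eq0 subr_eq0 => /eqP.
Qed.

(** Removing an absolutely continuous drift from the integrator only shifts
    the integral by a constant: on a step function near [f], the drift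
    contributes the integral of this function against [S], which is close to
    the integral of [f * S]. *)
Lemma is_stoch_int_drift X f Z (S : R -> R) : measurable_process X ->
  step_approximable T f -> (sq_int mu `[0%R, T] f < +oo)%E ->
  measurable_fun `[0, T] S -> (sq_int mu `[0%R, T] S < +oo)%E ->
  is_stoch_int P T (fun w t => \int[mu]_(u in `[0, t]) S u + X w t) f Z ->
  is_stoch_int P T X f (fun w => Z w - \int[mu]_(t in `[0, T]) (f t * S t)).
Proof.
move=> mX [mf af] ff mS fS HZ; have [mZ _] := HZ.
split; first exact: measurable_funB.
move=> e e0.
(* The drift part will be made smaller than d0, whose square is at most e / 8. *)
pose d0 := Num.min 1 (e / 8).
have d00 : 0 < d0 by rewrite lt_min ltr01 divr_gt0.
have d0e : d0 ^+ 2 <= e / 8.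
  rewrite expr2 (@le_trans _ _ (d0 * 1))// ?ler_wpM2l ?(ltW d00)//.
    by rewrite ge_min lexx.
  by rewrite mulr1 ge_min lexx orbT.
pose V := fine (sq_int mu `[0%R, T] S).
have V0 : 0 <= V by rewrite fine_ge0// sq_int_ge0.
pose eta := d0 / (2 * (V + 1)).
have eta0 : 0 < eta by rewrite divr_gt0// mulr_gt0// ltr_wpDl.
have [d1 d10 H1] := is_stoch_intE HZ (divr_gt0 e0 (ltr0n _ 4)).
exists (Num.min d1 (eta * (d0 / 2))); first by rewrite lt_min d10 mulr_gt0 // divr_gt0.
move=> s ss; rewrite EFin_min lt_min => /andP[sd1 sd2].
have ms : measurable_fun `[0, T] (step_fun s) by exact: measurable_step_fun.
have iS : mu.-integrable `[0, T] (EFin \o S).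
  have i1 : (sq_int mu `[0%R, T] (fun=> 1)%R < +oo)%E.
    rewrite /sq_int; under eq_integral do rewrite expr1n.
    rewrite integral_cst//= lebesgue_measure_itv/=; case: ifP => _.
      by rewrite oppr0 adde0 mul1e ltry.
    by rewrite mule0 ltry.
  apply: (eq_integrable _ _ _ _ (sq_int_mul_integrable _ _ _ i1 fS)) => //.
  by move=> t _ /=; rewrite mul1r.
pose u t := step_fun s t - f t.
have meas_u : measurable_fun `[0, T] u by exact: measurable_funB.
have uE : sq_int mu `[0%R, T] u = sq_int mu `[0%R, T] (fun t => f t - step_fun s t)%R.
  by apply: eq_integral => t _; rewrite /u -sqrrN opprB.
have uoo : (sq_int mu `[0%R, T] u < +oo)%E by rewrite uE (lt_trans sd2) ?ltry.
have sS : mu.-integrable `[0, T] (EFin \o (fun t => step_fun s t * S t)).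
  exact: step_fun_mul_integrable.
have ifS : mu.-integrable `[0, T] (EFin \o (fun t => f t * S t)).
  exact: sq_int_mul_integrable.
pose delta := \int[mu]_(t in `[0, T]) (u t * S t).
have deltaE : delta = \int[mu]_(t in `[0, T]) (step_fun s t * S t) -
    \int[mu]_(t in `[0, T]) (f t * S t).
  rewrite -RintegralB//; apply: eq_Rintegral => t _.
  by rewrite /u mulrBl.
have delta_le : `|delta| <= d0.
  have := @Rintegral_mul_amgm _ _ R mu `[0, T]%classic (measurable_itv _)
    u S eta meas_u mS uoo fS eta0.
  move=> /le_trans; apply; rewrite -/V.
  have h1 : eta^-1 * fine (sq_int mu `[0%R, T] u) <= d0 / 2.
    rewrite ler_pdivrMl// -lee_fin fineK; last first.
      by rewrite ge0_fin_numE// sq_int_ge0.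
    by rewrite uE ltW.
  have h2 : eta * V <= d0 / 2.
    rewrite /eta -mulrA ler_wpM2l ?(ltW d00)// ler_pdivrMl ?mulr_gt0 ?ltr_wpDl//.
    by rewrite mulrC mulrA mulVf// mul1r; lra.
  lra.
rewrite unlock -[X in (X < _)%E]/(sq_int P setT
  (fun w => step_int s (X w) - (Z w - \int[mu]_(t in `[0, T]) (f t * S t)))).
have -> : (fun w => step_int s (X w) - (Z w - \int[mu]_(t in `[0, T]) (f t * S t))) =
    (fun w => (step_int s (fun t => \int[mu]_(x in `[0, t]) S x + X w t) - Z w) + (- delta)).
  by apply/funext => w; rewrite (step_intD (fun t => \int[mu]_(x in `[0, t]) S x))
    (step_int_primitive iS ss) deltaE; ring.
have msX' : measurable_fun setT
    (fun w => step_int s (fun t => \int[mu]_(x in `[0, t]) S x + X w t)).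
  apply: (@measurable_step_int s (fun w t => \int[mu]_(x in `[0, t]) S x + X w t)) => //.
  by move=> t tT; apply: measurable_funD => //; exact: mX.
apply: (le_lt_trans (sq_intD _ _ _ _)) => //; first exact: measurable_funB.
have -> : sq_int P setT (fun=> - delta) = (delta ^+ 2)%:E.
  by rewrite /sq_int integral_cst//= probability_setT mule1 sqrrN.
rewrite (_ : e%:E = 2%:E * (e / 4)%:E + 2%:E * (e / 4)%:E)%E; last first.
  by rewrite -!EFinM -EFinD; congr EFin; field.
apply: lte_leD => //.
+ by rewrite lte_pmul2l// ?lte_fin//; exact: H1.
+ rewrite lee_wpmul2l// lee_fin -real_normK ?num_real//.
  have : `|delta| ^+ 2 <= d0 ^+ 2 by rewrite ler_sqr ?nnegrE// ltW.
  by move: d0e e0; lra.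
Qed.
End Process.

End StochasticIntegral.

(** * The noise coefficients *)

Section FiniteSums.
Context {R : realType}.
Implicit Types (F x a : nat -> R) (n N : nat).

(** All the sequences at hand have finite support, so that the sums over all
    indices become sums up to one common bound [N]. *)
Lemma fsum_pos_nat F N : (forall j, (N <= j)%N -> F j = 0) ->
  \sum_(j \in [set j | (0 < j)%N]) F j = \sum_(1 <= j < N) F j.
Proof.
move=> FN; rewrite -(@fsbig_widen _ _ _ _ [set` index_iota 1 N]).
- by rewrite -fsbig_seq// iota_uniq.
- by move=> j /=; rewrite mem_index_iota => /andP[].
- by move=> j [/= j0]; rewrite mem_index_iota j0 /= => /negP; rewrite -leqNgt => /FN.
Qed.

Lemma sum_nat_eq0 a N : \sum_(1 <= j < N) a j ^+ 2 = 0 ->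
  forall j, (0 < j < N)%N -> a j = 0.
Proof.
move=> /eqP; rewrite psumr_eq0 => [|j _]; last exact: sqr_ge0.
move=> /allP H j jN; have := H j; rewrite mem_index_iota jN => /(_ isT).
by rewrite sqrf_eq0 => /eqP.
Qed.

Lemma supp_le_interval n x : (forall j, (n < j)%N -> x j = 0) -> supp_le n x.
Proof.
move=> xn; have sub : supp x `<=` [set` index_iota 1 n.+1].
  move=> j /= [j0 xj]; rewrite mem_index_iota j0 ltnS leqNgt.
  by apply: contra xj => /xn ->.
have fin : finite_set (supp x) by apply: sub_finite_set sub _; exact: finite_seq.
split=> //; rewrite /nsupp.
have : (fset_set (supp x) `<=` [fset j in index_iota 1 n.+1])%fset.
  by apply/fsubsetP => j; rewrite in_fset_set// inE => /sub /=; rewrite !inE.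
move=> /fsubset_leq_card /leq_trans; apply.
by rewrite card_fseq undup_id ?iota_uniq// size_iota subn1.
Qed.

Lemma supp_scale c x : c != 0 -> supp (fun j => c * x j) = supp x.
Proof.
move=> c0; apply/funext => j; rewrite /supp /= mulf_eq0 (negbTE c0).
by [].
Qed.

Lemma supp_le_scale n c x : c != 0 -> supp_le n x -> supp_le n (fun j => c * x j).
Proof. by move=> c0; rewrite /supp_le /nsupp supp_scale. Qed.

End FiniteSums.

Section Noise.
Context {R : realType} {n : nat} (hn : (0 < n)%N).
Local Notation mu := (@lebesgue_measure R).
Local Notation Omega := (skorokhod (n%:R : R)).
Variables (Q : probability Omega R) (sigmaQ : R).
Hypothesis HQ : noise_condition Q sigmaQ.
Implicit Types (a : nat -> R) (j N : nat).

Let n0 : 0 < n%:R :> R. Proof. by rewrite ltr0n. Qed.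

Lemma measurable_coord : measurable_process n%:R (fun w : Omega => Defs.coord w).
Proof.
move=> t tn _ B mB; rewrite setTI; apply: sub_sigma_algebra.
by exists t, B.
Qed.

Lemma phi_step_approximable j : step_approximable (n%:R : R) (phi j).
Proof.
apply: lipschitz_step_approximable => //; first exact: phi_lipschitz.
exact: continuous_phi.
Qed.

Lemma L2_on_continuous (f : R -> R) : continuous f -> L2_on 0 n%:R f.
Proof.
move=> cf; split; first by apply: measurable_funTS; exact: continuous_measurable_fun.
exact: continuous_sq_int_lt.
Qed.

Lemma stoch_intP (f : R -> R) : continuous f ->
  is_stoch_int Q n%:R (fun w : Omega => Defs.coord w) f (stoch_int Q f).
Proof.
move=> /L2_on_continuous cf; have [_ /(_ _ cf) [[Z HZ] _ _]] := HQ.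
exact: (xgetPex (fun=> 0) (ex_intro _ Z HZ)).
Qed.

Definition trig_poly a N : R -> R := fun t => \sum_(1 <= j < N) a j * phi j t.

Lemma continuous_trig_poly a N : continuous (trig_poly a N).
Proof.
rewrite /trig_poly; elim: (index_iota 1 N) => [|j s IH].
  by under eq_fun do rewrite big_nil; move=> t; exact: cvg_cst.
under eq_fun do rewrite big_cons.
move=> t; apply: cvgD; last exact: IH.
by apply: cvgMl_tmp; exact: continuous_phi.
Qed.

Lemma measurable_trig_poly a N D : measurable_fun D (trig_poly a N).
Proof.
by apply: measurable_funTS; apply: continuous_measurable_fun; exact: continuous_trig_poly.
Qed.

Lemma trig_poly_step_approximable a N : step_approximable (n%:R : R) (trig_poly a N).
Proof.
apply: lipschitz_step_approximable => //; last exact: continuous_trig_poly.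
rewrite /trig_poly; elim: (index_iota 1 N) => [|j s [K K0 HK]].
  by exists 0 => // x y; rewrite !big_nil subrr normr0 mul0r.
have [L L0 HL] := @phi_lipschitz R j.
exists (`|a j| * L + K) => [|x y]; first by rewrite addr_ge0// mulr_ge0.
rewrite !big_cons opprD addrACA -mulrBr (le_trans (ler_normD _ _))//.
by rewrite mulrDl lerD// normrM -mulrA ler_wpM2l.
Qed.

Lemma is_stoch_int_trig_poly a N :
  is_stoch_int Q n%:R (fun w : Omega => Defs.coord w) (trig_poly a N)
    (fun w => \sum_(1 <= j < N) a j * stoch_int Q (phi j) w).
Proof.
have HI j := stoch_intP (@continuous_phi R j).
rewrite /trig_poly; elim/last_ind: (index_iota 1 N) => [|s j IH].
  (* The integral of zero, as that of phi 1 - phi 1. *)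
  have := is_stoch_int_lin (-1) measurable_coord (phi_step_approximable 1)
    (proj1 (phi_step_approximable 1)) (HI 1%N) (HI 1%N).
  by congr is_stoch_int; apply/funext => x; rewrite big_nil mulN1r subrr.
have -> : (fun t => \sum_(i <- rcons s j) a i * phi i t) =
    (fun t => \sum_(i <- s) a i * phi i t + a j * phi j t).
  by apply/funext => t; rewrite -cats1 big_cat big_seq1.
have -> : (fun w => \sum_(i <- rcons s j) a i * stoch_int Q (phi i) w) =
    (fun w => \sum_(i <- s) a i * stoch_int Q (phi i) w + a j * stoch_int Q (phi j) w).
  by apply/funext => w; rewrite -cats1 big_cat big_seq1.
apply: is_stoch_int_lin => //.
- exact: measurable_coord.
- exact: phi_step_approximable.
- by apply: measurable_sum => i; apply: measurable_scale; apply: measurable_funTS; exact: measurable_phi.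
Qed.

Lemma trig_poly_sq_int a N :
  sq_int mu `[0%R, n%:R] (trig_poly a N) = (n%:R * \sum_(1 <= j < N) a j ^+ 2)%:E.
Proof.
have ip j k : mu.-integrable `[0, n%:R] (EFin \o (fun t => a j * a k * (phi j t * phi k t))).
  apply: integrableZl_EFin => //; apply: continuous_integrable => t.
  by apply: cvgM; exact: continuous_phi.
have E t : trig_poly a N t ^+ 2 =
    \sum_(1 <= j < N) \sum_(1 <= k < N) a j * a k * (phi j t * phi k t).
  rewrite expr2 /trig_poly mulr_suml; apply: eq_bigr => j _.
  by rewrite mulr_sumr; apply: eq_bigr => k _; ring.
have isq : mu.-integrable `[0, n%:R] (EFin \o (fun t => trig_poly a N t ^+ 2)).
  by apply: continuous_integrable => t; apply: cvgM; exact: continuous_trig_poly.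
rewrite /sq_int -[LHS]fineK; last exact: integrable_fin_num.
congr EFin; rewrite -[LHS]/(\int[mu]_(t in `[0, n%:R]) (trig_poly a N t ^+ 2)).
under eq_Rintegral do rewrite E.
rewrite Rintegral_sum//; last by move=> j; exact: integrable_sum_EFin.
rewrite mulr_sumr big_seq [RHS]big_seq; apply: eq_bigr => j.
rewrite mem_index_iota => /andP[j0 jN].
rewrite Rintegral_sum// (bigD1_seq j) ?iota_uniq ?mem_index_iota ?j0//=.
have ipp k : mu.-integrable `[0, n%:R] (EFin \o (fun t => phi j t * phi k t)).
  by apply: continuous_integrable => t; apply: cvgM; exact: continuous_phi.
rewrite RintegralZl// phi_orthogonal// eqxx muln1 big_seq_cond big1 ?addr0.
  by rewrite expr2 mulrC.
move=> k; rewrite mem_index_iota => /andP[/andP[k0 kN] kj].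
by rewrite RintegralZl// phi_orthogonal// eq_sym (negbTE kj) muln0 mulr0.
Qed.

Lemma measurable_stoch_int j : measurable_fun setT (stoch_int Q (phi j)).
Proof. by have [] := stoch_intP (@continuous_phi R j). Qed.

Lemma measurable_xi j : measurable_fun setT (xi Q j).
Proof. by apply: measurable_scale; exact: measurable_stoch_int. Qed.

Lemma measurable_noise_sum a N :
  measurable_fun setT (fun w => \sum_(1 <= j < N) a j * xi Q j w).
Proof. by apply: measurable_sum => j; apply: measurable_scale; exact: measurable_xi. Qed.

(** Up to a factor [sqrt n], the weighted sum of the noise coefficients is the
    integral of a trigonometric polynomial, whose squared norm over [n] periods
    is [n] times the sum of the squared weights. *)
Lemma noise_sum_sq_int_le a N :
  (sq_int Q setT (fun w => \sum_(1 <= j < N) a j * xi Q j w)%R <=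
   (sigmaQ * \sum_(1 <= j < N) a j ^+ 2)%:E)%E.
Proof.
set f := trig_poly a N; set Z := fun w : Omega => \sum_(1 <= j < N) a j * stoch_int Q (phi j) w.
have mZ : measurable_fun setT Z.
  by apply: measurable_sum => j; apply: measurable_scale; exact: measurable_stoch_int.
have -> : (fun w => \sum_(1 <= j < N) a j * xi Q j w) = (fun w => (Num.sqrt n%:R)^-1 * Z w).
  by apply/funext => w; rewrite /Z mulr_sumr; apply: eq_bigr => j _; rewrite /xi mulrCA.
rewrite sq_intZ// exprVn sqr_sqrtr ?ler0n//.
have HI := stoch_intP (@continuous_trig_poly a N).
have [mI _] := HI.
have ZI : {ae Q, forall w, Z w = stoch_int Q f w}.
  apply: is_stoch_int_unique (is_stoch_int_trig_poly a N) HI.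
    exact: measurable_coord.
  exact: trig_poly_step_approximable.
have -> : sq_int Q setT Z = sq_int Q setT (stoch_int Q f).
  apply: ge0_ae_eq_integral => //; try exact: measurable_sq;
    try (by move=> w _; rewrite lee_fin sqr_ge0).
  by apply: filterS ZI => w -> _.
have [_ /(_ _ (L2_on_continuous (@continuous_trig_poly a N)))] := HQ.
case=> _ _; rewrite unlock -[X in (X <= _)%E]/(sq_int Q setT (stoch_int Q f)).
rewrite -[X in (_ <= _ * X)%E]/(sq_int mu `[0%R, n%:R] f) trig_poly_sq_int.
move=> /(lee_wpmul2l (_ : (0 <= (n%:R^-1)%:E)%E)); rewrite lee_fin invr_ge0 ler0n.
move=> /(_ isT) /le_trans; apply.
rewrite -!EFinM lee_fin le_eqVlt; apply/orP; left; apply/eqP.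
by field; rewrite gt_eqF.
Qed.

Lemma sq_int_xi_le j : (0 < j)%N -> (sq_int Q setT (xi Q j) <= sigmaQ%:E)%E.
Proof.
move=> j0; have := noise_sum_sq_int_le (fun i => (i == j)%:R) j.+1.
rewrite big_nat_recr//= eqxx expr1n big_nat_cond big1; last first.
  by move=> i /andP[/andP[_ ij] _]; rewrite (ltn_eqF ij) expr0n.
rewrite add0r mulr1; congr (_ <= _)%E; congr sq_int; apply/funext => w.
rewrite big_nat_recr//= eqxx mul1r big_nat_cond big1 ?add0r//.
by move=> i /andP[/andP[_ ij] _]; rewrite (ltn_eqF ij) mul0r.
Qed.

Lemma integrable_xi_sq j : (0 < j)%N ->
  Q.-integrable setT (EFin \o (fun w => xi Q j w ^+ 2)).
Proof.
move=> j0; apply: sq_int_lt_fin => //; first exact: measurable_xi.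
by rewrite (le_lt_trans (sq_int_xi_le j0))// ltry.
Qed.

Lemma xi_varE j : xi_var Q j = \int[Q]_w (xi Q j w ^+ 2).
Proof. by rewrite /xi_var unlock. Qed.

Lemma probability_sq_int1 : (sq_int Q setT (fun=> 1)%R < +oo)%E.
Proof.
rewrite /sq_int; under eq_integral do rewrite expr1n.
by rewrite integral_cst//= probability_setT mule1 ltry.
Qed.

Lemma integrable_xi j : (0 < j)%N -> Q.-integrable setT (EFin \o xi Q j).
Proof.
move=> j0; apply: (eq_integrable _ _ _ _
  (sq_int_mul_integrable (f := fun=> 1) measurableT _ (@measurable_xi j) probability_sq_int1 _)) => //.
- by move=> w _ /=; rewrite mul1r.
- by rewrite (le_lt_trans (sq_int_xi_le j0))// ltry.
Qed.

Lemma Rintegral_xi j : (0 < j)%N -> \int[Q]_w xi Q j w = 0.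
Proof.
move=> j0.
have [_ /(_ _ (L2_on_continuous (@continuous_phi R j))) [_]] := HQ.
rewrite unlock => I0 _.
have iI : Q.-integrable setT (EFin \o stoch_int Q (phi j)).
  apply: (eq_integrable _ _ _ _ (integrableZl_EFin measurableT (Num.sqrt n%:R) (integrable_xi j0))) => //.
  by move=> w _ /=; rewrite /xi mulVKf// gt_eqF// sqrtr_gt0.
by rewrite /xi RintegralZl// /Rintegral I0 mulr0.
Qed.

(** The mean of the loss in one coordinate is at least the contribution of
    the noise: the bias can only increase it. *)
Lemma sq_int_affine_xi_ge (b c : R) j : (0 < j)%N ->
  ((c ^+ 2 * xi_var Q j)%:E <= sq_int Q setT (fun w => b + c * xi Q j w)%R)%E.
Proof.
move=> j0.
have i1 := integrable_xi j0; have i2 := integrable_xi_sq j0.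
have ic : Q.-integrable setT (EFin \o (fun=> b ^+ 2)) by exact: finite_measure_integrable_cst.
have il : Q.-integrable setT (EFin \o (fun w => (2 * b * c) * xi Q j w)).
  exact: integrableZl_EFin.
have iq : Q.-integrable setT (EFin \o (fun w => c ^+ 2 * xi Q j w ^+ 2)).
  exact: (integrableZl_EFin _ _ i2).
have ilq := integrableD_EFin measurableT il iq.
have iall := integrableD_EFin measurableT ic ilq.
have E w : (b + c * xi Q j w) ^+ 2 = b ^+ 2 + (2 * b * c * xi Q j w + c ^+ 2 * xi Q j w ^+ 2).
  by ring.
rewrite /sq_int; under eq_integral do rewrite E.
rewrite -[leRHS]fineK; last exact: integrable_fin_num.
rewrite lee_fin -[leRHS]/(\int[Q]_w (b ^+ 2 + (2 * b * c * xi Q j w + c ^+ 2 * xi Q j w ^+ 2))).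
rewrite RintegralD// RintegralD// (RintegralZl (f := xi Q j))// (RintegralZl (f := fun w => xi Q j w ^+ 2))//.
rewrite Rintegral_xi// mulr0 add0r -xi_varE lerDr.
by rewrite Rintegral_ge0// => w _; exact: sqr_ge0.
Qed.

Definition noise_fluct a N (w : Omega) : R :=
  \sum_(1 <= j < N) a j * (xi Q j w ^+ 2 - xi_var Q j).

Lemma measurable_noise_fluct a N : measurable_fun setT (noise_fluct a N).
Proof.
apply: measurable_sum => j; apply: measurable_scale; apply: measurable_funB => //.
by apply: measurable_funX; exact: measurable_xi.
Qed.

Variables (varsigmaQ l : R).
Hypothesis HL : (L1 varsigmaQ Q + L2 Q <= l%:E)%E.

Let supp_le0 : supp_le n (fun=> 0 : R).
Proof. exact: supp_le_interval. Qed.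

Lemma L1_ge0 : (0 <= L1 varsigmaQ Q)%E.
Proof.
apply: ereal_sup_ubound; exists (fun=> 0); last by rewrite fsbig1 ?normr0// => j _; rewrite mul0r.
by split => // j; rewrite oppr_le0 ler01.
Qed.

Lemma L2_ge0 : (0 <= L2 Q)%E.
Proof.
apply: ereal_sup_ubound; exists (fun=> 0).
  by split => //; rewrite /sqnorm fsbig1// => j _; rewrite expr0n.
rewrite unlock; apply: integral0_eq => w _.
by rewrite fsbig1 ?expr0n// => j _; rewrite mul0r.
Qed.

Lemma L1_bound x N : (forall j, -1 <= x j <= 1) -> supp_le n x ->
  (forall j, (N <= j)%N -> x j = 0) ->
  `|\sum_(1 <= j < N) x j * (xi_var Q j - varsigmaQ)| <= l.
Proof.
move=> x1 xn xN; rewrite -lee_fin (le_trans _ HL)//.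
rewrite (@le_trans _ _ (L1 varsigmaQ Q))//; last by rewrite leeDl// L2_ge0.
apply: ereal_sup_ubound; exists x => //.
by rewrite (@fsum_pos_nat _ _ N)// => j /xN ->; rewrite mul0r.
Qed.

Lemma L2_bound x N : \sum_(1 <= j < N) x j ^+ 2 <= 1 -> supp_le n x ->
  (forall j, (N <= j)%N -> x j = 0) ->
  (sq_int Q setT (noise_fluct x N) <= l%:E)%E.
Proof.
move=> x1 xn xN; rewrite (le_trans _ HL)//.
rewrite (@le_trans _ _ (L2 Q))//; last by rewrite leeDr// L1_ge0.
apply: ereal_sup_ubound; exists x.
  by split => //; rewrite /sqnorm (@fsum_pos_nat _ _ N)// => j /xN ->; rewrite expr0n.
rewrite unlock; apply: eq_integral => w _; rewrite /noise_fluct.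
by rewrite (@fsum_pos_nat _ _ N)// => j /xN ->; rewrite mul0r.
Qed.

(** By homogeneity, from the unit ball to all weights. *)
Lemma noise_fluct_sq_int_le a N : supp_le n a ->
  (forall j, (N <= j)%N -> a j = 0) ->
  (sq_int Q setT (noise_fluct a N) <= (l * \sum_(1 <= j < N) a j ^+ 2)%:E)%E.
Proof.
move=> an aN; set A := \sum_(1 <= j < N) a j ^+ 2.
have A0 : 0 <= A by rewrite sumr_ge0// => j _; exact: sqr_ge0.
have [Az|Ap] := eqVneq A 0.
  have az := sum_nat_eq0 Az.
  rewrite Az mulr0 /sq_int integral0_eq// => w _.
  rewrite /noise_fluct big_nat_cond big1 ?expr0n// => j /andP[jN _].
  by rewrite az// mul0r.
have s0 : 0 < Num.sqrt A by rewrite sqrtr_gt0 lt_neqAle eq_sym Ap.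
have sA : Num.sqrt A ^+ 2 = A by rewrite sqr_sqrtr.
have := @L2_bound (fun j => (Num.sqrt A)^-1 * a j) N.
have -> : \sum_(1 <= j < N) ((Num.sqrt A)^-1 * a j) ^+ 2 = 1.
  under eq_bigr do rewrite exprMn.
  by rewrite -mulr_sumr exprVn sA mulVf.
move=> /(_ (lexx _) (supp_le_scale _ an)); rewrite invr_eq0 gt_eqF// => /(_ isT).
move=> H; have {}H := H (fun j jN => etrans (congr1 _ (aN j jN)) (mulr0 _)).
have E : noise_fluct a N = (fun w => Num.sqrt A * noise_fluct (fun j => (Num.sqrt A)^-1 * a j) N w).
  apply/funext => w; rewrite /noise_fluct mulr_sumr; apply: eq_bigr => j _.
  by rewrite !mulrA divff ?mul1r// gt_eqF.
rewrite E sq_intZ//; last exact: measurable_noise_fluct.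
by rewrite sA [leRHS]EFinM muleC lee_wpmul2r// lee_fin.
Qed.

Variables (S : R -> R) (theta : (R -> R) -> nat -> R).
Hypothesis S_per : forall t, S (t + 1) = S t.
Hypothesis S_L2 : L2_on 0 1 S.

Lemma phi_periodic j t : phi j (t + 1) = phi j t :> R.
Proof.
rewrite !phiE; set w := 2 * pi * _.
have -> : w * (t + 1) = w * t + 2 * pi * (phi_freq j)%:~R by rewrite mulrDr mulr1.
by rewrite cosD sinD cos_2pi_int sin_2pi_int !mulr1 !mulr0 subr0 addr0.
Qed.

Lemma periodic_L2_on : L2_on 0 n%:R S.
Proof.
have [mS fS] := S_L2.
have mS' : measurable_fun (`[0, 1[%classic : set R) S.
  by apply: measurable_funS mS => //; exact: subset_itv_co_cc.
have mSn := periodic_measurable (n := n) S_per mS'.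
split.
  have -> : `[0, n%:R]%classic = `[0, n%:R[%classic `|` [set n%:R] :> set R.
    by rewrite setUitv1// bnd_simp.
  apply/measurable_funU => //; split => //; exact: measurable_fun_set1.
rewrite -integral_itv_bndo_bndc; last exact: measurable_sq.
rewrite periodic_ge0_integral.
- rewrite integral_itv_bndo_bndc; last exact: measurable_sq.
  by rewrite lte_mul_pinfty// ?lee_fin.
- by move=> t; rewrite S_per.
- exact: measurable_sq.
- by move=> t; rewrite lee_fin sqr_ge0.
Qed.

Lemma periodic_fourier j :
  \int[mu]_(t in `[0, n%:R]) (phi j t * S t) =
  n%:R * \int[mu]_(t in `[0, 1]) (S t * phi j t).
Proof.
have [mS fS] := S_L2.
have phi_oo : (sq_int mu `[0%R, 1%R] (phi j : R -> R) < +oo)%E.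
  by apply: continuous_sq_int_lt; exact: continuous_phi.
have i1 : mu.-integrable `[0, 1] (EFin \o (fun t => phi j t * S t)).
  by apply: sq_int_mul_integrable => //; apply: measurable_funTS; exact: measurable_phi.
have i1' : mu.-integrable `[0, 1[ (EFin \o (fun t => phi j t * S t)).
  by apply: integrableS i1 => //; exact: subset_itv_co_cc.
have [in_ E] := @periodic_integrable _ (fun t => phi j t * S t) n
  (fun t => congr2 _ (phi_periodic j t) (S_per t)) i1'.
rewrite -Rintegral_itv_bndo_bndc// E Rintegral_itv_bndo_bndc//.
by congr (_ * _); apply: eq_Rintegral => t _; rewrite mulrC.
Qed.

(** The statistic is an integral against the observation; once the drift is
    removed it is a version of the integral against the noise, hence equal to
    it almost surely, and by periodicity the drift contributes [n] times the
    Fourier coefficient. *)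
Lemma theta_noise j :
  is_stoch_int Q n%:R (obs S) (phi j) (fun w => n%:R * theta (obs S w) j) ->
  {ae Q, forall w, theta (obs S w) j =
     \int[mu]_(t in `[0, 1]) (S t * phi j t) + xi Q j w / Num.sqrt n%:R}.
Proof.
move=> H; have [mS fS] := periodic_L2_on.
have phi_oo : (sq_int mu `[0%R, n%:R] (phi j : R -> R) < +oo)%E.
  by have [] := L2_on_continuous (@continuous_phi R j).
have := is_stoch_int_drift measurable_coord (phi_step_approximable j) phi_oo mS fS H.
move=> H'; have := is_stoch_int_unique measurable_coord (phi_step_approximable j) H'
  (stoch_intP (@continuous_phi R j)).
apply: filterS => w; rewrite periodic_fourier /xi => /eqP; rewrite subr_eq => /eqP E.
have s0 : Num.sqrt n%:R != 0 :> R by rewrite gt_eqF// sqrtr_gt0.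
have -> : theta (obs S w) j = n%:R^-1 * (n%:R * theta (obs S w) j).
  by rewrite mulKf// gt_eqF.
rewrite E mulrDr mulKf ?gt_eqF// addrC; congr (_ + _).
by rewrite mulrAC -invfM -expr2 sqr_sqrtr// ler0n.
Qed.

End Noise.

(** * The loss of a trigonometric estimator *)

Section Loss.
Context {R : realType}.
Local Notation mu := (@lebesgue_measure R).
Variables (S : R -> R) (N : nat).
Hypothesis S_L2 : L2_on 0 1 S.
Implicit Types (a : nat -> R).

Definition fourier (j : nat) : R := \int[mu]_(t in `[0, 1]) (S t * phi j t).

(** What no estimator of order less than [N] can recover. *)
Definition fourier_rest : R :=
  \int[mu]_(t in `[0, 1]) (S t ^+ 2) - \sum_(1 <= j < N) fourier j ^+ 2.

Let trig_poly_sq_int1 a :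
  sq_int mu `[0%R, 1%R] (trig_poly a N) = (\sum_(1 <= j < N) a j ^+ 2)%:E.
Proof. by have := @trig_poly_sq_int R 1 isT a N; rewrite mul1r. Qed.

Let loss_expansion a : \int[mu]_(t in `[0, 1]) ((trig_poly a N t - S t) ^+ 2) =
  \sum_(1 <= j < N) (a j - fourier j) ^+ 2 + fourier_rest.
Proof.
have [mS fS] := S_L2.
have phi_oo j : (sq_int mu `[0%R, 1%R] (phi j : R -> R) < +oo)%E.
  by apply: continuous_sq_int_lt; exact: continuous_phi.
have iSphi j : mu.-integrable `[0, 1] (EFin \o (fun t => S t * phi j t)).
  by apply: sq_int_mul_integrable => //; apply: measurable_funTS; exact: measurable_phi.
have iaS j : mu.-integrable `[0, 1] (EFin \o (fun t => (-2 * a j) * (S t * phi j t))).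
  exact: integrableZl_EFin.
have i1 : mu.-integrable `[0, 1] (EFin \o (fun t => trig_poly a N t ^+ 2)).
  by apply: continuous_integrable => t; apply: cvgM; exact: continuous_trig_poly.
have i2 : mu.-integrable `[0, 1] (EFin \o (fun t => S t ^+ 2)) by exact: sq_int_lt_fin.
have i3 : mu.-integrable `[0, 1]
    (EFin \o (fun t => \sum_(1 <= j < N) (-2 * a j) * (S t * phi j t))).
  exact: integrable_sum_EFin.
have E t : (trig_poly a N t - S t) ^+ 2 =
    trig_poly a N t ^+ 2 + (\sum_(1 <= j < N) (-2 * a j) * (S t * phi j t) + S t ^+ 2).
  have -> : \sum_(1 <= j < N) (-2 * a j) * (S t * phi j t) = -2 * S t * trig_poly a N t.
    by rewrite /trig_poly mulr_sumr; apply: eq_bigr => j _; ring.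
  by ring.
under eq_Rintegral do rewrite E.
rewrite RintegralD//; last exact: integrableD_EFin.
rewrite RintegralD// Rintegral_sum//.
have -> : \int[mu]_(t in `[0, 1]) (trig_poly a N t ^+ 2) = \sum_(1 <= j < N) a j ^+ 2.
  by rewrite /Rintegral -[X in fine X]/(sq_int mu `[0%R, 1%R] (trig_poly a N)) trig_poly_sq_int1.
have -> : \sum_(1 <= j < N) (a j - fourier j) ^+ 2 = \sum_(1 <= j < N) a j ^+ 2 +
    \sum_(1 <= j < N) \int[mu]_(t in `[0, 1]) (-2 * a j * (S t * phi j t)) +
    \sum_(1 <= j < N) fourier j ^+ 2.
  rewrite -!big_split; apply: eq_bigr => j _ /=.
  by rewrite RintegralZl// -/(fourier j); ring.
by rewrite /fourier_rest; ring.
Qed.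

(** Parseval's identity for a finite expansion, from the orthonormality of the
    basis. *)
Lemma loss_trig_poly a :
  (\int[mu]_(t in `[0%R, 1%R]) ((trig_poly a N t - S t) ^+ 2)%:E)%E =
  (\sum_(1 <= j < N) (a j - fourier j) ^+ 2 + fourier_rest)%:E.
Proof.
rewrite -loss_expansion /Rintegral fineK//.
have [mS fS] := S_L2.
have mT : measurable_fun (`[0, 1]%classic : set R) (trig_poly a N) by exact: measurable_trig_poly.
have : (sq_int mu `[0%R, 1%R] (fun t => trig_poly a N t + -1 * S t)%R < +oo)%E.
  apply: (le_lt_trans (sq_intD _ _ _ _)) => //; first exact: measurable_scale.
  rewrite sq_intZ// trig_poly_sq_int1 sqrrN expr1n mul1e.
  by rewrite lte_add_pinfty// ?lte_mul_pinfty// -?EFinM ?ltry.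
rewrite /sq_int; under eq_integral do rewrite mulN1r.
by move=> h; rewrite ge0_fin_numE// integral_ge0// => t _; rewrite lee_fin sqr_ge0.
Qed.

(** It is the loss of the projection of [S]. *)
Lemma fourier_rest_ge0 : 0 <= fourier_rest.
Proof.
have := loss_trig_poly fourier; rewrite big1 ?add0r => [E|j _].
  by rewrite -lee_fin -E integral_ge0// => t _; rewrite lee_fin sqr_ge0.
by rewrite subrr expr0n.
Qed.

Lemma S_hat_trig_poly (g th : nat -> R) t : (forall j, (N <= j)%N -> g j = 0) ->
  S_hat g th t = trig_poly (fun j => g j * th j) N t.
Proof.
by move=> gN; rewrite /S_hat (@fsum_pos_nat _ _ N)// => j /gN ->; rewrite !mul0r.
Qed.

End Loss.

(** * The oracle inequality for one observation *)

Section Oracle.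
Context {R : realType}.
Variables (n N : nat) (theta xi v : nat -> R) (vs sg rho : R).
Hypotheses (hn : (0 < n)%N) (vs_gt0 : 0 < vs) (rho_gt0 : 0 < rho) (rho_lt : rho < 1 / 3).
Implicit Types (a g h x : nat -> R).

Local Notation "\S_ j F" := (\sum_(1 <= j < N) F)
  (at level 36, j at level 0, F at level 36).

Definition perturbed j : R := theta j + xi j / Num.sqrt n%:R.
Definition error a : R := \S_j (a j * perturbed j - theta j) ^+ 2.
Definition empirical_cost a : R :=
  \S_j (a j ^+ 2 * perturbed j ^+ 2) - 2 * \S_j (a j * (perturbed j ^+ 2 - sg / n%:R))
  + rho * (sg * \S_j (a j ^+ 2) / n%:R).

Definition signal_sq x : R := \S_j (x j ^+ 2 * theta j ^+ 2).
Definition signal_noise x : R := \S_j (x j * theta j * xi j).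
Definition bias_sum a : R := \S_j (a j * (v j - vs)).
Definition fluct_sum a : R := \S_j (a j * (xi j ^+ 2 - v j)).

(** The two normalized quadratic statistics whose sums over the weight set
    control the fluctuations; a quotient by zero is zero, which is right as
    the numerator then vanishes as well. *)
Definition fluct_stat a : R := fluct_sum a ^+ 2 / \S_j (a j ^+ 2).
Definition cross_stat x : R :=
  signal_noise x ^+ 2 / signal_sq x +
  signal_noise (fun j => x j ^+ 2) ^+ 2 / signal_sq x.

Let n_gt0 : 0 < n%:R :> R. Proof. by rewrite ltr0n. Qed.
Let s_gt0 : 0 < Num.sqrt n%:R :> R. Proof. by rewrite sqrtr_gt0. Qed.
Let s_sq : Num.sqrt n%:R * Num.sqrt n%:R = n%:R :> R.
Proof. by rewrite -expr2 sqr_sqrtr// ler0n. Qed.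

(** The hypothesis on [w] makes the degenerate case agree with the convention
    that a quotient by zero is zero. *)
Lemma amgm_quotient (w s k : R) : 0 <= s -> 0 < k -> (s = 0 -> w = 0) ->
  2 * w <= k * s + w ^+ 2 / s / k.
Proof.
move=> s0 k0 sw; have [sz|sp] := eqVneq s 0.
  by rewrite sz sw// expr0n /= !mulr0 !mul0r addr0.
have sgt : 0 < s by rewrite lt_neqAle eq_sym sp.
have sk : 0 < k * s by rewrite mulr_gt0.
rewrite -subr_ge0.
have -> : k * s + w ^+ 2 / s / k - 2 * w = (k * s - w) ^+ 2 / (k * s).
  by field; rewrite !gt_eqF.
by rewrite divr_ge0 ?sqr_ge0// ltW.
Qed.

(** The empirical cost estimates the error, up to a constant, a penalty and
    centred remainders. *)
Lemma errorE a : error a = empirical_cost a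
  + 2 * (signal_noise a / Num.sqrt n%:R + bias_sum a / n%:R + fluct_sum a / n%:R
         + (vs - sg) * \S_j a j / n%:R)
  - rho * (sg * \S_j (a j ^+ 2) / n%:R) + \S_j (theta j ^+ 2).
Proof.
have -> : error a = \S_j (a j ^+ 2 * perturbed j ^+ 2)
    - 2 * \S_j (a j * (perturbed j ^+ 2 - sg / n%:R))
    + 2 * (signal_noise a / Num.sqrt n%:R + bias_sum a / n%:R + fluct_sum a / n%:R
         + (vs - sg) * \S_j a j / n%:R) + \S_j (theta j ^+ 2).
  rewrite /error /signal_noise /bias_sum /fluct_sum.
  rewrite !(mulr_suml, mulr_sumr) -!big_split /= !mulr_sumr -sumrB -!big_split /=.
  apply: eq_bigr => j _; rewrite /perturbed; have := s_gt0; have := s_sq.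
  move: (Num.sqrt _) => s <- s0.
  by field; rewrite gt_eqF.
by rewrite /empirical_cost; ring.
Qed.

(** The numerators of [cross_stat] vanish with its denominator. *)
Lemma signal_sq_eq0 x : signal_sq x = 0 -> forall y : nat -> R,
  \S_j (x j * y j * theta j * xi j) = 0.
Proof.
rewrite /signal_sq; under eq_bigr do rewrite -exprMn.
move=> /sum_nat_eq0 x0 y; rewrite big_nat_cond big1// => j /andP[jN _].
have -> : x j * y j * theta j * xi j = (x j * theta j) * (y j * xi j) by ring.
by rewrite (x0 j jN) mul0r.
Qed.

(** The errors of two weights bound the distance between them, as
    [(h - g) y = (h y - theta) - (g y - theta)] for the observed coefficients
    [y]; replacing [y] by [theta] on the left costs a cross term. *)
Lemma signal_sq_le h g :
  (1 - rho) * signal_sq (fun j => h j - g j) <= 2 * error h + 2 * error g +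
   signal_noise (fun j => (h j - g j) ^+ 2) ^+ 2 / signal_sq (fun j => h j - g j) / (n%:R * rho).
Proof.
set x := fun j => _; set s2 := signal_sq x; set W := signal_noise _.
have hat : s2 + 2 * (W / Num.sqrt n%:R) <= 2 * error h + 2 * error g.
  rewrite /s2 /W /signal_sq /signal_noise /error.
  rewrite !(mulr_suml, mulr_sumr) -!big_split /=; apply: ler_sum => j _.
  rewrite -subr_ge0 /x.
  have -> : 2 * (h j * perturbed j - theta j) ^+ 2 + 2 * (g j * perturbed j - theta j) ^+ 2
      - ((h j - g j) ^+ 2 * theta j ^+ 2 +
         2 * ((h j - g j) ^+ 2 * theta j * xi j / Num.sqrt n%:R)) =
      ((h j + g j) * perturbed j - 2 * theta j) ^+ 2 +
      ((h j - g j) * (xi j / Num.sqrt n%:R)) ^+ 2.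
    by rewrite /perturbed; ring.
  by rewrite addr_ge0 ?sqr_ge0.
have s20 : 0 <= s2 by apply: sumr_ge0 => j _; rewrite mulr_ge0 ?sqr_ge0.
have := @amgm_quotient (- (W / Num.sqrt n%:R)) s2 rho s20 rho_gt0.
have -> : (- (W / Num.sqrt n%:R)) ^+ 2 / s2 / rho = W ^+ 2 / s2 / (n%:R * rho).
  by rewrite sqrrN expr_div_n sqr_sqrtr ?ler0n// invfM; ring.
move=> H; have {}H := H _; have : s2 = 0 -> - (W / Num.sqrt n%:R) = 0.
  move=> /signal_sq_eq0 /(_ x) W0; rewrite /W /signal_noise.
  by under eq_bigr do rewrite expr2; rewrite W0 mul0r oppr0.
by move=> /H; lra.
Qed.

(** Up to the normalized statistic, the fluctuation is absorbed by the penalty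
    of [a] computed with the true variance. *)
Lemma fluct_sum_le a : 0 < \S_j (a j ^+ 2) ->
  2 * `|fluct_sum a / n%:R| <= rho * (vs * \S_j (a j ^+ 2) / n%:R) +
    fluct_stat a / (n%:R * rho * vs).
Proof.
move=> A0; have k0 : 0 <= vs * \S_j (a j ^+ 2) / n%:R.
  by rewrite divr_ge0 ?ler0n// mulr_ge0// ltW.
rewrite (le_trans (amgm_quotient k0 rho_gt0 _))//.
  by move=> /eqP; rewrite gt_eqF// divr_gt0// mulr_gt0.
rewrite lerD2l real_normK ?num_real// /fluct_stat le_eqVlt; apply/orP; left; apply/eqP.
by field; rewrite !gt_eqF.
Qed.

(** Since [h] has the smaller empirical cost, the difference of the errors is at
    most the difference of the remainders in [errorE]. The penalty absorbs the
    fluctuations; up to [cross_stat], the cross term is at most [rho] times the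
    signal distance of [h] and [g], hence at most a multiple of the two errors.
    After multiplication by [1 - rho], moving this part to the left leaves the
    factors [1 - 3 * rho] and [1 + rho]. *)
Lemma pointwise_oracle h g (L m : R) :
  empirical_cost h <= empirical_cost g ->
  `|bias_sum h| <= L -> `|bias_sum g| <= L ->
  0 < \S_j (h j ^+ 2) <= m -> 0 < \S_j (g j ^+ 2) <= m ->
  0 <= \S_j h j <= m -> 0 <= \S_j g j <= m ->
  (1 - 3 * rho) * error h <= (1 + rho) * error g +
  (1 - rho) * (4 * L / n%:R + (fluct_stat h + fluct_stat g) / (n%:R * rho * vs)
    + 2 * (1 + rho) * m * `|sg - vs| / n%:R
    + 2 * rho * (vs * \S_j (g j ^+ 2) / n%:R))
  + cross_stat (fun j => h j - g j) / (n%:R * rho).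
Proof.
move=> hg Lh Lg /andP[Ah Ahm] /andP[Ag Agm] /andP[h0 hm] /andP[g0 gm].
set x := fun j => h j - g j.
pose s2 := signal_sq x.
pose Z := signal_noise x ^+ 2 / s2.
pose Z1 := signal_noise (fun j => x j ^+ 2) ^+ 2 / s2.
have s20 : 0 <= s2 by apply: sumr_ge0 => j _; rewrite mulr_ge0 ?sqr_ge0.
have cross : 2 * (signal_noise x / Num.sqrt n%:R) <= rho * s2 + Z / (n%:R * rho).
  rewrite (le_trans (amgm_quotient s20 rho_gt0 _))//.
    move=> /signal_sq_eq0 /(_ (fun=> 1)) W0; rewrite /signal_noise.
    by under eq_bigr do rewrite -[x _]mulr1; rewrite W0 mul0r.
  by rewrite lerD2l /Z expr_div_n sqr_sqrtr ?ler0n// invfM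
    le_eqVlt; apply/orP; left; apply/eqP; ring.
have s2_le : (1 - rho) * s2 <= 2 * error h + 2 * error g + Z1 / (n%:R * rho).
  exact: signal_sq_le.
have Wx : signal_noise x = signal_noise h - signal_noise g.
  by rewrite /signal_noise -sumrB; apply: eq_bigr => j _; rewrite /x; ring.
have Fh := fluct_sum_le Ah; have Fg := fluct_sum_le Ag.
have := ler_norm (fluct_sum h / n%:R); have := ler_norm (- (fluct_sum g / n%:R)).
rewrite normrN => fg fh.
have bh : bias_sum h / n%:R <= L / n%:R.
  by rewrite ler_wpM2r ?invr_ge0 ?ler0n// (le_trans (ler_norm _)).
have bg : - (bias_sum g / n%:R) <= L / n%:R.
  by rewrite -mulNr ler_wpM2r ?invr_ge0 ?ler0n// (le_trans (ler_norm _))// normrN.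
(* The variance estimator enters through vs - sg, multiplied by a difference
   of two numbers of [0, m] and by the two penalties. *)
pose e := `|sg - vs| / n%:R.
have e0 : 0 <= e by rewrite divr_ge0.
have ve1 : (vs - sg) / n%:R <= e.
  by rewrite ler_wpM2r ?invr_ge0 ?ler0n// distrC ler_norm.
have ve2 : - ((vs - sg) / n%:R) <= e.
  by rewrite -mulNr ler_wpM2r ?invr_ge0 ?ler0n// opprB ler_norm.
have vle k : 0 <= k <= m -> k * ((vs - sg) / n%:R) <= m * e /\ - (k * ((vs - sg) / n%:R)) <= m * e.
  move=> /andP[k0 km]; split; last rewrite -mulrN.
    by rewrite (@le_trans _ _ (k * e))// ?ler_wpM2l// ler_wpM2r.
  by rewrite (@le_trans _ _ (k * e))// ?ler_wpM2l// ler_wpM2r.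
have lin : (\S_j h j - \S_j g j) * ((vs - sg) / n%:R) <= m * e.
  have [hgS|ghS] := leP (\S_j g j) (\S_j h j).
    have k0 : 0 <= \S_j h j - \S_j g j <= m by move: hm g0 hgS; lra.
    by have [] := vle _ k0.
  have k0 : 0 <= \S_j g j - \S_j h j <= m by move: gm h0 ghS; lra.
  by have [_] := vle _ k0; rewrite -mulNr opprB.
have [ph _] := vle (\S_j (h j ^+ 2)) (introT andP (conj (ltW Ah) Ahm)).
have [_ pg] := vle (\S_j (g j ^+ 2)) (introT andP (conj (ltW Ag) Agm)).
have main : error h <= error g + rho * s2 + Z / (n%:R * rho) +
   (4 * L / n%:R + (fluct_stat h + fluct_stat g) / (n%:R * rho * vs)
    + 2 * (1 + rho) * m * `|sg - vs| / n%:R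
    + 2 * rho * (vs * \S_j (g j ^+ 2) / n%:R)).
  rewrite (errorE h) (errorE g).
  have ph' := ler_wpM2l (ltW rho_gt0) ph.
  have pg' := ler_wpM2l (ltW rho_gt0) pg.
  have := cross; rewrite Wx.
  have -> : 2 * (1 + rho) * m * `|sg - vs| / n%:R = 2 * (m * e) + 2 * (rho * (m * e)).
    by rewrite /e; ring.
  have -> : 4 * L / n%:R = 4 * (L / n%:R) by rewrite mulrA.
  rewrite [(fluct_stat h + _) / _]mulrDl.
  move: ph' pg' fg fh Fh Fg bh bg lin hg.
  move: (fluct_stat h / _) (fluct_stat g / _) (Z / _) (rho * s2) (rho * (m * e)) (m * e) (L / n%:R) => fsh fsg zz rs rme me Ln.
  have -> (k : R) : rho * (sg * k / n%:R) = rho * (vs * k / n%:R) - rho * (k * ((vs - sg) / n%:R)) by ring.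
  have -> : (vs - sg) * \S_j h j / n%:R = (\S_j h j) * ((vs - sg) / n%:R) by ring.
  have -> : (vs - sg) * \S_j g j / n%:R = (\S_j g j) * ((vs - sg) / n%:R) by ring.
  have -> (k : R) : 2 * rho * (vs * k / n%:R) = 2 * (rho * (vs * k / n%:R)) by ring.
  rewrite !mulrBl !mulrN.
  lra.
have r1 : 0 <= 1 - rho by move: rho_lt; lra.
have := ler_wpM2l r1 main; have := ler_wpM2l (ltW rho_gt0) s2_le.
have nr : 0 < n%:R * rho by rewrite mulr_gt0.
have Z0 : 0 <= rho * (Z / (n%:R * rho)).
  by rewrite mulr_ge0 ?(ltW rho_gt0)// divr_ge0 ?(ltW nr)// divr_ge0 ?sqr_ge0.
have Z10 : 0 <= (1 - rho) * (Z1 / (n%:R * rho)).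
  by rewrite mulr_ge0 ?(ltW rho_gt0)// divr_ge0 ?(ltW nr)// divr_ge0 ?sqr_ge0.
rewrite /cross_stat -/s2 -/Z -/Z1 [(Z + Z1) / _]mulrDl.
move: Z0 Z10; move: (Z / _) (Z1 / _) (_ + _ * rho * (_ / _)) => z z1 X.
by move: (error h) (error g) => eh eg; nra.
Qed.

End Oracle.

(** * The estimator of the noise variance *)

Section VarianceEstimator.
Context {R : realType} {n : nat} (hn : (0 < n)%N).
Local Notation mu := (@lebesgue_measure R).
Local Notation Omega := (skorokhod (n%:R : R)).
Local Notation r := (Num.sqrt n%:R : R).
Local Notation m := (Num.truncn r).

Let n0 : 0 < n%:R :> R. Proof. by rewrite ltr0n. Qed.
Let r1 : 1 <= r. Proof. by rewrite -[leLHS]sqrtr1 ler_sqrt ?ler0n// ler1n. Qed.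
Let r0 : 0 < r. Proof. exact: lt_le_trans ltr01 r1. Qed.
Let rr : r * r = n%:R. Proof. by rewrite -expr2 sqr_sqrtr// ler0n. Qed.
Let mr : m%:R <= r.
Proof. by have /andP[] := truncn_itv (ltW r0). Qed.
Let m_le : (m <= n)%N.
Proof.
by rewrite -(ler_nat R) (le_trans mr)// -[leRHS]rr ler_peMr// ltW.
Qed.

(** Turns the sums over the frequencies of the estimator into weighted sums, to
    which the bounds on the noise apply. *)
Definition tail_weight (j : nat) : R := ((m < j) && (j <= n))%N%:R.

Lemma sum_tail_weight (F : nat -> R) :
  \sum_(1 <= j < n.+1) tail_weight j * F j = \sum_(m.+1 <= j < n.+1) F j.
Proof.
rewrite (big_cat_nat (n := m.+1)) ?ltnS//= big_nat_cond big1 ?add0r; last first.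
  by move=> j /andP[/andP[_ jm] _]; rewrite /tail_weight ltnNge -ltnS jm mul0r.
apply: eq_big_nat => j /andP[mj jn].
by rewrite /tail_weight mj -ltnS jn mul1r.
Qed.

Lemma tail_weight_supp : supp_le n tail_weight.
Proof.
by apply: supp_le_interval => j nj; rewrite /tail_weight (leqNgt j) nj andbF.
Qed.

Lemma tail_weight_sum : \sum_(1 <= j < n.+1) tail_weight j ^+ 2 <= n%:R.
Proof.
apply: (@le_trans _ _ (\sum_(1 <= j < n.+1) 1)); last first.
  by rewrite sumr_const_nat subn1.
by apply: ler_sum => j _; rewrite /tail_weight; case: (_ && _); rewrite ?expr1n ?expr0n.
Qed.

(** The estimator omits the [m] first frequencies out of [n], which costs
    [vs * m / n], at most [vs / r]. *)
Lemma variance_error_le (theta xi v : nat -> R) (vs : R) : 0 <= vs ->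
  `|\sum_(m.+1 <= j < n.+1) (theta j + xi j / r) ^+ 2 - vs| <=
    \sum_(m.+1 <= j < n.+1) theta j ^+ 2
    + 2 * `|\sum_(m.+1 <= j < n.+1) theta j * xi j| / r
    + `|\sum_(m.+1 <= j < n.+1) (xi j ^+ 2 - v j)| / n%:R
    + `|\sum_(m.+1 <= j < n.+1) (v j - vs)| / n%:R + vs / r.
Proof.
move=> vs0; set T := \sum_(_ <= j < _) theta j ^+ 2.
set W := \sum_(_ <= j < _) theta j * xi j.
set F := \sum_(_ <= j < _) (xi j ^+ 2 - v j).
set B := \sum_(_ <= j < _) (v j - vs).
have -> : \sum_(m.+1 <= j < n.+1) (theta j + xi j / r) ^+ 2 - vs =
    T + 2 * W / r + F / n%:R + B / n%:R - vs * (m%:R / n%:R).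
  have vsE : \sum_(m.+1 <= j < n.+1) (vs / n%:R) = vs - vs * (m%:R / n%:R).
    by rewrite sumr_const_nat subSS -[_ *+ _]mulr_natr natrB//; field; rewrite gt_eqF.
  have -> : \sum_(m.+1 <= j < n.+1) (theta j + xi j / r) ^+ 2 =
      T + 2 * W / r + F / n%:R + B / n%:R + \sum_(m.+1 <= j < n.+1) (vs / n%:R).
    rewrite /T /W /F /B !(mulr_suml, mulr_sumr) -!big_split /=.
    apply: eq_bigr => j _; have := rr; have := r0.
    by move: (Num.sqrt _) => s s0 <-; field; rewrite gt_eqF.
  by rewrite vsE; ring.
have T0 : 0 <= T by apply: sumr_ge0 => j _; exact: sqr_ge0.
have mrn : m%:R / n%:R <= r^-1.
  by rewrite ler_pdivrMr// -[X in _ <= _ * X]rr mulrA mulVf ?mul1r// gt_eqF.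
rewrite (le_trans (ler_normB _ _))// lerD//.
  rewrite (le_trans (ler_normD _ _))// lerD//; last by rewrite normrM normfV (@ger0_norm _ n%:R).
  rewrite (le_trans (ler_normD _ _))// lerD//; last by rewrite normrM normfV (@ger0_norm _ n%:R).
  rewrite (le_trans (ler_normD _ _))// lerD//; first by rewrite ger0_norm.
  by rewrite !normrM normfV (ger0_norm (ltW r0)) (@ger0_norm _ 2).
by rewrite ger0_norm ?ler_wpM2l// mulr_ge0// divr_ge0 ?ler0n.
Qed.


Variables (Q : probability Omega R) (sigmaQ vs l V sg_sup : R).
Hypotheses (HQ : noise_condition Q sigmaQ)
  (HL : (L1 vs Q + L2 Q <= (l)%:E)%E) (l_gt0 : 0 < l) (vs_gt0 : 0 < vs)
  (vsV : vs <= V) (sigma_le : sigmaQ <= sg_sup).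
(** The L1 distance from the estimator to the noise variance, for coefficients
    [theta] whose tail is of order [D ^+ 2 / r]. The means of the two random
    terms are bounded through their mean squares by the arithmetic-geometric
    inequality, with [c1] and [c2] bounds of the root mean squares. *)
Lemma variance_estimator_L1 (theta : nat -> R) (D : R) : 0 <= D ->
  \sum_(m.+1 <= j < n.+1) theta j ^+ 2 <= 8 * D ^+ 2 / r ->
  exists H : Omega -> R,
  [/\ measurable_fun setT H, (forall w, 0 <= H w),
      (forall w th, (forall j, (0 < j)%N ->
          th j = theta j + xi Q j w / r) -> `|sigma_hat n th - vs| <= H w) &
      (\int[Q]_w (H w)%:E <= (3 * kappa_star n l V sg_sup D / r)%:E)%E].
Proof.
move=> D0 tailE.
have sigma0 : 0 < sigmaQ by case: HQ.
have sup0 : 0 < sg_sup := lt_le_trans sigma0 sigma_le.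
have V0 : 0 < V := lt_le_trans vs_gt0 vsV.
pose q := n%:R `^ 4^-1 : R.
have q0 : 0 < q by rewrite powR_gt0.
have qq : q ^+ 2 = r.
  by rewrite -powR12_sqrt// -powR_mulrn ?powR_ge0// -powRrM; congr powR; field.
pose c1 := 3 * D * Num.sqrt sg_sup / q.
have c10 : 0 <= c1 by rewrite !mulr_ge0 ?sqrtr_ge0// invr_ge0 ltW.
pose c2 := Num.sqrt l * r.
have c20 : 0 < c2 by rewrite mulr_gt0// sqrtr_gt0.
pose tw := tail_weight.
pose W w := \sum_(1 <= j < n.+1) (tw j * theta j) * xi Q j w.
pose F := noise_fluct Q tw n.+1.
have mW : measurable_fun setT W by exact: (measurable_noise_sum HQ).
have mF : measurable_fun setT F by exact: (measurable_noise_fluct HQ).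
have W_sq : (sq_int Q setT W <= (c1 ^+ 2)%:E)%E.
  rewrite (le_trans (noise_sum_sq_int_le hn HQ _ _))// lee_fin.
  have -> : \sum_(1 <= j < n.+1) (tw j * theta j) ^+ 2 = \sum_(m.+1 <= j < n.+1) theta j ^+ 2.
    rewrite -sum_tail_weight; apply: eq_bigr => j _.
    by rewrite exprMn /tw /tail_weight; case: (_ && _); rewrite ?expr1n ?expr0n.
  rewrite (le_trans (ler_wpM2l (ltW sigma0) tailE))//.
  have -> : c1 ^+ 2 = sg_sup * (9 * D ^+ 2 / r).
    rewrite /c1 expr_div_n !exprMn sqr_sqrtr ?(ltW sup0)// qq.
    by ring.
  have D2 : 0 <= D ^+ 2 / r by rewrite divr_ge0 ?sqr_ge0// ltW.
  rewrite ler_pM ?(ltW sigma0)//; first by rewrite -mulrA mulr_ge0.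
  by rewrite -!mulrA ler_wpM2r//; lra.
have F_sq : (sq_int Q setT F <= (c2 ^+ 2)%:E)%E.
  rewrite (le_trans (noise_fluct_sq_int_le HQ HL tail_weight_supp _))//.
    by move=> j nj; rewrite /tail_weight (leqNgt j) nj andbF.
  rewrite lee_fin /c2 exprMn !sqr_sqrtr ?ler0n ?(ltW l_gt0)//.
  by rewrite ler_wpM2l ?(ltW l_gt0)//; exact: tail_weight_sum.
(* If D is zero, so are the coefficients, and the cross term vanishes. *)
have D_zero : D = 0 -> forall w, W w = 0.
  move=> Dz w; rewrite /W big_nat_cond big1// => j /andP[/andP[_ jn] _].
  rewrite /tw /tail_weight; case: (ltnP m j) => [mj|_]; last by rewrite !mul0r.
  have : \sum_(m.+1 <= i < n.+1) theta i ^+ 2 == 0.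
    rewrite eq_le sumr_ge0 ?andbT// => [|i _]; last exact: sqr_ge0.
    by rewrite (le_trans tailE)// Dz expr0n /= mulr0 mul0r.
  rewrite psumr_eq0 => [/allP /(_ j)|i _]; last exact: sqr_ge0.
  rewrite mem_index_iota mj jn => /(_ isT).
  by rewrite sqrf_eq0 => /eqP ->; rewrite mulr0 mul0r.
pose K0 := 8 * D ^+ 2 / r + c1 / r + c2 / (2 * n%:R) + l / n%:R + vs / r.
have K00 : 0 <= K0.
  by rewrite !addr_ge0 ?divr_ge0 ?mulr_ge0 ?sqr_ge0 ?(ltW r0) ?(ltW c20) ?(ltW l_gt0)
    ?(ltW vs_gt0) ?(ltW q0) ?ler0n.
pose H w := K0 + (c1^-1 / r * W w ^+ 2 + (2 * n%:R * c2)^-1 * F w ^+ 2).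
have k1 : 0 <= c1^-1 / r by rewrite mulr_ge0// invr_ge0// ltW.
have k2 : 0 <= (2 * n%:R * c2)^-1 by rewrite invr_ge0 !mulr_ge0// ltW.
exists H; split.
- apply: measurable_funD => //; apply: measurable_funD; apply: measurable_scale.
    exact: measurable_funX.
  exact: measurable_funX.
- by move=> w; rewrite addr_ge0// addr_ge0// mulr_ge0// sqr_ge0.
- move=> w th thE.
  have -> : sigma_hat n th = \sum_(m.+1 <= j < n.+1) (theta j + xi Q j w / r) ^+ 2.
    by apply: eq_big_nat => j /andP[mj _]; rewrite thE// (leq_ltn_trans _ mj).
  rewrite (le_trans (variance_error_le _ _ (xi_var Q) (ltW vs_gt0)))//.
  have WE : \sum_(m.+1 <= j < n.+1) theta j * xi Q j w = W w.
    by rewrite -sum_tail_weight; apply: eq_bigr => j _; rewrite mulrA.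
  have FE : \sum_(m.+1 <= j < n.+1) (xi Q j w ^+ 2 - xi_var Q j) = F w.
    by rewrite -sum_tail_weight.
  have BE : `|\sum_(m.+1 <= j < n.+1) (xi_var Q j - vs)| <= l.
    rewrite -sum_tail_weight; apply: (L1_bound HL) => //.
    - by move=> j; rewrite /tail_weight; case: ((m < j) && (j <= n))%N => /=; lra.
    - exact: tail_weight_supp.
    - by move=> j nj; rewrite /tail_weight (leqNgt j) nj andbF.
  rewrite WE FE.
  have W1 : 2 * `|W w| <= c1 + c1^-1 * W w ^+ 2.
    have := @amgm_quotient _ `|W w| c1 1 c10 ltr01.
    rewrite mul1r divr1 real_normK ?num_real// [_ / c1]mulrC; apply.
    move=> /eqP; rewrite /c1 !mulf_eq0 invr_eq0 (gt_eqF q0) sqrtr_eq0 leNgt sup0 pnatr_eq0 !orbF /=.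
    by move=> /eqP /D_zero ->; rewrite normr0.
  have F1 : 2 * `|F w| <= c2 + c2^-1 * F w ^+ 2.
    have := @amgm_quotient _ `|F w| c2 1 (ltW c20) ltr01.
    rewrite mul1r divr1 real_normK ?num_real// [_ / c2]mulrC; apply.
    by move=> /eqP; rewrite gt_eqF.
  have -> : H w = 8 * D ^+ 2 / r + (c1 + c1^-1 * W w ^+ 2) / r +
      (c2 + c2^-1 * F w ^+ 2) / 2 / n%:R + l / n%:R + vs / r.
    rewrite /H /K0.
    have -> : (2 * n%:R * c2)^-1 = c2^-1 / 2 / n%:R by field; rewrite !gt_eqF.
    by move: (c1^-1) (c2^-1) => i1 i2; field; rewrite !gt_eqF.
  rewrite !lerD// ?ler_wpM2r ?invr_ge0 ?(ltW r0) ?ler0n//.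
  by rewrite ler_pdivlMr// mulrC.
- have iE : (\int[Q]_w (H w)%:E)%E = (K0%:E + ((c1^-1 / r)%:E * sq_int Q setT W +
     (2 * n%:R * c2)^-1%:E * sq_int Q setT F))%E.
    have HE w : (H w)%:E = (K0%:E + ((c1^-1 / r)%:E * (W w ^+ 2)%:E +
        (2 * n%:R * c2)^-1%:E * (F w ^+ 2)%:E))%E by rewrite -!EFinM -!EFinD.
    under eq_integral do rewrite HE.
    have msq (X : Omega -> R) (k : R) : measurable_fun setT X ->
      measurable_fun setT (fun w => k%:E * (X w ^+ 2)%:E)%E.
      by move=> mX; apply: measurable_funeM; exact: measurable_sq.
    have p0 (X : Omega -> R) (k : R) : 0 <= k -> forall w, (0 <= k%:E * (X w ^+ 2)%:E)%E.
      by move=> kk w; rewrite -EFinM lee_fin mulr_ge0// sqr_ge0.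
    rewrite ge0_integralD//; last 2 first.
    + by move=> w _; rewrite adde_ge0 ?p0.
    + by apply: emeasurable_funD; exact: msq.
    rewrite ge0_integralD//; last 4 first.
    + by move=> w _; exact: p0.
    + exact: msq.
    + by move=> w _; exact: p0.
    + exact: msq.
    rewrite integral_cst//= probability_setT mule1 !ge0_integralZl//.
    + exact: measurable_sq.
    + by move=> w _; rewrite lee_fin sqr_ge0.
    + exact: measurable_sq.
    + by move=> w _; rewrite lee_fin sqr_ge0.
  rewrite iE.
  apply: (@le_trans _ _ (K0 + (c1^-1 / r * c1 ^+ 2 + (2 * n%:R * c2)^-1 * c2 ^+ 2))%:E).
    rewrite (EFinD K0) (EFinD (_ * _)) (EFinM _ (c1 ^+ 2)) (EFinM _ (c2 ^+ 2)).
    by rewrite leeD2l// leeD// lee_wpmul2l// lee_fin.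
  rewrite lee_fin.
  have e1 : c1^-1 / r * c1 ^+ 2 = c1 / r.
    have [->|c1n] := eqVneq c1 0; first by rewrite expr0n !mulr0 mul0r.
    by field; rewrite c1n gt_eqF.
  have e2 : (2 * n%:R * c2)^-1 * c2 ^+ 2 = c2 / (2 * n%:R).
    by field; rewrite !gt_eqF.
  have e3 : c2 / (2 * n%:R) = Num.sqrt l / 2 / r.
    rewrite /c2 -[X in _ / (2 * X)]rr; field.
    by rewrite gt_eqF.
  have e4 : l / n%:R = (l / r) / r by rewrite -[X in _ / X]rr invfM mulrA.
  rewrite e1 e2 /K0 e3 e4 /kappa_star powR12_sqrt// -/q.
  rewrite -subr_ge0.
  have -> : 3 * (4 * D ^+ 2 + V + Num.sqrt l + 4 * D * Num.sqrt sg_sup / q + l / r) / r -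
     (8 * D ^+ 2 / r + c1 / r + Num.sqrt l / 2 / r + (l / r) / r + vs / r +
        (c1 / r + Num.sqrt l / 2 / r)) =
     (4 * D ^+ 2 + 3 * V - vs + 2 * Num.sqrt l + 6 * (D * Num.sqrt sg_sup / q) + 2 * (l / r)) / r.
    by rewrite /c1; field; rewrite !gt_eqF.
  rewrite divr_ge0 ?(ltW r0)//.
  have := sqrtr_ge0 l; have : 0 <= D * Num.sqrt sg_sup / q.
    by rewrite divr_ge0 ?(ltW q0)// mulr_ge0// sqrtr_ge0.
  have : 0 <= l / r by rewrite divr_ge0// ltW.
  have := sqr_ge0 D.
  by move: vsV V0; lra.
Qed.

End VarianceEstimator.

(** * The oracle inequality under one law *)

Section NonnegativeIntegrals.
Context {d : measure_display} {T : measurableType d} {R : realType}.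
Variable P : probability T R.
Implicit Types (f g : T -> R) (c k : R).

Lemma ge0_integral_axpy c f g : 0 <= c ->
  measurable_fun setT f -> (forall w, 0 <= f w) ->
  measurable_fun setT g -> (forall w, 0 <= g w) ->
  (\int[P]_w (c * f w + g w)%:E = c%:E * \int[P]_w (f w)%:E + \int[P]_w (g w)%:E)%E.
Proof.
move=> c0 mf f0 mg g0; under eq_integral do rewrite EFinD EFinM.
rewrite ge0_integralD//.
- rewrite ge0_integralZl//; first exact/measurable_EFinP.
  by move=> w _; rewrite lee_fin.
- by move=> w _; rewrite -EFinM lee_fin mulr_ge0.
- by apply: measurable_funeM; exact/measurable_EFinP.
- by move=> w _; rewrite lee_fin.
- exact/measurable_EFinP.
Qed.

Lemma integral_sq_quotient_le f (A k : R) : measurable_fun setT f -> 0 <= A -> 0 <= k ->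
  (sq_int P setT f <= (k * A)%:E)%E -> (\int[P]_w (f w ^+ 2 / A)%:E <= k%:E)%E.
Proof.
move=> mf A0 k0 fk; have [Az|Ap] := eqVneq A 0.
  by rewrite Az; under eq_integral do rewrite invr0 mulr0; rewrite integral0 lee_fin.
have Agt : 0 < A by rewrite lt_neqAle eq_sym Ap.
under eq_integral do rewrite mulrC EFinM.
rewrite ge0_integralZl//; last 3 first.
- exact: measurable_sq.
- by move=> w _; rewrite lee_fin sqr_ge0.
- by rewrite lee_fin invr_ge0.
have iA : (0 <= (A^-1)%:E)%E by rewrite lee_fin invr_ge0.
by rewrite (le_trans (lee_wpmul2l iA fk))// -EFinM lee_fin mulrC -mulrA divff// mulr1.
Qed.

Lemma integral_sum_le (I : eqType) (s : seq I) (f : I -> T -> R) k :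
  (forall i, measurable_fun setT (f i)) -> (forall i w, 0 <= f i w) ->
  (forall i, i \in s -> (\int[P]_w (f i w)%:E <= k%:E)%E) ->
  (\int[P]_w (\sum_(i <- s) f i w)%:E <= ((size s)%:R * k)%:E)%E.
Proof.
move=> mf f0; elim: s => [_|i s IH fk].
  by rewrite mul0r; under eq_integral do rewrite big_nil; rewrite integral0.
under eq_integral do rewrite big_cons -[X in X + _]mul1r.
rewrite ge0_integral_axpy//.
- rewrite mul1e /= -natr1 mulrDl mul1r addrC EFinD leeD//; last by rewrite fk ?mem_head.
  by apply: IH => j js; rewrite fk// in_cons js orbT.
- exact: measurable_sum.
- by move=> w; exact: sumr_ge0.
Qed.

Lemma ler_sum_mem (I : eqType) (s : seq I) (F : I -> R) i : i \in s ->
  (forall j, 0 <= F j) -> F i <= \sum_(j <- s) F j.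
Proof.
move=> + F0; elim: s => // j s IH; rewrite in_cons big_cons => /predU1P[->|/IH].
  by rewrite lerDl sumr_ge0.
by move=> /le_trans; apply; rewrite lerDr.
Qed.

End NonnegativeIntegrals.

Section Weights.
Context {R : realType} {n : nat} {G : {fset (nat -> R)}}.
Hypothesis hG : weight_set n G.

Lemma weight_set_bound : exists2 N : nat, (n < N)%N &
  forall g, g \in G -> forall j, (N <= j)%N -> g j = 0.
Proof.
pose b (g : nat -> R) := \max_(j <- fset_set (supp g)) j.
exists (maxn n (\max_(g <- G) b g)).+1; first by rewrite ltnS leq_maxl.
move=> g gG j; rewrite ltnNge; apply: contraNeq => gj0.
have [_ /(_ _ gG) [g0 _ [fg _] _]] := hG.
rewrite leq_max; apply/orP; right.
have [j0|j0] := posnP j; first by rewrite j0 g0 eqxx in gj0.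
apply: (@leq_trans (b g)); last by apply: leq_bigmax_seq.
by rewrite /b; apply: (@leq_bigmax_seq _ _ xpredT id) => //; rewrite in_fset_set// inE; split.
Qed.

Variables (N : nat) (g : nat -> R).
Hypotheses (gG : g \in G) (gN : forall j, (N <= j)%N -> g j = 0).

Lemma weight01 j : 0 <= g j <= 1.
Proof. by have [_ /(_ _ gG) [_ h _ _]] := hG. Qed.

Lemma weight_supp_le : supp_le n g.
Proof. by have [_ /(_ _ gG) [_ _ h _]] := hG. Qed.

(** Compares the sums of the weights with the number of nonzero ones. *)
Lemma nsuppE : (nsupp g)%:R = \sum_(1 <= j < N) (g j != 0)%:R :> R.
Proof.
have -> : nsupp g = size [seq j <- index_iota 1 N | g j != 0].
  have u : uniq [seq j <- index_iota 1 N | g j != 0] by rewrite filter_uniq// iota_uniq.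
  rewrite -(undup_id u) -card_fseq.
  rewrite /nsupp; congr #|` _|; apply/fsetP => j.
  have [fg _] := weight_supp_le.
  rewrite in_fset_set// !inE mem_filter mem_index_iota.
  apply/idP/idP => [|/andP[gj /andP[j0 _]]]; last by rewrite inE; split.
  rewrite inE => -[j0 gj]; rewrite gj j0 ltnNge.
  by apply: contra gj => /gN ->.
rewrite -sum1_size big_filter -natr_sum big_mkcond /=.
by congr (_%:R); apply: eq_bigr => j _; case: (g j == 0).
Qed.

Lemma weight_sum_le : 0 <= \sum_(1 <= j < N) g j <= (nsupp g)%:R.
Proof.
apply/andP; split; first by apply: sumr_ge0 => j _; case/andP: (weight01 j).
rewrite nsuppE; apply: ler_sum => j _; have [->//|_] := eqVneq (g j) 0.
by case/andP: (weight01 j).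
Qed.

Lemma weight_sq_sum_le : 0 < \sum_(1 <= j < N) g j ^+ 2 <= (nsupp g)%:R.
Proof.
apply/andP; split.
  rewrite lt_neqAle sumr_ge0 ?andbT => [|j _]; last exact: sqr_ge0.
  rewrite eq_sym; apply: contraTneq isT => /sum_nat_eq0 g0.
  have [_ /(_ _ gG) [_ _ _]] := hG.
  rewrite -(ltr0n R) nsuppE big_nat_cond big1 ?ltxx// => j /andP[jN _].
  by rewrite g0// eqxx.
rewrite nsuppE; apply: ler_sum => j _; have [->|_] := eqVneq (g j) 0.
  by rewrite expr0n.
by case/andP: (weight01 j) => g0 g1; rewrite expr_le1.
Qed.

End Weights.

Section OneLaw.
Context {R : realType} {n : nat} (hn : (0 < n)%N).
Local Notation mu := (@lebesgue_measure R).
Local Notation Omega := (skorokhod (n%:R : R)).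
Local Notation r := (Num.sqrt n%:R : R).
Variables (Q : probability Omega R) (sigmaQ vs l V sg_sup : R).
Hypotheses (HQ : noise_condition Q sigmaQ)
  (HL : (L1 vs Q + L2 Q <= l%:E)%E) (l_gt0 : 0 < l) (vs_gt0 : 0 < vs)
  (vsV : vs <= V) (sigma_le : sigmaQ <= sg_sup).
Variables (S dS : R -> R).
Hypotheses (S_C1 : C1_with_derivative S dS)
  (dS_int : mu.-integrable `[0, 1[ (EFin \o dS))
  (S_per : forall t, S (t + 1) = S t) (S_L2 : L2_on 0 1 S).
Local Notation D := (\int[mu]_(t in `[0, 1[) `|dS t|).
Variables (rho : R) (rho_gt0 : 0 < rho) (rho_lt : rho < 1 / 3).
Variables (G : {fset (nat -> R)}) (hG : weight_set n G).
Variables (theta : (R -> R) -> nat -> R) (ghat : (R -> R) -> nat -> R).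
Hypothesis htheta : forall j, (0 < j)%N ->
  is_stoch_int Q n%:R (obs S) (phi j) (fun w => n%:R * theta (obs S w) j).
Hypothesis hghat : model_selection n rho G S theta ghat.
Variables (N : nat) (nN : (n < N)%N)
  (GN : forall g, g \in G -> forall j, (N <= j)%N -> g j = 0).
Implicit Types (g a h : nat -> R) (w : Omega).

Let n0 : 0 < n%:R :> R. Proof. by rewrite ltr0n. Qed.
Let r0 : 0 < r. Proof. by rewrite sqrtr_gt0. Qed.

(** The loss in trigonometric coordinates; it is measurable in the path. *)
Definition loss_of g w : R :=
  \sum_(1 <= j < N) (g j * theta (obs S w) j - fourier S j) ^+ 2 + fourier_rest S N.

Lemma loss_of_ge0 g w : 0 <= loss_of g w.
Proof.
by rewrite addr_ge0 ?(fourier_rest_ge0 N S_L2)// sumr_ge0// => j _; exact: sqr_ge0.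
Qed.

Lemma loss_ofE g w : g \in G ->
  (\int[mu]_(t in `[0%R, 1%R]) ((S_hat g (theta (obs S w)) t - S t) ^+ 2)%:E)%E =
  (loss_of g w)%:E.
Proof.
move=> gG; rewrite -(loss_trig_poly N S_L2 (fun j => g j * theta (obs S w) j)).
by apply: eq_integral => t _; rewrite (S_hat_trig_poly _ _ (GN gG)).
Qed.

Lemma measurable_theta j : (0 < j)%N -> measurable_fun setT (fun w => theta (obs S w) j).
Proof.
move=> /htheta [mt _].
have -> : (fun w => theta (obs S w) j) = (fun w => n%:R^-1 * (n%:R * theta (obs S w) j)).
  by apply/funext => w; rewrite mulKf// gt_eqF.
exact: measurable_scale.
Qed.

Lemma measurable_loss_of g : measurable_fun setT (loss_of g).
Proof.
apply: measurable_funD => //.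
rewrite (_ : (fun w => _) = (fun w => \sum_(1 <= j < N)
    (if (0 < j)%N then (g j * theta (obs S w) j - fourier S j) ^+ 2 else 0))); last first.
  by apply/funext => w; apply: eq_big_nat => j /andP[-> _].
apply: measurable_sum => -[|j] /=; first exact: measurable_cst.
apply: measurable_funX; apply: measurable_funB => //.
by apply: measurable_scale; exact: measurable_theta.
Qed.

(** Selection among finitely many weights preserves measurability. *)
Lemma loss_of_ghatE w : loss_of (ghat (obs S w)) w =
  \sum_(g <- G) \1_[set w | ghat (obs S w) = g] w * loss_of g w.
Proof.
have [_ /(_ (obs S w)) [gG _]] := hghat.
rewrite (bigD1_seq (ghat (obs S w))) ?fset_uniq//=.
rewrite indicE mem_set//= mul1r big1 ?addr0// => g /eqP gg.
by rewrite indicE memNset ?mul0r// => /= e; apply: gg; rewrite e.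
Qed.

Lemma measurable_loss_of_ghat : measurable_fun setT (fun w => loss_of (ghat (obs S w)) w).
Proof.
under eq_fun do rewrite loss_of_ghatE.
have [mghat _] := hghat.
rewrite (_ : (fun w => _) = (fun w => \sum_(g <- G) (if g \in G then
    \1_[set w | ghat (obs S w) = g] w * loss_of g w else 0))); last first.
  by apply/funext => w; rewrite big_seq [RHS]big_seq; apply: eq_bigr => g ->.
apply: measurable_sum => g; case: (boolP (g \in G)) => [gG|_]; last exact: measurable_cst.
apply: measurable_funM; last exact: measurable_loss_of.
by apply: measurable_indic; exact: mghat.
Qed.

Lemma riskE g : g \in G ->
  risk Q (fun y => S_hat g (theta y)) S = (\int[Q]_w (loss_of g w)%:E)%E.
Proof. by move=> gG; apply: eq_integral => w _; exact: loss_ofE. Qed.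

Lemma risk_ghatE :
  risk Q (fun y => S_hat (ghat y) (theta y)) S =
  (\int[Q]_w (loss_of (ghat (obs S w)) w)%:E)%E.
Proof.
apply: eq_integral => w _; apply: loss_ofE.
by have [_ /(_ (obs S w)) []] := hghat.
Qed.

Let regular w := forall j, (0 < j)%N ->
  theta (obs S w) j = fourier S j + xi Q j w / r.

Lemma ae_regular : {ae Q, forall w, regular w}.
Proof.
apply: ae_foralln => -[|j]; first by apply: aeW => w.
have := theta_noise hn HQ S_per S_L2 (htheta (ltn0Sn j)).
by apply: filterS => w E _.
Qed.

Lemma loss_of_error g w : regular w ->
  loss_of g w = error n N (fourier S) (xi Q ^~ w) g + fourier_rest S N.
Proof.
by move=> rw; congr (_ + _); apply: eq_big_nat => j /andP[j0 _]; rewrite rw.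
Qed.

Lemma cost_empirical g w : g \in G -> regular w ->
  cost n rho (theta (obs S w)) g =
  empirical_cost n N (fourier S) (xi Q ^~ w) (sigma_hat n (theta (obs S w))) rho g.
Proof.
move=> gG rw; have g0 := GN gG.
rewrite /cost /penalty /sqnorm /empirical_cost /theta_tilde.
rewrite !(@fsum_pos_nat _ _ N); try by move=> j /g0 ->; rewrite ?expr0n ?mul0r.
congr (_ - 2 * _ + _).
  by apply: eq_big_nat => j /andP[j0 _]; rewrite rw.
by apply: eq_big_nat => j /andP[j0 _]; rewrite rw.
Qed.

(** In each coordinate the mean loss is at least its variance part, and the
    variances of the noise coefficients are close to [vs] on average. *)
Lemma variance_le_risk g : g \in G ->
  ((vs * (\sum_(1 <= j < N) g j ^+ 2) / n%:R - l / n%:R)%:E <=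
   \int[Q]_w (loss_of g w)%:E)%E.
Proof.
move=> gG; have g0 := GN gG.
pose b j := (g j - 1) * fourier S j; pose c j := g j / r.
have csq j : c j ^+ 2 = g j ^+ 2 / n%:R by rewrite expr_div_n sqr_sqrtr// ler0n.
have mq j : measurable_fun setT (fun w => (b j + c j * xi Q j w) ^+ 2).
  apply: measurable_funX; apply: measurable_funD => //.
  by apply: measurable_scale; exact: (measurable_xi HQ).
apply: (@le_trans _ _ (\int[Q]_w (\sum_(1 <= j < N) (b j + c j * xi Q j w) ^+ 2)%:E)%E).
  under eq_integral do rewrite -sumEFin.
  rewrite ge0_integral_sum//; last 2 first.
  - by move=> j; exact/measurable_EFinP.
  - by move=> j w _; rewrite lee_fin sqr_ge0.
  apply: (@le_trans _ _ (\sum_(1 <= j < N) (c j ^+ 2 * xi_var Q j)%:E)%E).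
    rewrite sumEFin lee_fin.
    have := @L1_bound _ _ _ _ _ HL (fun j => g j ^+ 2) N.
    have h1 j : -1 <= g j ^+ 2 <= 1.
      have /andP[gj0 gj1] := weight01 hG gG j.
      by rewrite (le_trans _ (sqr_ge0 _)) ?lerN10//= expr_le1.
    have h2 : supp_le n (fun j => g j ^+ 2).
      have := weight_supp_le hG gG; rewrite /supp_le /nsupp.
      have -> // : supp (fun j => g j ^+ 2) = supp g.
      by apply/funext => j; rewrite /supp /= sqrf_eq0.
    move=> /(_ h1 h2 (fun j jN => etrans (congr1 (fun x => x ^+ 2) (g0 j jN)) (expr0n _ _))).
    rewrite ler_norml => /andP[+ _].
    under eq_bigr do rewrite mulrBr.
    rewrite sumrB -mulr_suml => h.
    have -> : \sum_(1 <= j < N) c j ^+ 2 * xi_var Q j =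
        (\sum_(1 <= j < N) g j ^+ 2 * xi_var Q j) / n%:R.
      by rewrite mulr_suml; apply: eq_bigr => j _; rewrite csq mulrAC.
    by rewrite -mulrBl ler_wpM2r ?invr_ge0 ?ler0n//; move: h; lra.
  rewrite big_seq [leRHS]big_seq; apply: lee_sum => j.
  rewrite mem_index_iota => /andP[j0 _].
  exact: (sq_int_affine_xi_ge hn HQ).
apply: ae_ge0_le_integral => //.
- by move=> w _; rewrite lee_fin sumr_ge0// => j _; exact: sqr_ge0.
- by apply/measurable_EFinP; exact: measurable_sum.
- by move=> w _; rewrite lee_fin loss_of_ge0.
- by apply/measurable_EFinP; exact: measurable_loss_of.
- apply: filterS ae_regular => w rw _; rewrite lee_fin loss_of_error//.
  rewrite ler_wpDr ?(fourier_rest_ge0 N S_L2)// le_eqVlt; apply/orP; left; apply/eqP.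
  by apply: eq_bigr => j _; rewrite /b /c /perturbed; congr (_ ^+ 2); ring.
Qed.

Local Notation fluct_of a w := (fluct_stat N (xi Q ^~ w) (xi_var Q) a).
Local Notation cross_of x w := (cross_stat N (fourier S) (xi Q ^~ w) x).

Let sigma_gt0 : 0 < sigmaQ. Proof. by case: HQ. Qed.

Lemma fluct_of_ge0 a w : 0 <= fluct_of a w.
Proof. by rewrite divr_ge0 ?sqr_ge0// sumr_ge0// => j _; exact: sqr_ge0. Qed.

Lemma signal_sq_ge0 x : 0 <= signal_sq N (fourier S) x.
Proof. by apply: sumr_ge0 => j _; rewrite mulr_ge0 ?sqr_ge0. Qed.

Lemma cross_of_ge0 x w : 0 <= cross_of x w.
Proof. by rewrite addr_ge0// divr_ge0 ?sqr_ge0 ?signal_sq_ge0. Qed.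

Lemma measurable_fluct_of a : measurable_fun setT (fun w => fluct_of a w).
Proof.
rewrite (_ : (fun w => _) = (fun w => (\sum_(1 <= j < N) a j ^+ 2)^-1 * noise_fluct Q a N w ^+ 2)).
  by apply: measurable_scale; apply: measurable_funX; exact: (measurable_noise_fluct HQ).
by apply/funext => w; rewrite mulrC.
Qed.

Lemma integral_fluct_of_le a : a \in G -> (\int[Q]_w (fluct_of a w)%:E <= l%:E)%E.
Proof.
move=> aG; apply: integral_sq_quotient_le.
- exact: (measurable_noise_fluct HQ).
- by apply: sumr_ge0 => j _; exact: sqr_ge0.
- exact: ltW.
- by apply: (noise_fluct_sq_int_le HQ HL); [exact: weight_supp_le aG|exact: GN].
Qed.

Let signal_noise_w x w := signal_noise N (fourier S) (xi Q ^~ w) x.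

Let measurable_signal_noise x : measurable_fun setT (signal_noise_w x).
Proof. exact: (measurable_noise_sum HQ (fun j => x j * fourier S j)). Qed.

Let measurable_cross_part (x y : nat -> R) :
  measurable_fun setT (fun w => signal_noise_w y w ^+ 2 / signal_sq N (fourier S) x).
Proof.
rewrite (_ : (fun w => _) =
    (fun w => (signal_sq N (fourier S) x)^-1 * signal_noise_w y w ^+ 2)).
  by apply: measurable_scale; apply: measurable_funX; exact: measurable_signal_noise.
by apply/funext => w; rewrite mulrC.
Qed.

Let integral_cross_part (x y : nat -> R) : (forall j, y j ^+ 2 <= x j ^+ 2) ->
  (\int[Q]_w (signal_noise_w y w ^+ 2 / signal_sq N (fourier S) x)%:E <= sigmaQ%:E)%E.
Proof.
move=> yx; apply: integral_sq_quotient_le => //.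
- exact: signal_sq_ge0.
- exact: ltW.
rewrite (le_trans (noise_sum_sq_int_le hn HQ (fun j => y j * fourier S j) N))//.
rewrite lee_fin ler_wpM2l ?(ltW sigma_gt0)//; apply: ler_sum => j _.
by rewrite exprMn ler_wpM2r ?sqr_ge0.
Qed.

Lemma measurable_cross_of x : measurable_fun setT (fun w => cross_of x w).
Proof.
apply: measurable_funD; first exact: (measurable_cross_part x x).
exact: (measurable_cross_part x (fun j => x j ^+ 2)).
Qed.

Lemma integral_cross_of_le x : (forall j, -1 <= x j <= 1) ->
  (\int[Q]_w (cross_of x w)%:E <= (2 * sigmaQ)%:E)%E.
Proof.
move=> x1; rewrite /cross_stat.
under eq_integral do rewrite -[X in X + _]mul1r.
rewrite ge0_integral_axpy//.
- rewrite mul1e (_ : 2 * sigmaQ = sigmaQ + sigmaQ); last by rewrite mulr_natl mulr2n.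
  rewrite EFinD leeD//; first exact: (@integral_cross_part x x).
  apply: (@integral_cross_part x (fun j => x j ^+ 2)) => j.
  have x2 : x j ^+ 2 <= 1.
    rewrite -real_normK ?num_real// expr_le1// ler_norml.
    by have /andP[-> ->] := x1 j.
  by rewrite expr2 ler_piMl ?sqr_ge0.
- exact: (measurable_cross_part x x).
- by move=> w; rewrite divr_ge0 ?sqr_ge0 ?signal_sq_ge0.
- exact: (measurable_cross_part x (fun j => x j ^+ 2)).
- by move=> w; rewrite divr_ge0 ?sqr_ge0 ?signal_sq_ge0.
Qed.

Local Notation nu := (#|` G|%:R : R).
Local Notation size_max := ((\max_(g <- G) nsupp g)%:R : R).
Local Notation kappa := (kappa_star n l V sg_sup D).

Let r1 : 0 < 1 - rho. Proof. by move: rho_lt; lra. Qed.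

(** The pointwise comparison integrated: each random term is replaced by its
    sum over the weight set, so that the mean can be taken. *)
Lemma integrated_oracle g : g \in G ->
  ((1 - 3 * rho)%:E * \int[Q]_w (loss_of (ghat (obs S w)) w)%:E <=
   (1 + rho)%:E * \int[Q]_w (loss_of g w)%:E +
   (2 * (1 - rho) / (n%:R * rho * vs) * (nu * l)
    + ((1 - rho) * 2 * (1 + rho) * size_max / n%:R * (3 * kappa / r)
    + ((n%:R * rho)^-1 * (nu * (2 * sigmaQ))
    + (1 - rho) * (4 * l / n%:R +
        2 * rho * (vs * (\sum_(1 <= j < N) g j ^+ 2) / n%:R)))))%:E)%E.
Proof.
move=> gG.
have mS : measurable_fun (`[0, 1]%classic : set R) S by case: S_L2.
have D0 : 0 <= D := total_variation_ge0 dS.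
have tailE := fourier_tail_bound S_C1 dS_int S_per mS hn.
have [H [mH H0 dom iH]] := variance_estimator_L1 hn HQ HL l_gt0 vs_gt0 vsV sigma_le D0 tailE.
set A := \sum_(1 <= j < N) g j ^+ 2.
have A0 : 0 <= A by apply: sumr_ge0 => j _; exact: sqr_ge0.
have maxG a : a \in G -> (nsupp a)%:R <= size_max.
  by move=> aG; rewrite ler_nat; apply: (@leq_bigmax_seq _ _ xpredT (fun a : nat -> R => nsupp a)).
have max0 : 0 <= size_max by rewrite ler0n.
have nr0 : 0 < n%:R * rho by rewrite mulr_gt0.
have nrv0 : 0 < n%:R * rho * vs by rewrite mulr_gt0.
pose c2 := 2 * (1 - rho) / (n%:R * rho * vs).
pose c3 := (1 - rho) * 2 * (1 + rho) * size_max / n%:R.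
pose c4 := (n%:R * rho)^-1.
pose c0 := (1 - rho) * (4 * l / n%:R + 2 * rho * (vs * A / n%:R)).
have rho1 : 0 <= 1 + rho by rewrite addr_ge0// ltW.
have c2_ge0 : 0 <= c2 by apply: divr_ge0; [rewrite mulr_ge0// ltW|exact: ltW].
have c3_ge0 : 0 <= c3 by rewrite divr_ge0 ?ler0n// !mulr_ge0// ltW.
have c4_ge0 : 0 <= c4 by rewrite invr_ge0 ltW.
have c0_ge0 : 0 <= c0.
  apply: mulr_ge0; first exact: ltW.
  apply: addr_ge0; first by rewrite divr_ge0 ?ler0n// mulr_ge0// ltW.
  apply: mulr_ge0; first by rewrite mulr_ge0// ltW.
  by rewrite divr_ge0 ?ler0n// mulr_ge0// ltW.
pose f2 w := \sum_(a <- G) fluct_of a w.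
pose f4 w := \sum_(a <- G) cross_of (fun j => a j - g j) w.
have mf2 : measurable_fun setT f2 by apply: measurable_sum => a; exact: measurable_fluct_of.
have mf4 : measurable_fun setT f4 by apply: measurable_sum => a; exact: measurable_cross_of.
have f20 w : 0 <= f2 w by apply: sumr_ge0 => a _; exact: fluct_of_ge0.
have f40 w : 0 <= f4 w by apply: sumr_ge0 => a _; exact: cross_of_ge0.
pose B w := (1 + rho) * loss_of g w + (c2 * f2 w + (c3 * H w + (c4 * f4 w + c0))).
have mB4 : measurable_fun setT (fun w => c4 * f4 w + c0).
  by apply: measurable_funD => //; exact: measurable_scale.
have mB3 : measurable_fun setT (fun w => c3 * H w + (c4 * f4 w + c0)).
  by apply: measurable_funD => //; exact: measurable_scale.
have mB2 : measurable_fun setT (fun w => c2 * f2 w + (c3 * H w + (c4 * f4 w + c0))).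
  by apply: measurable_funD => //; exact: measurable_scale.
have B40 w : 0 <= c4 * f4 w + c0 by rewrite addr_ge0// mulr_ge0.
have B30 w : 0 <= c3 * H w + (c4 * f4 w + c0) by rewrite addr_ge0// mulr_ge0.
have B20 w : 0 <= c2 * f2 w + (c3 * H w + (c4 * f4 w + c0)) by rewrite addr_ge0// mulr_ge0.
have mB : measurable_fun setT B.
  by apply: measurable_funD => //; apply: measurable_scale; exact: measurable_loss_of.
have r30 : 0 <= 1 - 3 * rho by move: rho_lt; lra.
have pointwise w : regular w -> (1 - 3 * rho) * loss_of (ghat (obs S w)) w <= B w.
  move=> rw; have [_ /(_ (obs S w)) [hG' hmin]] := hghat.
  set h := ghat (obs S w) in hG' hmin *.
  have := hmin _ gG; rewrite !cost_empirical// => cost_le.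
  set sg := sigma_hat n _ in cost_le.
  have bias a : a \in G -> `|bias_sum N (xi_var Q) vs a| <= l.
    move=> aG; apply: (L1_bound HL); [|exact: weight_supp_le aG|exact: GN].
    by move=> j; have /andP[aj ->] := weight01 hG aG j; rewrite (le_trans _ aj)// lerN10.
  have sq a : a \in G -> 0 < \sum_(1 <= j < N) a j ^+ 2 <= size_max.
    move=> aG; have /andP[-> ale] := weight_sq_sum_le hG aG (GN aG).
    exact: le_trans ale (maxG _ aG).
  have sm a : a \in G -> 0 <= \sum_(1 <= j < N) a j <= size_max.
    move=> aG; have /andP[-> ale] := weight_sum_le hG aG (GN aG).
    exact: le_trans ale (maxG _ aG).
  have := pointwise_oracle hn vs_gt0 rho_gt0 rho_lt cost_le (bias _ hG') (bias _ gG)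
    (sq _ hG') (sq _ gG) (sm _ hG') (sm _ gG).
  have fl : (fluct_of h w + fluct_of g w) / (n%:R * rho * vs) <=
      2 * (f2 w / (n%:R * rho * vs)).
    rewrite mulrA ler_wpM2r ?invr_ge0 ?(ltW nrv0)// mulr_natl mulr2n lerD//.
      by apply: (@ler_sum_mem _ _ _ (fun a => fluct_of a w)) => // a; exact: fluct_of_ge0.
    by apply: (@ler_sum_mem _ _ _ (fun a => fluct_of a w)) => // a; exact: fluct_of_ge0.
  have cr : cross_of (fun j => h j - g j) w / (n%:R * rho) <= c4 * f4 w.
    rewrite mulrC ler_wpM2l//.
    by apply: (@ler_sum_mem _ _ _ (fun a => cross_of (fun j => a j - g j) w)) => // a;
      exact: cross_of_ge0.
  have sgH : 2 * (1 + rho) * size_max * `|sg - vs| / n%:R <=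
      2 * (1 + rho) * size_max * H w / n%:R.
    rewrite ler_wpM2r ?invr_ge0 ?ler0n// ler_wpM2l ?mulr_ge0//.
    by apply: dom => j; exact: rw.
  move=> main; rewrite /B !loss_of_error//.
  have rest := fourier_rest_ge0 N S_L2.
  have -> : c2 * f2 w = (1 - rho) * (2 * (f2 w / (n%:R * rho * vs))) by rewrite /c2; ring.
  have -> : c3 * H w = (1 - rho) * (2 * (1 + rho) * size_max * H w / n%:R) by rewrite /c3; ring.
  have fl' := ler_wpM2l (ltW r1) fl; have sgH' := ler_wpM2l (ltW r1) sgH.
  have rest' : 0 <= rho * fourier_rest S N by rewrite mulr_ge0// ltW.
  apply: (@le_trans _ _ ((1 - 3 * rho) * error n N (fourier S) (xi Q ^~ w) h +
     (1 - 3 * rho) * fourier_rest S N)); first by rewrite mulrDr.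
  rewrite /c0.
  move: main fl' sgH' cr rest rest'; rewrite -/A.
  move: (fluct_of h w + _) => X; move: (X / _) (f2 w / _) (c4 * f4 w) => x1 x2 x3.
  move: (_ * `|sg - vs| / _) (_ * H w / _) (cross_of _ w / _) => x4 x5 x6.
  move: (error _ _ _ _ h) (error _ _ _ _ g) (fourier_rest S N) (4 * l / _) (_ * (vs * A / _)).
  move=> eh eg rst x7 x8; lra.
rewrite -ge0_integralZl//; last 2 first.
- by apply/measurable_EFinP; exact: measurable_loss_of_ghat.
- by move=> w _; rewrite lee_fin loss_of_ge0.
apply: (@le_trans _ _ (\int[Q]_w (B w)%:E)%E).
  apply: ae_ge0_le_integral => //.
  - by move=> w _; rewrite -EFinM lee_fin mulr_ge0// loss_of_ge0.
  - by apply: measurable_funeM; apply/measurable_EFinP; exact: measurable_loss_of_ghat.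
  - by move=> w _; rewrite lee_fin /B addr_ge0// mulr_ge0// loss_of_ge0.
  - exact/measurable_EFinP.
  - by apply: filterS ae_regular => w rw _; rewrite -EFinM lee_fin pointwise.
rewrite /B ge0_integral_axpy//; [|exact: measurable_loss_of|by move=> w; exact: loss_of_ge0].
rewrite leeD2l//.
rewrite ge0_integral_axpy// ge0_integral_axpy// ge0_integral_axpy//.
rewrite integral_cst//= probability_setT mule1.
rewrite 3!EFinD leeD//.
  rewrite (EFinM c2) lee_wpmul2l ?lee_fin//; apply: integral_sum_le.
  - exact: measurable_fluct_of.
  - exact: fluct_of_ge0.
  - exact: integral_fluct_of_le.
rewrite leeD//; first by rewrite (EFinM c3) lee_wpmul2l ?lee_fin.
rewrite leeD2r// (EFinM c4) lee_wpmul2l ?lee_fin//; apply: integral_sum_le.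
- by move=> a; exact: measurable_cross_of.
- by move=> a; exact: cross_of_ge0.
- move=> a aG; apply: integral_cross_of_le => j.
  have := weight01 hG aG j; have := weight01 hG gG j; lra.
Qed.

End OneLaw.

(** * Suprema over the laws and minimum over the weights *)

Section Constants.
Context {R : realType}.

Lemma kappa_star_ge0 (n : nat) (l V sg D : R) :
  0 <= l -> 0 <= V -> 0 <= D -> 0 <= kappa_star n l V sg D.
Proof.
move=> l0 V0 D0; rewrite /kappa_star !addr_ge0 ?mulr_ge0 ?sqr_ge0 ?sqrtr_ge0//;
  by rewrite invr_ge0 powR_ge0.
Qed.

(** The arithmetic of the constants: the variance of the competitor is paid by
    its risk, and everything else is of order [1 / n]. *)
Lemma oracle_constants (n nu m : nat) (rho l vi vs V sigma sg D A X x : R) :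
  (0 < n)%N -> 0 < rho -> rho < 1 / 3 -> 0 < l -> 0 < vi -> vi <= vs -> vs <= V ->
  0 < sigma -> sigma <= sg -> 0 <= D ->
  vs * A / n%:R - l / n%:R <= x ->
  (1 - 3 * rho) * X <= (1 + rho) * x +
   (2 * (1 - rho) / (n%:R * rho * vs) * (nu%:R * l)
    + ((1 - rho) * 2 * (1 + rho) * m%:R / n%:R * (3 * kappa_star n l V sg D / Num.sqrt n%:R)
    + ((n%:R * rho)^-1 * (nu%:R * (2 * sigma))
    + (1 - rho) * (4 * l / n%:R + 2 * rho * (vs * A / n%:R))))) ->
  X <= (1 + 3 * rho - 2 * rho ^+ 2) / (1 - 3 * rho) * x +
    n%:R^-1 * B_star n rho l vi V sg nu m D.
Proof.
move=> n0 rho0 rho3 l0 vi0 vivs vsV sigma0 sigma_le D0 var main.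
have n0' : 0 < n%:R :> R by rewrite ltr0n.
have r0 : 0 < Num.sqrt n%:R :> R by rewrite sqrtr_gt0.
have d0 : 0 < 1 - 3 * rho by move: rho3; lra.
have vs0 : 0 < vs := lt_le_trans vi0 vivs.
have V0 : 0 < V := lt_le_trans vs0 vsV.
have sg0 : 0 < sg := lt_le_trans sigma0 sigma_le.
have k0 := kappa_star_ge0 n sg (ltW l0) (ltW V0) D0.
rewrite /B_star; move: main k0; set kappa := kappa_star _ _ _ _ _ => main k0.
pose nu' : R := nu%:R; pose m' : R := m%:R.
have nu0 : 0 <= nu' by rewrite ler0n.
have m0 : 0 <= m' by rewrite ler0n.
have r01 : 0 < 1 - rho by move: rho3; lra.
have nr : 0 < n%:R * rho by rewrite mulr_gt0.
(* The four remainders: quadratic noise, variance estimator, cross term, bias. *)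
have t1 : 2 * (1 - rho) / (n%:R * rho * vs) * (nu' * l) <=
    2 * nu' * l / (n%:R * rho * vi).
  have -> : 2 * (1 - rho) / (n%:R * rho * vs) * (nu' * l) =
      2 * nu' * l / (n%:R * rho) * ((1 - rho) / vs).
    by field; rewrite !gt_eqF.
  have -> : 2 * nu' * l / (n%:R * rho * vi) = 2 * nu' * l / (n%:R * rho) * vi^-1.
    by field; rewrite !gt_eqF.
  rewrite ler_wpM2l//.
    by rewrite divr_ge0 ?(ltW nr)// !mulr_ge0// ltW.
  rewrite ler_pdivrMr// mulrC ler_pdivlMr//.
  have : (1 - rho) * vi <= 1 * vi by rewrite ler_wpM2r ?(ltW vi0)//; move: rho0; lra.
  by move: vivs; lra.
have t2 : (1 - rho) * 2 * (1 + rho) * m' / n%:R * (3 * kappa / Num.sqrt n%:R) <=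
    6 * m' * kappa / (n%:R * Num.sqrt n%:R).
  have -> : (1 - rho) * 2 * (1 + rho) * m' / n%:R * (3 * kappa / Num.sqrt n%:R) =
      (1 - rho ^+ 2) * (6 * m' * kappa / (n%:R * Num.sqrt n%:R)).
    by field; rewrite !gt_eqF.
  rewrite ler_piMl//; first by rewrite divr_ge0 ?mulr_ge0// ltW.
  by have := sqr_ge0 rho; lra.
have Vvi : 1 <= V / vi by rewrite ler_pdivlMr// mul1r (le_trans vivs).
have t3 : (n%:R * rho)^-1 * (nu' * (2 * sigma)) <= 2 * V * sg * nu' / (n%:R * rho * vi).
  have -> : 2 * V * sg * nu' / (n%:R * rho * vi) =
      (n%:R * rho)^-1 * (nu' * (2 * (sg * (V / vi)))).
    by field; rewrite !gt_eqF.
  rewrite ler_wpM2l ?invr_ge0 ?(ltW nr)// ler_wpM2l// ler_wpM2l//.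
  by rewrite (le_trans sigma_le)// ler_peMr// ltW.
have t4 : (1 - rho) * (4 * l / n%:R) + 2 * rho * (1 - rho) * (l / n%:R) <=
    4 * V * l / (n%:R * rho * vi).
  have -> : 4 * V * l / (n%:R * rho * vi) = (l / n%:R) * (4 * (V / vi) / rho).
    by field; rewrite !gt_eqF.
  have -> : (1 - rho) * (4 * l / n%:R) + 2 * rho * (1 - rho) * (l / n%:R) =
    (l / n%:R) * ((1 - rho) * (4 + 2 * rho)) by ring.
  rewrite ler_wpM2l//; first by rewrite divr_ge0 ?ler0n// ltW.
  rewrite ler_pdivlMr// (@le_trans _ _ 4)//; last by move: Vvi; lra.
  have h1 : (1 - rho) * (4 + 2 * rho) <= 4 by have := sqr_ge0 rho; move: rho0; lra.
  have h2 : 0 <= (1 - rho) * (4 + 2 * rho) by rewrite mulr_ge0 ?(ltW r01)//; move: rho0; lra.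
  rewrite (@le_trans _ _ ((1 - rho) * (4 + 2 * rho) * 1))//; last by rewrite mulr1.
  by rewrite ler_wpM2l//; move: rho3; lra.
have paid : 2 * rho * (1 - rho) * (vs * A / n%:R) <=
    2 * rho * (1 - rho) * x + 2 * rho * (1 - rho) * (l / n%:R).
  rewrite -mulrDr ler_wpM2l//; last by move: var; lra.
  by rewrite !mulr_ge0// ltW.
have -> : (1 + 3 * rho - 2 * rho ^+ 2) / (1 - 3 * rho) * x +
    n%:R^-1 * (Psi_star rho l vi V sg nu
      + 6 * m%:R * kappa / ((1 - 3 * rho) * Num.sqrt n%:R)) =
  ((1 + 3 * rho - 2 * rho ^+ 2) * x + (2 * nu' * l / (n%:R * rho * vi)
   + 6 * m' * kappa / (n%:R * Num.sqrt n%:R) + 2 * V * sg * nu' / (n%:R * rho * vi)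
   + 4 * V * l / (n%:R * rho * vi))) / (1 - 3 * rho).
  by rewrite /Psi_star -/nu' -/m'; field; rewrite !gt_eqF.
rewrite ler_pdivlMr// mulrC (le_trans main)//.
move: t1 t2 t3 t4 paid; rewrite -/nu' -/m'.
move: (_ / (n%:R * rho * vs) * (nu' * l)) (2 * nu' * l / _) => a1 b1.
move: (_ * (3 * kappa / _)) (_ / (n%:R * Num.sqrt n%:R)) => a2 b2.
move: (_ * (nu' * (2 * sigma))) (_ * sg * nu' / _) => a3 b3.
move: (4 * V * l / _) (4 * l / _) (vs * A / _) (l / _) => b4 y z u.
nra.
Qed.

Lemma bigmin_attained (I : eqType) (s : seq I) (F : I -> \bar R) : s != [::] ->
  exists2 i, i \in s & \big[Order.min/+oo%E]_(j <- s) F j = F i.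
Proof.
elim: s => // i s IH _; rewrite big_cons.
have [->|/IH [j js ->]] := eqVneq s [::].
  by exists i; rewrite ?mem_head// big_nil; apply/min_idPl; rewrite leey.
have [ij|ij] := leP (F i) (F j); first by exists i; rewrite ?mem_head.
by exists j; rewrite ?in_cons ?js ?orbT.
Qed.

End Constants.

Unset Implicit Arguments.

Theorem theorem3p5 (R : realType) (n : nat) (hn : (0 < n)%N)
    (QQ : set (probability (skorokhod (n%:R : R)) R))
    (sigma varsigma : probability (skorokhod (n%:R : R)) R -> R)
    (l : nat -> R)
    (l_gt0 : forall k, 0 < l k)
    (l_incr : nondecreasing_seq l)
    (l_infty : l @ \oo --> +oo)
    (l_slow : forall delta : R, 0 < delta ->
       (fun k => l k / k%:R `^ delta) @ \oo --> (0 : R))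
    (QQ_neq0 : QQ !=set0)
    (QQ_semimartingale : forall Q, QQ Q -> semimartingale_law Q)
    (QQ_noise : forall Q, QQ Q -> noise_condition Q (sigma Q))
    (varsigma_gt0 : forall Q, QQ Q -> 0 < varsigma Q)
    (QQ_L : forall Q, QQ Q -> (L1 (varsigma Q) Q + L2 Q <= (l n)%:E)%E)
    (varsigma_inf_gt0 : 0 < inf (varsigma @` QQ))
    (varsigma_bounded : has_ubound (varsigma @` QQ))
    (sigma_bounded : has_ubound (sigma @` QQ))
    (S dS : R -> R)
    (S_periodic : forall t, S (t + 1) = S t)
    (S_L2 : L2_on 0 1 S)
    (S_C1 : C1_with_derivative S dS)
    (dS_integrable : lebesgue_measure.-integrable `[0, 1[ (EFin \o dS))
    (rho : R) (rho_gt0 : 0 < rho) (rho_lt : rho < 1 / 3)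
    (G : {fset (nat -> R)}) (hG : weight_set n G)
    (theta : (R -> R) -> nat -> R) (htheta : is_fourier_estimator QQ S theta)
    (ghat : (R -> R) -> nat -> R)
    (hghat : model_selection n rho G S theta ghat) :
  (robust_risk QQ (fun y => S_hat (ghat y) (theta y)) S <=
   ((1 + 3 * rho - 2 * rho ^+ 2) / (1 - 3 * rho))%:E *
     \big[Order.min/+oo]_(g <- G) robust_risk QQ (fun y => S_hat g (theta y)) S
   + (n%:R^-1 *
      B_star n rho (l n) (inf (varsigma @` QQ)) (sup (varsigma @` QQ))
        (sup (sigma @` QQ)) #|` G| (\max_(g <- G) nsupp g)
        (\int[lebesgue_measure]_(t in `[0, 1[) `|dS t|))%:E)%E.
Proof.
have Gn0 : enum_fset G != [::].
  by case: hG => + _; rewrite -cardfs_eq0; case: (enum_fset G).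
have [g gG ->] := bigmin_attained
  (fun g => robust_risk QQ (fun y => S_hat g (theta y)) S) Gn0.
have [N nN GN] := weight_set_bound hG.
have d0 : 0 < 1 - 3 * rho by lra.
have c0 : 0 < (1 + 3 * rho - 2 * rho ^+ 2) / (1 - 3 * rho).
  by rewrite divr_gt0//; nra.
apply: ub_ereal_sup => _ [Q QQQ <-].
have sigma_le : sigma Q <= sup (sigma @` QQ) by apply: ub_le_sup => //; exists Q.
have vs_le : varsigma Q <= sup (varsigma @` QQ) by apply: ub_le_sup => //; exists Q.
have vs_ge : inf (varsigma @` QQ) <= varsigma Q.
  apply: ge_inf; last by exists Q.
  by exists 0 => _ [P QP <-]; rewrite ltW// varsigma_gt0.
have HQ := QQ_noise Q QQQ; have HL := QQ_L Q QQQ.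
have vs0 := varsigma_gt0 Q QQQ.
have ht j (j0 : (0 < j)%N) := htheta Q j QQQ j0.
have main := integrated_oracle hn HQ HL (l_gt0 n) vs0 vs_le sigma_le S_C1 dS_integrable
  S_periodic S_L2 rho_gt0 rho_lt hG ht hghat GN gG.
have var := variance_le_risk hn HQ HL S_periodic S_L2 hG ht GN gG.
set robust := robust_risk QQ (fun y => S_hat g (theta y)) S.
have risk_le : (\int[Q]_w (loss_of S theta N g w)%:E <= robust)%E.
  rewrite -(riskE Q S_L2 theta GN gG).
  by apply: ereal_sup_ubound; exists Q.
rewrite (risk_ghatE Q S_L2 hghat GN).
have D0 := total_variation_ge0 dS.
have Y0 : (0 <= \int[Q]_w (loss_of S theta N (ghat (obs S w)) w)%:E)%E.
  by apply: integral_ge0 => w _; rewrite lee_fin; apply: loss_of_ge0.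
have x0 : (0 <= \int[Q]_w (loss_of S theta N g w)%:E)%E.
  by apply: integral_ge0 => w _; rewrite lee_fin; apply: loss_of_ge0.
have sigma0 : 0 < sigma Q by case: HQ.
move: main var risk_le x0 Y0.
move: (integral Q setT (fun w => (loss_of S theta N g w)%:E)) => x.
move: (integral Q setT (fun w => (loss_of S theta N (ghat (obs S w)) w)%:E)) => Y.
case: robust => [rr| |]; last 2 first.
- by rewrite gt0_muley ?lte_fin// addye ?leey.
- by move=> _ _ xr /le_trans /(_ xr).
case: x => [x| |] //; case: Y => [Y| |].
- rewrite -!EFinM -!EFinD !lee_fin => main var xr _ _.
  have := oracle_constants hn rho_gt0 rho_lt (l_gt0 n) varsigma_inf_gt0 vs_ge vs_le
    sigma0 sigma_le D0 var main.
  by move=> /le_trans; apply; rewrite lerD2r ler_wpM2l// ltW.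
- by rewrite gt0_muley ?lte_fin// -EFinM -EFinD leye_eq.
- by [].
Qed.
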